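(* Let $g:[-1,1]\to\mathbb{R}$ and $\psi:\mathcal{M}_+\to\mathbb{R}$ satisfy: (H1) $g$ is continuously differentiable and there is $m>0$ with $g(x)\ge m$ for all $x\in[-1,1]$; (H2) $|\psi(\mu)-\psi(\nu)|\le \|\psi\|_{\mathrm{Lip},\mathrm{TV}}\,\mathrm{TV}(\mu,\nu)$ for all $\mu,\nu\in\mathcal{M}_+$; (H3) there exists $a>0$ such that for every integer $K\ge1$, $\nabla\psi^{(K)}\in L^\infty(\mathbb{R}_{\ge0}^{D_K};\mathcal{K}_{a,K}')$; (H4) there is a constant $\|\psi\|_{\mathrm{Lip},W}<\infty$ with $|\psi(\mathbb{P})-\psi(\mathbb{Q})|\le\|\psi\|_{\mathrm{Lip},W}W(\mathbb{P},\mathbb{Q})$ for all probability measures $\mathbb{P},\mathbb{Q}$ on $[-1,1]$. For each integer $K\ge1$ and each real $R>\|\psi\|_{\mathrm{Lip},\mathrm{TV}}$, let $f_R^{(K)}\in\mathfrak{L}_{\mathrm{unif}}$ be the unique viscosity solution of $\partial_tf=\mathsf{H}_{K,R}(\nabla f)$ on $\mathbb{R}_{>0}\times\mathbb{R}_{>0}^{D_K}$ with initial condition $\psi^{(K)}$. Then for every $t\ge0$ and every $\mu\in\mathcal{M}_+$, the limit $$f(t,\mu)=\lim_{K\to\infty}f_R^{(K)}\big(t,x^{(K)}(\mu)\big)$$ exists, is finite, and is independent of $R$. (The value of this limit is defined to be the solution to the infinite-dimensional Hamilton-Jacobi equation $\partial_tf(t,\mu)=\mathsf{C}_\infty(D_\mu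 f(t,\mu))$ on $\mathbb{R}_{>0}\times\mathcal{M}_+$ with $f(0,\mu)=\psi(\mu)$.)
   Context: $\mathcal{M}_+$ is the set of finite non-negative measures on $[-1,1]$, $\mathrm{TV}(\mu,\nu)=\sup_A|\mu(A)-\nu(A)|$ over measurable $A\subset[-1,1]$, and $W(\mathbb{P},\mathbb{Q})=\sup\{|\int h\,d\mathbb{P}-\int h\,d\mathbb{Q}|: h:[-1,1]\to\mathbb{R}\text{ 1-Lipschitz}\}$. $\|\psi\|_{\mathrm{Lip},\mathrm{TV}}$ denotes the Lipschitz constant in (H2). For an integer $K\ge1$, $D_K=\{i/2^K: i\in\mathbb{Z},\ -2^K\le i<2^K\}$, so $|D_K|=2^{K+1}$; vectors in $\mathbb{R}^{D_K}$ are indexed by $D_K$. For $x\in\mathbb{R}_{\ge0}^{D_K}$ let $\mu_x^{(K)}=\frac1{|D_K|}\sum_{k\in D_K}x_k\delta_k$, and $\psi^{(K)}(x)=\psi(\mu_x^{(K)})$. For $\mu\in\mathcal{M}_+$, $x^{(K)}(\mu)=(|D_K|\,\mu(I_k))_{k\in D_K}$, where $I_k=[k,k+2^{-K})$ for $k\neq 1-2^{-K}$ and $I_{1-2^{-K}}=[1-2^{-K},1]$. Let $G^{(K)}=|D_K|^{-2}(g(kk'))_{k,k'\in D_K}$. Normalized norms on $\mathbb{R}^d$ (with $d=|D_K|$ for $\mathbb{R}^{D_K}$): $\|x\|_1=\frac1d\sum_k|x_k|$ and $\|y\|_{1,*}=\max_k d|y_k|$. For $h:\mathbb{R}_{\ge0}^d\to\mathbb{R}$,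 $\|h\|_{\mathrm{Lip},1}=\sup_{x\ne x'}|h(x)-h(x')|/\|x-x'\|_1$. Inequalities between vectors are coordinatewise. $\mathcal{K}_{a,K}=\{G^{(K)}x: x\in\mathbb{R}_{\ge0}^{D_K},\ \|x\|_1\le a\}$ and $\mathcal{K}_{a,K}'=\{y+w: y\in\mathcal{K}_{a,K},\ \|w\|_{1,*}\le|D_K|^{-1/2}\}$. (H3) means that the a.e. defined gradient of the Lipschitz function $\psi^{(K)}$ lies in $\mathcal{K}_{a,K}'$ almost everywhere. The non-linearity: $\mathcal{C}_K=\{G^{(K)}x: x\in\mathbb{R}_{\ge0}^{D_K}\}$ and $\mathsf{C}_K:\mathcal{C}_K\to\mathbb{R}$, $\mathsf{C}_K(G^{(K)}x)=\frac12 G^{(K)}x\cdot x$ (well-defined). For $R>0$ define $\widetilde{\mathsf C}_{K,R}:\mathcal{C}_K\to\mathbb{R}$ by $\widetilde{\mathsf C}_{K,R}(y)=\max\big(\mathsf{C}_K(y),\frac{8R}{m}(\|y\|_{1,*}-R)\big)$ if $\|y\|_{1,*}\le2R$ and $\widetilde{\mathsf C}_{K,R}(y)=\frac{8R}{m}(\|y\|_{1,*}-R)$ otherwise, and $\mathsf{H}_{K,R}:\mathbb{R}^{D_K}\to\mathbb{R}$ by $\mathsf{H}_{K,R}(y)=\inf\{\widetilde{\mathsf C}_{K,R}(w): w\in\mathcal{C}_K,\ w\ge y\}$. Function spaces: for $u:[0,\infty)\times\mathbb{R}_{\ge0}^d\to\mathbb{R}$, $[u]_0=\sup_{t>0,x}|u(t,x)-u(0,x)|/t$;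 $\mathfrak{L}$ is the set of such $u$ with $u(0,\cdot)$ Lipschitz and $[u]_0<\infty$; $\mathfrak{L}_{\mathrm{unif}}=\{u\in\mathfrak{L}:\sup_{t\ge0}\|u(t,\cdot)\|_{\mathrm{Lip},1}<\infty\}$. Viscosity solutions: a continuous function $f$ is a viscosity solution of $\partial_tf=\mathsf{H}(\nabla f)$ on $\mathbb{R}_{>0}\times\mathbb{R}_{>0}^d$ if for every $\phi\in C^\infty((0,\infty)\times\mathbb{R}_{>0}^d)$ and $(t^*,x^* )\in(0,\infty)\times\mathbb{R}_{>0}^d$: $(\partial_t\phi-\mathsf{H}(\nabla\phi))(t^*,x^* )\le0$ whenever $f-\phi$ has a local maximum at $(t^*,x^* )$, and $\ge0$ whenever $f-\phi$ has a local minimum there. Under (H1)-(H3), the equation $\partial_tf=\mathsf{H}_{K,R}(\nabla f)$ has, for each $K\geq 1$ and $R>0$, a unique viscosity solution in $\mathfrak{L}_{\mathrm{unif}}$ with initial condition $\psi^{(K)}$. For the infinite-dimensional equation (only named in the claim): $G_\mu(x)=\int g(xy)\,d\mu(y)$, $\mathsf{C}_\infty(G_\mu)=\frac12\int G_\mu\,d\mu$, and $D_\mu f$ is the density of the Gateaux derivative; the equation is given meaning only through the limit $\lim_{K\to\infty}f_R^{(K)}\big(t,x^{(K)}(\mu)\big)$ of the solutions $f_R^{(K)}$ of the finite-dimensional equations $\partial_tf=\mathsf{H}_{K,R}(\nabla f)$ with initial condition $\psi^{(K)}$, for $R>\|\psi\|_{\mathrm{Lip},\mathrm{TV}}$. 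*)

(* Defs.v *)
From HB Require Import structures.
From mathcomp Require Import all_boot all_order all_algebra.
From mathcomp Require Import all_classical all_reals all_analysis.

Set Implicit Arguments.
Unset Strict Implicit.
Unset Printing Implicit Defensive.

Import Order.TTheory GRing.Theory Num.Theory numFieldNormedType.Exports.

Local Open Scope classical_set_scope.
Local Open Scope ring_scope.

Section MeasuresOnSegment.
Context {R : realType}.

Definition seg : set R := `[-1, 1]%classic.

(* A finite measure on [-1, 1] is a finite Borel measure on R that does not
   charge the complement of [-1, 1]. *)
Record Mplus := MkMplus {
  Mplus_measure :> {finite_measure set (measurableTypeR R) -> \bar R};
  Mplus_seg : Mplus_measure (~` seg) = 0%E }.

Definition is_prob (mu : Mplus) : Prop := mu setT = 1%E.

Definition TV (mu nu : Mplus) : R :=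
  sup [set z | exists A : set (measurableTypeR R),
    [/\ measurable A, A `<=` seg & z = `|fine (mu A) - fine (nu A)|]].

Definition W (P Q : Mplus) : R :=
  sup [set z | exists h : R -> R, 1.-lipschitz_seg h /\
    z = `|Rintegral P seg h - Rintegral Q seg h|].

(* The difference quotient is taken within [-1, 1], so the derivative is
   one-sided at the endpoints. *)
Definition C1_seg (g : R -> R) : Prop :=
  exists2 g' : R -> R, {within seg, continuous g'} &
    forall x, seg x ->
      (g y - g x) / (y - x) @[y --> within seg (dnbhs x)] --> g' x.

End MeasuresOnSegment.
Arguments Mplus : clear implicits.

Section Vectors.
Context {R : realType} {d : nat}.
Implicit Types (x y a b : 'cV[R]_d).

Definition dotv x y : R := \sum_i x i 0 * y i 0.

Definition lev x y : Prop := forall i, x i 0 <= y i 0.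

Definition orthant : set 'cV[R]_d := [set x | lev 0 x].

Definition open_orthant : set 'cV[R]_d := [set x | forall i, 0 < x i 0].

Definition norm1 x : R := d%:R^-1 * \sum_i `|x i 0|.

Definition norm1s y : R := \big[Num.max/0]_i (d%:R * `|y i 0|).

Definition grad (h : 'cV[R]_d -> R) x : 'cV[R]_d :=
  \col_i 'D_(delta_mx i 0) h x.

Definition box a b : set 'cV[R]_d := [set x | lev a x /\ lev x b].

Definition box_vol a b : R := \prod_i (b i 0 - a i 0).

(* MathComp-Analysis has no Lebesgue measure on R^d; null sets are those
   of zero outer measure. *)
Definition lebesgue_null (N : set 'cV[R]_d) : Prop :=
  forall e : R, 0 < e -> exists a b : nat -> 'cV[R]_d,
    [/\ forall n, lev (a n) (b n),
        N `<=` \bigcup_n box (a n) (b n) &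
        (\sum_(0 <= n <oo) (box_vol (a n) (b n))%:E <= e%:E)%E].

Definition Lip1 (h : 'cV[R]_d -> R) : \bar R :=
  ereal_sup [set z | exists x x', [/\ orthant x, orthant x', x <> x' &
    z = (`|h x - h x'| / norm1 (x - x'))%:E]].

End Vectors.

Section HamiltonJacobi.
Context {R : realType}.

Fixpoint Ck (V : normedModType R) (n : nat) (U : set V) (phi : V -> R) : Prop :=
  (forall p, U p -> {for p, continuous phi}) /\
  match n with
  | 0 => True
  | n'.+1 => forall v, (forall p, U p -> derivable phi p v) /\
                       Ck n' U (fun p => 'D_v phi p)
  end.

Definition smooth (V : normedModType R) (U : set V) (phi : V -> R) : Prop :=
  forall n, Ck n U phi.

Context {d : nat}.
Implicit Types (u f phi : R * 'cV[R]_d -> R).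

(* Functions on [0, oo) x R_{>=0}^d are represented by total functions whose
   values outside [dom] are irrelevant. *)
Definition dom : set (R * 'cV[R]_d) := [set p | 0 <= p.1 /\ orthant p.2].

Definition open_dom : set (R * 'cV[R]_d) :=
  [set p | 0 < p.1 /\ open_orthant p.2].

Definition time_lip u : \bar R :=
  ereal_sup [set z | exists (t : R) x, [/\ 0 < t, orthant x &
    z = (`|u (t, x) - u (0, x)| / t)%:E]].

Definition frakL u : Prop :=
  (Lip1 (fun x => u (0%R, x)) < +oo)%E /\ (time_lip u < +oo)%E.

Definition frakL_unif u : Prop := frakL u /\
  (ereal_sup [set z | exists2 t : R, (0 <= t)%R & z = Lip1 (fun x => u (t, x))]
     < +oo)%E.

Definition HJ_operator (H : 'cV[R]_d -> R) phi (p : R * 'cV[R]_d) : R :=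
  derive1 (fun s => phi (s, p.2)) p.1 - H (grad (fun y => phi (p.1, y)) p.2).

Definition is_local_max f (p : R * 'cV[R]_d) : Prop :=
  \forall q \near p, f q <= f p.

Definition is_local_min f (p : R * 'cV[R]_d) : Prop :=
  \forall q \near p, f p <= f q.

Definition viscosity_solution (H : 'cV[R]_d -> R) f : Prop :=
  {within dom, continuous f} /\
  forall phi, smooth open_dom phi -> forall p, open_dom p ->
    (is_local_max (fun q => f q - phi q) p -> HJ_operator H phi p <= 0) /\
    (is_local_min (fun q => f q - phi q) p -> 0 <= HJ_operator H phi p).

End HamiltonJacobi.

Section Dyadic.
Context {R : realType}.
Variable K : nat.

(* |D_K|; the element i / 2^K of D_K, with -2^K <= i < 2^K, has index
   i + 2^K. *)
Definition cardD : nat := (2 ^ K.+1)%N.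

Definition dyad (i : 'I_cardD) : R := i%:R / 2 ^+ K - 1.

Definition dyadic_cell (i : 'I_cardD) : set R :=
  if i.+1 == cardD then `[dyad i, 1]%classic else `[dyad i, dyad i + 2 ^- K[%classic.

Definition project (mu : Mplus R) : 'cV[R]_cardD :=
  \col_i (cardD%:R * fine (mu (dyadic_cell i))).

(* Coordinates are replaced by their positive parts, so that this is a measure
   for every vector; nothing changes on the orthant. *)
Definition atomic (x : 'cV[R]_cardD) (A : set (measurableTypeR R)) : \bar R :=
  (\sum_(i < cardD) (Num.max 0 (x i 0) / cardD%:R)%:E *
     \d_(dyad i : measurableTypeR R) A)%E.

Lemma coef_ge0 (x : 'cV[R]_cardD) i : 0 <= Num.max 0 (x i 0) / cardD%:R.
Proof. by rewrite divr_ge0// le_max lexx. Qed.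

Lemma atomic0 x : atomic x set0 = 0%E.
Proof. by rewrite /atomic big1// => i _; rewrite measure0 mule0. Qed.

Lemma atomic_ge0 x A : (0 <= atomic x A)%E.
Proof. by apply: sume_ge0 => i _; rewrite mule_ge0// lee_fin coef_ge0. Qed.

Lemma atomic_sigma_additive x : semi_sigma_additive (atomic x).
Proof.
move=> F mF tF mUF; rewrite /atomic.
under eq_fun do rewrite exchange_big/=.
apply: cvg_nnesum => i _.
  apply: nearW => n; apply: sume_ge0 => j _.
  by rewrite mule_ge0// lee_fin coef_ge0.
pose nu : {measure set (measurableTypeR R) -> \bar R} :=
  mscale (NngNum (coef_ge0 x i)) \d_(dyad i : measurableTypeR R).
exact: (@measure_semi_sigma_additive _ _ _ nu F mF tF mUF).
Qed.

HB.instance Definition _ x := isMeasure.Build _ _ _ (atomic x)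
  (atomic0 x) (atomic_ge0 x) (@atomic_sigma_additive x).

Lemma atomic_fin_num x : fin_num_fun (atomic x).
Proof.
move=> A mA; rewrite /atomic; apply/sum_fin_numP => i _ _.
by rewrite fin_numM// fin_num_measure.
Qed.

HB.instance Definition _ x :=
  Measure_isFinite.Build _ _ _ (atomic x) (@atomic_fin_num x).

Lemma dyad_seg i : seg (dyad i).
Proof.
rewrite /seg /dyad/= in_itv/= -lerBlDr subrr lerBlDr; apply/andP; split.
  by rewrite divr_ge0// exprn_ge0.
rewrite ler_pdivrMr ?exprn_gt0// -[_ + _]/(2%:R) -natrX -natrM ler_nat.
by rewrite -expnS ltnW.
Qed.

Lemma atomic_seg x : atomic x (~` seg) = 0%E.
Proof.
rewrite /atomic big1// => i _; rewrite diracE memNset ?mule0//.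
by apply; exact: dyad_seg.
Qed.

Definition mu_of (x : 'cV[R]_cardD) : Mplus R :=
  @MkMplus R (atomic x) (atomic_seg x).

Definition psiK (psi : Mplus R -> R) (x : 'cV[R]_cardD) : R := psi (mu_of x).

Definition GK (g : R -> R) : 'M[R]_cardD :=
  \matrix_(i, j) (cardD%:R ^- 2 * g (dyad i * dyad j)).

Definition calK (g : R -> R) (a : R) : set 'cV[R]_cardD :=
  [set GK g *m x | x in [set x | orthant x /\ norm1 x <= a]].

Definition calK' (g : R -> R) (a : R) : set 'cV[R]_cardD :=
  [set v | exists y w, [/\ calK g a y,
    norm1s w <= (Num.sqrt cardD%:R)^-1 & v = y + w]].

Definition calC (g : R -> R) : set 'cV[R]_cardD :=
  [set GK g *m x | x in orthant].

(* [get] picks the only element of this set when y is in [calC g]: see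
   [sfC_GK] below. *)
Definition sfC (g : R -> R) (y : 'cV[R]_cardD) : R :=
  get [set c | exists x, [/\ orthant x, y = GK g *m x &
                             c = 2^-1 * dotv (GK g *m x) x]].

Definition sfCR (g : R -> R) (m rho : R) (y : 'cV[R]_cardD) : R :=
  if norm1s y <= 2 * rho
  then Num.max (sfC g y) (8 * rho / m * (norm1s y - rho))
  else 8 * rho / m * (norm1s y - rho).

Definition sfH (g : R -> R) (m rho : R) (y : 'cV[R]_cardD) : R :=
  inf [set sfCR g m rho w | w in [set w | calC g w /\ lev y w]].

Lemma dotv_GK g x y : dotv (GK g *m x) y = dotv (GK g *m y) x.
Proof.
have E u v : dotv (GK g *m u) v = \sum_i \sum_j GK g i j * (u j 0 * v i 0).
  apply: eq_bigr => i _; rewrite mxE big_distrl/=.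
  by apply: eq_bigr => j _; rewrite mulrA.
rewrite !E exchange_big/=; apply: eq_bigr => i _; apply: eq_bigr => j _.
by rewrite !mxE [dyad j * _]mulrC [x i 0 * _]mulrC.
Qed.

Lemma sfC_GK g x : orthant x ->
  sfC g (GK g *m x) = 2^-1 * dotv (GK g *m x) x.
Proof.
have E u : GK g *m x = GK g *m u -> dotv (GK g *m u) u = dotv (GK g *m x) x.
  by move=> xu; rewrite -[in LHS]xu dotv_GK -xu.
move=> x0; apply: get_subset1; first by exists x.
by move=> _ _ [u [_ /E Eu ->]] [v [_ /E Ev ->]]; rewrite Eu Ev.
Qed.

End Dyadic.

(* Main.v *)
Require Import Defs.
From mathcomp Require Import all_boot all_order all_algebra.
From mathcomp Require Import all_classical all_reals all_analysis.
From mathcomp Require Import measurable_realfun ring lra.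

Set Implicit Arguments.
Unset Strict Implicit.
Unset Printing Implicit Defensive.

Import Order.TTheory GRing.Theory Num.Theory numFieldNormedType.Exports.

Local Open Scope classical_set_scope.
Local Open Scope ring_scope.

(** Write f^K for the solution at level K with a given cut-off R.

    Comparison. The nonlinearities are nondecreasing for the coordinatewise
    order and Lipschitz along the diagonal. For such an operator the equation
    needs no boundary condition on the faces of the orthant: in the doubling of
    variables, the barrier eps * sum_i 1/x_i keeps the maximum inside, and its
    gradient has a sign that monotonicity absorbs, for subsolutions as well as
    for supersolutions ([comparison]). Solutions enter only through the slopes
    of the paraboloids that touch them ([prox_super], [prox_sub]). This notion
    is local, and therefore compatible with translations and with the passage
    to cell averages, for which test functions that have to be smooth on the
    whole open orthant are inconvenient.

    Slopes. A translate of a solution by a nonnegative vector is a solution.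
    By comparison, bounds on the increments of the initial condition persist at
    later times ([propagate]), so that each slope of a touching paraboloid
    satisfies the linear inequalities satisfied by the gradients of psi^K. Its
    dual norm is at most lipTV ([touching_norm]); and it lies in the compact
    convex set calK' ([touching_calK']). The hypothesis on the gradient of
    psi^K holds only almost everywhere; it yields bounds on increments because
    some small translate of any given segment meets a null set in a set of
    small length ([small_section], [increment_le_of_gradient]).

    Cut-off. An element of calK' is, up to |D_K|^(-1/2), in the cone calC, and
    on the part of the cone where the dual norm is below R the nonlinearity is
    the quadratic form C_K, whatever R is. Hence two solutions with different
    cut-offs differ by O(|D_K|^(-1/2)) ([cutoff_close]).

    Levels. Let K <= K'. The function (t, X) |-> f^K (t, avg X), where avg
    averages over the cells of level K, solves the equation of level K' up to a
    small error: its slopes are of the form [pull q] with q a slope of f^K, and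
    the nonlinearities at q and at [pull q] are close because g oscillates
    little on dyadic cells ([level_close]). The initial conditions are close
    because elements of calK' vary little inside a cell ([psiK_avg]). By
    comparison the values along the projections of a measure form a Cauchy
    sequence ([levels_close], [projections_cauchy]). *)

(** * Smoothness and touching paraboloids *)

Section CkClosure.
Context {R : realType} {V : normedModType R}.
Implicit Types (U : set V) (phi f h : V -> R).

Lemma Ck_setT n U phi : Ck n setT phi -> Ck n U phi.
Proof.
elim: n phi => [|n IH] phi /=; first by case=> + _; split=> // p _; auto.
case=> c H; split=> [p _|v]; first exact: c.
by have [dv Ckv] := H v; split=> [p _|]; [exact: dv|exact: IH].
Qed.

Lemma CkW n U phi : Ck n.+1 U phi -> Ck n U phi.
Proof.
elim: n phi => [|n IH] phi; first by move=> [].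
move=> [c H]; split=> // v; have [dv Ckv] := H v; split=> //; exact: IH.
Qed.

Lemma Ck_cst n (a : R) : Ck n setT (fun _ : V => a).
Proof.
elim: n a => [|n IH] a; first by split=> // p _; exact: cvg_cst.
split=> [p _|v]; first exact: cvg_cst.
split=> [p _|]; first exact: derivable_cst.
rewrite (_ : (fun p => 'D_v _ p) = cst 0); first exact: IH.
by apply/funext => p; rewrite derive_cst.
Qed.

Lemma Ck_add n f h : Ck n setT f -> Ck n setT h -> Ck n setT (fun x => f x + h x).
Proof.
elim: n f h => [|n IH] f h [cf Hf] [ch Hh].
  by split=> // p _; apply: continuousD; [exact: cf|exact: ch].
split=> [p _|v]; first by apply: continuousD; [exact: cf|exact: ch].
have [[df Cf] [dh Ch]] := (Hf v, Hh v); split.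
  by move=> p _; apply: derivableD; [exact: df|exact: dh].
rewrite (_ : (fun p => 'D_v _ p) = (fun p => 'D_v f p + 'D_v h p));
  first exact: IH.
by apply/funext => p; rewrite deriveD //; [exact: df|exact: dh].
Qed.

Lemma Ck_mul n f h : Ck n setT f -> Ck n setT h -> Ck n setT (fun x => f x * h x).
Proof.
elim: n f h => [|n IH] f h Cf0 Ch0; case: (Cf0) => cf Hf; case: (Ch0) => ch Hh.
  by split=> // p _; apply: continuousM; [exact: cf|exact: ch].
split=> [p _|v]; first by apply: continuousM; [exact: cf|exact: ch].
have [[df Cf] [dh Ch]] := (Hf v, Hh v); split.
  by move=> p _; apply: derivableM; [exact: df|exact: dh].
rewrite (_ : (fun p => 'D_v _ p) = (fun p => f p * 'D_v h p + h p * 'D_v f p)).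
  by apply: Ck_add; apply: IH => //; exact: CkW.
by apply/funext => p; rewrite deriveM //; [exact: df|exact: dh].
Qed.

Lemma Ck_sum n (I : finType) (F : I -> V -> R) :
  (forall i, Ck n setT (F i)) -> Ck n setT (fun x => \sum_i F i x).
Proof.
move=> CF; rewrite (_ : (fun x => _) = \sum_i F i); last first.
  by apply/funext => x; rewrite fct_sumE.
apply: (big_ind (Ck n setT)) => //; first exact: (Ck_cst n 0).
exact: Ck_add.
Qed.

Lemma derive_linear_fun f :
  (forall (a : R) u v, f (a *: u + v) = a * f u + f v) ->
  forall p v, derivable f p v /\ 'D_v f p = f v.
Proof.
move=> lf p v; have H : h^-1 *: (f (h *: v + p) - f p) @[h --> 0^'] --> f v.
  apply: cvg_near_cst; near=> h; rewrite lf addrK scalerA mulVf ?scale1r//.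
  by near: h; exact: nbhs_dnbhs_neq.
split; first by apply/cvg_ex; exists (f v).
exact: cvg_lim H.
Unshelve. all: by end_near. Qed.

Lemma Ck_linear n f : continuous f ->
  (forall (a : R) u v, f (a *: u + v) = a * f u + f v) -> Ck n setT f.
Proof.
move=> cf lf; case: n => [|n]; first by split=> // p _; exact: cf.
split=> [p _|v]; first exact: cf.
split=> [p _|]; first exact: (derive_linear_fun lf p v).1.
rewrite (_ : (fun p => 'D_v f p) = cst (f v)); first exact: Ck_cst.
by apply/funext => p; rewrite (derive_linear_fun lf p v).2.
Qed.

End CkClosure.

Section Proximal.
Context {R : realType} {d : nat}.
Notation point := (R * 'cV[R]_d)%type.
Implicit Types (f phi : point -> R) (p z : point) (q x y : 'cV[R]_d).

Definition sqdist (z p : point) : R :=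
  (z.1 - p.1) ^+ 2 + \sum_i (z.2 i 0 - p.2 i 0) ^+ 2.

(** The proximal superdifferential: [tau] and [q] are the slopes of a
    paraboloid that touches the graph of [f] at [p] from above. *)
Definition prox_super f p (tau : R) q : Prop := exists M : R,
  \forall z \near p, f z <= f p + tau * (z.1 - p.1) + dotv q (z.2 - p.2) + M *
    sqdist z p.

Definition prox_sub f p tau q : Prop := prox_super (fun z =>
  - f z) p (- tau) (- q).

Definition paraboloid p (tau : R) q (M : R) : point -> R := fun z =>
  tau * (z.1 - p.1) + dotv q (z.2 - p.2) + M * sqdist z p.

(** A paraboloid is a polynomial, hence smooth on the whole space. *)
Lemma smooth_paraboloid p tau q M : smooth open_dom (paraboloid p tau q M).
Proof.
move=> n; apply: Ck_setT.
have C1 (a : R) : Ck n setT (fun z : point => z.1 - a).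
  apply: Ck_add; last exact: Ck_cst.
  apply: Ck_linear => [x|a' [u1 u2] [v1 v2]] //=; exact: cvg_fst.
have C2 (a : R) i : Ck n setT (fun z : point => z.2 i 0 - a).
  apply: Ck_add; last exact: Ck_cst.
  apply: Ck_linear => [x|a' [u1 u2] [v1 v2]] //=; last by rewrite !mxE.
  apply: (@continuous_comp _ _ _ snd (fun M : 'cV[R]_d => M i 0)).
    exact: cvg_snd.
  exact: coord_continuous.
apply: Ck_add; first apply: Ck_add.
- apply: Ck_mul (C1 _); exact: Ck_cst.
- apply: Ck_sum => i; apply: Ck_mul; first exact: Ck_cst.
  rewrite (_ : (fun _ => _) = (fun z : point => z.2 i 0 - p.2 i 0)) //.
  by apply/funext => z; rewrite !mxE.
- apply: Ck_mul; first exact: Ck_cst.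
  apply: Ck_add; first exact: Ck_mul.
  by apply: Ck_sum => i; exact: Ck_mul.
Qed.

Lemma dotvZr (a : R) x y : dotv x (a *: y) = a * dotv x y.
Proof. by rewrite /dotv mulr_sumr; apply: eq_bigr => i _; rewrite mxE mulrCA. Qed.

Lemma dotv_delta x i : dotv x (delta_mx i 0) = x i 0.
Proof.
rewrite /dotv (bigD1 i)//= mxE !eqxx mulr1 big1 ?addr0// => j ji.
by rewrite mxE (negbTE ji) mulr0.
Qed.

Lemma dotv0 x : dotv x 0 = 0.
Proof. by rewrite /dotv big1// => i _; rewrite mxE mulr0. Qed.

Lemma sqdist_refl p : sqdist p p = 0.
Proof.
rewrite /sqdist subrr expr0n/= add0r big1// => i _; by rewrite subrr expr0n.
Qed.

Lemma paraboloid_refl p tau q M : paraboloid p tau q M p = 0.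
Proof.
by rewrite /paraboloid sqdist_refl !subrr dotv0 !mulr0 !addr0.
Qed.

Lemma derive1_paraboloid p tau q M :
  derive1 (fun s => paraboloid p tau q M (s, p.2)) p.1 = tau.
Proof.
rewrite (_ : (fun s => _) = (fun s => tau * (s - p.1) + M * (s - p.1) ^+ 2)).
  by rewrite derive1E derive_val; rewrite /GRing.scale/=; lra.
apply/funext => s; rewrite /paraboloid/sqdist/= subrr dotv0 addr0.
by rewrite big1 ?addr0// => i _; rewrite subrr expr0n.
Qed.

Lemma grad_paraboloid p tau q M :
  grad (fun y => paraboloid p tau q M (p.1, y)) p.2 = q.
Proof.
apply/colP => i; rewrite mxE.
apply: cvg_lim => //.
have E (h : R) : h != 0 ->
   h^-1 *: (paraboloid p tau q M (p.1, h *: delta_mx i 0 + p.2) -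
            paraboloid p tau q M (p.1, p.2)) = q i 0 + M * h.
  move=> h0; rewrite /paraboloid /sqdist/= !subrr addrK dotv0 dotvZr dotv_delta.
  rewrite [X in _ - X](_ : _ = 0); last first.
    by rewrite big1 ?expr0n/= ?addr0 ?mulr0 ?addr0// => j _; rewrite subrr expr0n.
  rewrite mulr0 add0r subr0 expr0n/= add0r (bigD1 i)//= big1 => [|j ji].
    by rewrite !mxE !eqxx/= /GRing.scale/= mulr1 addrK addr0; field.
  by rewrite !mxE (negbTE ji)/= mulr0 add0r subrr expr0n.
have : (q i 0 + M * h) @[h --> (0 : R)^'] --> q i 0.
  rewrite -[X in _ --> X]addr0 -[X in _ + X](mulr0 M).
  apply: cvg_within_filter => //.
  by apply: cvgD; [exact: cvg_cst|apply: cvgM; [exact: cvg_cst|exact: cvg_id]].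
apply: cvg_trans; apply: near_eq_cvg; near=> h; rewrite E//.
by near: h; exact: nbhs_dnbhs_neq.
Unshelve. all: by end_near. Qed.

(** The touching paraboloid is an admissible test function. *)
Lemma visc_prox_super H f p tau q : viscosity_solution H f -> open_dom p ->
  prox_super f p tau q -> tau <= H q.
Proof.
move=> [_ visc] p0 [M nf].
have [+ _] := visc _ (smooth_paraboloid p tau q M) p p0.
rewrite /HJ_operator derive1_paraboloid grad_paraboloid subr_le0; apply.
apply: filterS nf => z; rewrite paraboloid_refl /paraboloid.
lra.
Qed.

Lemma visc_prox_sub H f p tau q : viscosity_solution H f -> open_dom p ->
  prox_sub f p tau q -> H q <= tau.
Proof.
move=> [_ visc] p0 [M nf].
have [_] := visc _ (smooth_paraboloid p tau q (- M)) p p0.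
rewrite /HJ_operator derive1_paraboloid grad_paraboloid subr_ge0; apply.
apply: filterS nf => z; rewrite paraboloid_refl /paraboloid.
have -> : dotv (- q) (z.2 - p.2) = - dotv q (z.2 - p.2).
  by rewrite /dotv -sumrN; apply: eq_bigr => i _; rewrite mxE mulNr.
by lra.
Qed.

Lemma prox_super_near f p tau q : prox_super f p tau q ->
  exists2 M, 0 <= M & \forall z \near p, f z <= f p + tau * (z.1 - p.1) +
    dotv q (z.2 - p.2) + M * sqdist z p.
Proof.
move=> [M nf]; exists `|M| => //; apply: filterS nf => z /le_trans; apply.
rewrite lerD2l ler_wpM2r ?ler_norm// addr_ge0 ?sqr_ge0//.
by apply: sumr_ge0 => i _; exact: sqr_ge0.
Qed.

Lemma prox_superD f1 f2 p tau1 tau2 q1 q2 :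
  prox_super f1 p tau1 q1 -> prox_super f2 p tau2 q2 ->
  prox_super (fun z => f1 z + f2 z) p (tau1 + tau2) (q1 + q2).
Proof.
move=> [M1 n1] [M2 n2]; exists (M1 + M2); apply: filterS2 n1 n2 => z.
have -> : dotv (q1 + q2) (z.2 - p.2) = dotv q1 (z.2 - p.2) + dotv q2 (z.2 - p.2).
  by rewrite /dotv -big_split; apply: eq_bigr => i _; rewrite mxE mulrDl.
by lra.
Qed.

Lemma prox_superZ (a : R) f p tau q : 0 <= a ->
  prox_super f p tau q -> prox_super (fun z => a * f z) p (a * tau) (a *: q).
Proof.
move=> a0 [M n]; exists (a * M); apply: filterS n => z h.
have -> : dotv (a *: q) (z.2 - p.2) = a * dotv q (z.2 - p.2).
  by rewrite /dotv mulr_sumr; apply: eq_bigr => i _; rewrite mxE mulrA.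
by have := ler_wpM2l a0 h; lra.
Qed.

Lemma prox_super_sum (I : finType) (F : I -> point -> R) p (tau : I -> R)
    (q : I -> 'cV[R]_d) :
  (forall i, prox_super (F i) p (tau i) (q i)) ->
  prox_super (fun z => \sum_i F i z) p (\sum_i tau i) (\sum_i q i).
Proof.
move=> H; elim: (index_enum I) => [|i s IH].
  exists 0; near=> z; rewrite !big_nil /dotv big1 ?mul0r ?addr0// => i _.
  by rewrite mxE mul0r.
rewrite !big_cons (_ : (fun z => _) = fun z => F i z + \sum_(j <- s) F j z).
  exact: prox_superD.
by apply/funext => z; rewrite big_cons.
Unshelve. all: by end_near. Qed.

Lemma prox_super_le f g p tau q : (\forall z \near p, f z - f p <= g z - g p) ->
  prox_super g p tau q -> prox_super f p tau q.
Proof. by move=> nfg [M ng]; exists M; apply: filterS2 nfg ng => z; lra. Qed.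

End Proximal.

(** * Continuity, growth and penalizations *)

Section Continuity.
Context {R : realType} {T : topologicalType}.
Implicit Types f g : T -> R.

(** The rules below are in the form [continuous (fun x => ...)], so that they
    apply to the explicit expressions met later. *)
Lemma ctsD f g : continuous f -> continuous g -> continuous (fun x => f x + g x).
Proof. by move=> cf cg x; apply: cvgD; [exact: cf|exact: cg]. Qed.

Lemma ctsB f g : continuous f -> continuous g -> continuous (fun x => f x - g x).
Proof. by move=> cf cg x; apply: cvgB; [exact: cf|exact: cg]. Qed.

Lemma ctsM f g : continuous f -> continuous g -> continuous (fun x => f x * g x).
Proof. by move=> cf cg x; apply: cvgM; [exact: cf|exact: cg]. Qed.

Lemma cts_cst (a : R) : continuous (fun _ : T => a).
Proof. by move=> x; exact: cvg_cst. Qed.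

Lemma ctsX f n : continuous f -> continuous (fun x => f x ^+ n).
Proof.
move=> cf; elim: n => [|n IH]; first by under eq_fun do rewrite expr0;
  exact: cts_cst.
by under eq_fun do rewrite exprS; exact: ctsM.
Qed.

Lemma cts_sum (I : Type) (s : seq I) (F : I -> T -> R) :
  (forall i, continuous (F i)) -> continuous (fun x => \sum_(i <- s) F i x).
Proof. by move=> cF; apply: continuous_big => //; exact: add_continuous. Qed.

Lemma cts_max (a : R) f : continuous f -> continuous (fun x => Num.max a (f x)).
Proof.
by move=> cf x; apply: (@continuous_max _ _ (cst a) f);
  [exact: cvg_cst|exact: cf].
Qed.

Lemma cts_norm f : continuous f -> continuous (fun x => `|f x|).
Proof. by move=> cf x; apply: cvg_norm; exact: cf. Qed.

Lemma cts_inv f : continuous f -> (forall x, f x != 0) ->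
  continuous (fun x => (f x)^-1).
Proof. by move=> cf f0 x; apply: cvgV => //; exact: cf. Qed.

Lemma cts_col d (f : T -> 'cV[R]_d) :
  (forall i, continuous (fun x => f x i 0)) -> continuous f.
Proof.
move=> cf x B [P nP sPB]; rewrite nbhs_filterE /=.
have : \forall z \near x, forall i, P i 0 (f z i 0).
  by apply: filter_forall => i; exact: (cf i x _ (nP i 0)).
by apply: filterS => z Hz; apply: sPB => i j; rewrite (ord1 j); exact: Hz.
Qed.

Lemma cts_coord d (f : T -> 'cV[R]_d) i : continuous f ->
  continuous (fun x => f x i 0).
Proof.
by move=> cf x; apply: (@continuous_comp _ _ _ f (fun M : 'cV[R]_d => M i 0));
  [exact: cf|exact: coord_continuous].
Qed.

Lemma cts_pair (U V : topologicalType) (f : T -> U) (g : T -> V) :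
  continuous f -> continuous g -> continuous (fun x => (f x, g x)).
Proof. by move=> cf cg x; apply: cvg_pair; [exact: cf|exact: cg]. Qed.

Lemma cts_comp (U V : topologicalType) (f : T -> U) (g : U -> V) :
  continuous f -> continuous g -> continuous (fun x => g (f x)).
Proof. by move=> cf cg x; apply: continuous_comp; [exact: cf|exact: cg]. Qed.

End Continuity.

Lemma cts_fst (U V : topologicalType) : continuous (@fst U V).
Proof. by move=> x; exact: cvg_fst. Qed.
Lemma cts_snd (U V : topologicalType) : continuous (@snd U V).
Proof. by move=> x; exact: cvg_snd. Qed.

Lemma cV_compact {R : realType} d (a b : R) :
  compact [set x : 'cV[R]_d | forall i, a <= x i 0 <= b].
Proof.
have := @rV_compact R d (fun=> `[a, b]%classic) (fun=> @segment_compact _ a b).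
set A := [set _ | _] => cA.
have -> : [set x : 'cV[R]_d | forall i, a <= x i 0 <= b] = trmx @` A.
  apply/seteqP; split => [x Hx|_ [y Hy <-] i] /=.
    exists x^T; last by rewrite trmxK.
    by move=> i /=; rewrite mxE in_itv/=; exact: Hx.
  by have := Hy i; rewrite /= in_itv/= mxE.
apply: continuous_compact => //; apply: continuous_subspaceT.
apply: (@cts_col R) => i x.
rewrite (_ : (fun x => _) = fun y : 'rV[R]_d => y 0 i).
  exact: coord_continuous.
by apply/funext => y; rewrite mxE.
Qed.

Section Retraction.
Context {R : realType} {d : nat}.
Notation point := (R * 'cV[R]_d)%type.
Implicit Types (u f : point -> R) (z p : point).

Definition pos_part (x : 'cV[R]_d) : 'cV[R]_d := \col_i Num.max 0 (x i 0).
(** Retraction onto the closed domain. Composing with it turns a function that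
    is continuous within the domain into one that is continuous everywhere. *)
Definition ret z : point := (Num.max 0 z.1, pos_part z.2).

Lemma pos_part_id x : orthant x -> pos_part x = x.
Proof.
move=> x0; apply/colP => i; rewrite mxE; apply/max_idPr.
by have := x0 i; rewrite mxE.
Qed.

Lemma pos_part_ge0 x : orthant (pos_part x).
Proof. by move=> i; rewrite !mxE le_max lexx. Qed.

Lemma ret_dom z : dom (ret z).
Proof. by split; [rewrite le_max lexx|exact: pos_part_ge0]. Qed.

Lemma ret_id z : dom z -> ret z = z.
Proof.
by case: z => t x [/= t0 x0]; rewrite /ret/= pos_part_id// (max_idPr t0).
Qed.

Lemma ret_continuous : continuous ret.
Proof.
apply: cts_pair; first exact/cts_max/cts_fst.
apply: (@cts_col R) => i; under eq_fun do rewrite mxE.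
exact/cts_max/cts_coord/cts_snd.
Qed.

Lemma continuous_ret u : {within dom, continuous u} -> continuous (u \o ret).
Proof.
move=> /subspace_continuousP cu z.
have := cu _ (ret_dom z); move=> H.
apply: (cvg_comp _ _ _ H).
move=> B; rewrite /within/= => nB.
have := @ret_continuous z _ nB; rewrite /nbhs/=; apply: filterS => y; apply.
exact: ret_dom.
Qed.

(** The regularity in time is only required from time 0; together with the
    Lipschitz initial condition it gives linear growth. *)
Definition tame u := continuous (u \o ret) /\ exists C : R, [/\ 0 <= C,
  (forall t x, 0 <= t -> orthant x -> `|u (t, x) - u (0, x)| <= C * t) &
  (forall x y, orthant x -> orthant y ->
     `|u (0, x) - u (0, y)| <= C * \sum_i `|x i 0 - y i 0|)].

Lemma open_orthant_orthant (x : 'cV[R]_d) : open_orthant x -> orthant x.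
Proof. by move=> x0 i; rewrite mxE; exact/ltW. Qed.

Lemma orthant_ge0 (x : 'cV[R]_d) i : orthant x -> 0 <= x i 0.
Proof. by move=> /(_ i); rewrite mxE. Qed.

Lemma near_pos_continuous (T : topologicalType) (f : T -> R) x :
  continuous f -> 0 < f x -> \forall z \near x, 0 < f z.
Proof. by move=> cf; exact: cvgr_gt (cf x) 0. Qed.

Lemma near_open_dom z : open_dom z -> \forall y \near z, open_dom y.
Proof.
move=> [z0 z1]; have H1 : \forall y \near z, 0 < y.1.
  by apply: near_pos_continuous => //; exact: cts_fst.
have H2 : nbhs z [set y : point | forall i, 0 < y.2 i 0].
  apply: (@filter_forall _ _ (fun i => [set y : point | 0 < y.2 i 0])
    (nbhs z) _) => i.
  by apply: (near_pos_continuous (f := fun y : point => y.2 i 0)) => //;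
    exact/cts_coord/cts_snd.
by apply: filterS2 H1 H2 => y y1 y2; split.
Qed.

End Retraction.

Section Basis.
Context {R : realType} {d : nat}.
Notation point := (R * 'cV[R]_d)%type.
Implicit Types (u f : point -> R) (z p : point).

Lemma sqdist_ge0 z p : 0 <= sqdist z p.
Proof.
by rewrite addr_ge0 ?sqr_ge0//; apply: sumr_ge0 => i _; rewrite sqr_ge0.
Qed.

Lemma sqdistC z p : sqdist z p = sqdist p z.
Proof. by rewrite /sqdist -sqrrN opprB; congr (_ + _); apply: eq_bigr => i _;
  rewrite -sqrrN opprB. Qed.

Lemma prox_super_sqdist p z0 :
  prox_super (sqdist^~ p) z0 (2 * (z0.1 - p.1)) (2 *: (z0.2 - p.2)).
Proof.
exists 1; near=> z; rewrite mul1r /sqdist.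
rewrite [leRHS](_ : _ = (z.1 - p.1) ^+ 2 + ((\sum_i (z0.2 i 0 - p.2 i 0) ^+ 2 +
  dotv (2 *: (z0.2 - p.2)) (z.2 - z0.2)) + \sum_i (z.2 i 0 - z0.2 i 0) ^+ 2)).
  rewrite lerD2l /dotv -!big_split/=; apply: ler_sum => i _; rewrite !mxE.
  by rewrite le_eqVlt; apply/orP; left; apply/eqP; ring.
by ring.
Unshelve. all: by end_near. Qed.

Definition sumv (x : 'cV[R]_d) : R := \sum_i x i 0.

Lemma sumv_ge0 x : orthant x -> 0 <= sumv x.
Proof. by move=> x0; apply: sumr_ge0 => i _; exact: orthant_ge0. Qed.

Lemma sumvB x y : sumv (x - y) = sumv x - sumv y.
Proof. by rewrite /sumv -sumrB; apply: eq_bigr => i _; rewrite !mxE. Qed.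

Lemma dotv_const (a : R) x : dotv (const_mx a) x = a * sumv x.
Proof. by rewrite /dotv /sumv mulr_sumr; apply: eq_bigr => i _; rewrite mxE. Qed.

Lemma prox_super_linear (b c : R) z0 :
  prox_super (fun z => b * sumv z.2 + c * z.1) z0 c (const_mx b).
Proof.
by exists 0; near=> z; rewrite dotv_const sumvB; lra.
Unshelve. all: by end_near. Qed.

(** Cauchy-Schwarz inequality against the constant family 1. *)
Lemma sqr_sum_le (n : nat) (a : 'I_n -> R) :
  (\sum_i a i) ^+ 2 <= n%:R * \sum_i a i ^+ 2.
Proof.
rewrite expr2 big_distrl/= mulr_sumr.
apply: (@le_trans _ _ (\sum_i \sum_j (a i ^+ 2 + a j ^+ 2) / 2)).
  apply: ler_sum => i _; rewrite mulr_sumr; apply: ler_sum => j _.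
  by rewrite ler_pdivlMr//; have := sqr_ge0 (a i - a j); lra.
rewrite (eq_bigr (fun i => n%:R * (a i ^+ 2 / 2) + (\sum_j a j ^+ 2) / 2)).
  rewrite big_split/= sumr_const card_ord -mulr_sumr -mulr_suml.
  by rewrite -mulr_sumr -[_ *+ n]mulr_natl; lra.
move=> i _; under eq_bigr do rewrite mulrDl.
rewrite big_split/= sumr_const card_ord -[_ *+ n]mulr_natl -mulr_suml.
by [].
Qed.

Lemma prox_super_square (c : R) z0 (r := fun z : point =>
  1 + sumv z.2 + c * z.1) :
  prox_super (fun z => r z ^+ 2) z0 (2 * r z0 * c) (const_mx (2 * r z0)).
Proof.
exists (2 * c ^+ 2 + 2 * d%:R); near=> z.
rewrite dotv_const /r sumvB.
set S := sumv z.2 - sumv z0.2; set T := z.1 - z0.1.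
have E : sumv z.2 = sumv z0.2 + S by rewrite /S; ring.
have E' : z.1 = z0.1 + T by rewrite /T; ring.
have HS : S ^+ 2 <= d%:R * \sum_i (z.2 i 0 - z0.2 i 0) ^+ 2.
  by apply: le_trans (sqr_sum_le _); rewrite /S /sumv -sumrB.
have HT : 0 <= T ^+ 2 by exact: sqr_ge0.
have HQ : (S + c * T) ^+ 2 <= 2 * S ^+ 2 + 2 * c ^+ 2 * T ^+ 2.
  by have := sqr_ge0 (S - c * T); lra.
rewrite /sqdist -/T.
set Q := \sum_i _ in HS *.
have Q0 : 0 <= Q by apply: sumr_ge0 => i _; exact: sqr_ge0.
have H1 : 0 <= c ^+ 2 * Q by rewrite mulr_ge0// sqr_ge0.
have H2 : 0 <= (d%:R : R) * T ^+ 2 by rewrite mulr_ge0.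
rewrite E E'; nra.
Unshelve. all: by end_near. Qed.

(** Convexity of the inverse, quantified:
    1/b - 1/a + (b - a)/a^2 = (b - a)^2 / (a^2 b) <= 2 (b - a)^2 / a^3
    as soon as b >= a/2. *)
Lemma prox_super_inv z0 : open_orthant z0.2 ->
  prox_super (fun z => \sum_i (z.2 i 0)^-1) z0 0 (- \col_i (z0.2 i 0) ^- 2).
Proof.
move=> z00.
have H i : prox_super (fun z : point => (z.2 i 0)^-1) z0 0
    (- ((z0.2 i 0) ^- 2) *: delta_mx i 0).
  set a := z0.2 i 0; have a0 : 0 < a by exact: z00.
  exists (2 / a ^+ 3).
  have na : nbhs z0 [set z : point | 0 < z.2 i 0 - a / 2].
    apply: (near_pos_continuous (f := fun z : point => z.2 i 0 - a / 2)).
      by apply: ctsB; [exact/cts_coord/cts_snd|exact: cts_cst].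
    by rewrite -/a; lra.
  apply: filterS na => z /=; set b := z.2 i 0 => ba.
  rewrite mul0r addr0.
  have -> : dotv (- a ^- 2 *: delta_mx i 0) (z.2 - z0.2) = - a ^- 2 * (b - a).
    rewrite /dotv (bigD1 i)//= big1 ?addr0 => [|j ji].
      by rewrite !mxE !eqxx mulr1.
    by rewrite !mxE (negbTE ji) mulr0 mul0r.
  have Hs : (b - a) ^+ 2 <= sqdist z z0.
    rewrite /sqdist (bigD1 i)//= -/a -/b addrCA lerDl addr_ge0 ?sqr_ge0//.
    by apply: sumr_ge0 => j _; exact: sqr_ge0.
  have a3 : 0 <= 2 / a ^+ 3 by rewrite divr_ge0// exprn_ge0// ltW.
  apply: le_trans (_ : _ <= a^-1 - a ^- 2 * (b - a) + 2 / a ^+ 3 * (b - a) ^+ 2)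
    _.
    have b0 : 0 < b by lra.
    rewrite -subr_ge0.
    have -> : a^-1 - a ^- 2 * (b - a) + 2 / a ^+ 3 * (b - a) ^+ 2 - b^-1 =
       (b - a) ^+ 2 * (2 * b - a) / (a ^+ 3 * b).
      by field; rewrite ?lt0r_neq0.
    rewrite divr_ge0// mulr_ge0 ?sqr_ge0 ?exprn_ge0 ?(ltW a0) ?(ltW b0)//.
    lra.
  rewrite mulNr lerD2l; exact: ler_wpM2l.
have := prox_super_sum H; rewrite big1//.
rewrite (_ : \sum_i _ = - \col_i (z0.2 i 0) ^- 2)//.
apply/colP => i; rewrite !mxE summxE (bigD1 i)//= !mxE !eqxx mulr1 big1
  ?addr0// => j ji.
by rewrite !mxE eq_sym (negbTE ji) mulr0.
Qed.

End Basis.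

(** * Doubling of variables *)

Section Doubling.
Context {R : realType} {d : nat}.
Notation point := (R * 'cV[R]_d)%type.
Implicit Types (u v f : point -> R) (z p : point).

(** On the closed domain this is 1 + sum_i |x_i| + c t; its square is the
    coercive penalization. *)
Definition weight (c : R) (z : point) : R := 1 + sumv z.2 + c * z.1.
Definition invsum (z : point) : R := \sum_i (z.2 i 0)^-1.
Definition pos_dom : set point := [set z | 0 <= z.1 /\ open_orthant z.2].

(** The functional of the doubling of variables. The square of [weight], for c
    larger than the Lipschitz constant of the operator, is a strict
    supersolution that makes the functional coercive; [invsum] keeps the maximum
    off the faces of the orthant. *)
Definition doubled u v (A eta kap del eps c k : R) (z z' : point) : R :=
  (u z - A - (eta * sumv z.2 + kap * z.1) - del * weight c z ^+ 2 - eps *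
    invsum z) -
  (v z' + del * weight c z' ^+ 2 + eps * invsum z') - k * sqdist z z'.

Lemma pos_dom_dom z : pos_dom z -> dom z.
Proof. by move=> [z1 z2]; split=> //; exact: open_orthant_orthant. Qed.

Lemma weight_ge1 c z : 0 <= c -> dom z -> 1 <= weight c z.
Proof.
move=> c0 [z0 z1]; rewrite /weight -addrA lerDl addr_ge0 ?sumv_ge0//.
exact: mulr_ge0.
Qed.

Lemma invsum_ge0 z : dom z -> 0 <= invsum z.
Proof.
by move=> [_ z0]; apply: sumr_ge0 => i _; rewrite invr_ge0 orthant_ge0.
Qed.

Lemma le_invsum z i : dom z -> (z.2 i 0)^-1 <= invsum z.
Proof.
move=> [_ z0]; rewrite /invsum (bigD1 i)//= lerDl; apply: sumr_ge0 => j _.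
by rewrite invr_ge0 orthant_ge0.
Qed.

Lemma le_sumv (x : 'cV[R]_d) i : orthant x -> x i 0 <= sumv x.
Proof.
move=> x0; rewrite /sumv (bigD1 i)//= lerDl; apply: sumr_ge0 => j _.
exact: orthant_ge0.
Qed.

Lemma tame_growth u c : tame u -> 1 <= c ->
  exists2 D, 0 <= D & forall z, dom z -> `|u z| <= D * weight c z.
Proof.
move=> [_ [C [C0 Ct Cx]]] c1; exists (`|u (0, 0)| + C); first exact: addr_ge0.
move=> [t x] [/= t0 x0].
have o0 : orthant (0 : 'cV[R]_d) by move=> i.
have h1 := Ct _ _ t0 x0; have := Cx _ _ x0 o0.
rewrite (eq_bigr (fun i => x i 0)) => [h2|i _]; last first.
  by rewrite mxE subr0 ger0_norm// orthant_ge0.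
rewrite -/(sumv x) in h2.
have S0 := sumv_ge0 x0.
have h : `|u (t, x)| <= C * t + C * sumv x + `|u (0, 0)|.
  have -> : u (t, x) = (u (t, x) - u (0, x)) + (u (0, x) - u (0, 0)) + u (0, 0)
    by ring.
  by apply: le_trans (ler_normD _ _) _;
    rewrite lerD2r (le_trans (ler_normD _ _))// lerD.
apply: le_trans h _; rewrite /weight/= mulrDl !mulrDr.
have : C * t <= C * (c * t) by rewrite ler_wpM2l// ler_peMl.
have : 0 <= `|u (0, 0)| * sumv x by rewrite mulr_ge0.
have : 0 <= `|u (0, 0)| * (c * t) by rewrite mulr_ge0// mulr_ge0//; lra.
by lra.
Qed.

Lemma quad_bound (D del r : R) : 0 < del ->
  D * r - del * r ^+ 2 <= D ^+ 2 / (4 * del).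
Proof.
move=> d0; rewrite ler_pdivlMr; last by lra.
by have := sqr_ge0 (D - 2 * del * r); lra.
Qed.

(** Where the functional is positive, the weights are bounded by coercivity, and
    then the coordinates are bounded from below because of [invsum]. The maximum
    is therefore reached in a compact set [K], on which the functional agrees
    with a globally continuous one. *)
Lemma doubled_max u v (A eta kap del eps c k : R) (z0 : point) :
  tame u -> tame v -> 0 <= eta -> 0 <= kap -> 0 < del -> 0 < eps ->
    1 <= c -> 0 < k ->
  pos_dom z0 -> 0 < doubled u v A eta kap del eps c k z0 z0 ->
  exists z z', [/\ pos_dom z, pos_dom z' & forall y y', pos_dom y -> pos_dom y' ->
    doubled u v A eta kap del eps c k y y' <= doubled u v A eta kap del
      eps c k z z'].
Proof.
move=> tu tv eta0 kap0 del0 eps0 c1 k0 z00 pos.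
have c0 : 0 <= c by lra.
have [D1 D10 gu] := tame_growth tu c1; have [D2 D20 gv] := tame_growth tv c1.
(* D r - del r^2 <= E for all r, so that each of the two variables can be
   bounded when the other one is ignored. *)
pose D := D1 + D2 + `|A|.
have D0 : 0 <= D by rewrite !addr_ge0.
pose E := D ^+ 2 / (4 * del).
have E0 : 0 <= E by rewrite divr_ge0 ?sqr_ge0//; lra.
pose rho := (D + E) / del.
pose h := eps / (2 * E + 1).
have h0 : 0 < h by rewrite divr_gt0//; lra.
pose K : set point := [set z : point | 0 <= z.1 <= rho /\ forall i,
  h <= z.2 i 0 <= rho].
have Kpos z : K z -> pos_dom z.
  by move=> [/andP[? _] H]; split=> // i; have /andP[? _] := H i; lra.
have bound z z' : pos_dom z -> pos_dom z' ->
    doubled u v A eta kap del eps c k z z' <=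
    (D * weight c z - del * weight c z ^+ 2 - eps * invsum z) +
    (D * weight c z' - del * weight c z' ^+ 2 - eps * invsum z').
  move=> /pos_dom_dom dz /pos_dom_dom dz'.
  have := gu _ dz; have := gv _ dz';
    rewrite !ler_norml => /andP[v1 _] /andP[_ u1].
  have r1 := weight_ge1 c0 dz; have r1' := weight_ge1 c0 dz'.
  have : `|A| <= `|A| * weight c z by rewrite ler_peMr.
  have : 0 <= `|A| * weight c z' by rewrite mulr_ge0//; lra.
  have : 0 <= k * sqdist z z' by rewrite mulr_ge0 ?sqdist_ge0// ltW.
  have : - A <= `|A| by rewrite -normrN ler_norm.
  have : 0 <= D2 * weight c z by rewrite mulr_ge0//; lra.
  have : 0 <= D1 * weight c z' by rewrite mulr_ge0//; lra.
  have : 0 <= eta * sumv z.2 by rewrite mulr_ge0 ?sumv_ge0//; case: dz.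
  have : 0 <= kap * z.1 by rewrite mulr_ge0//; case: dz.
  by rewrite /doubled /D; lra.
have inK z : pos_dom z -> 0 < D * weight c z - del * weight c z ^+ 2 - eps *
  invsum z + E -> K z.
  move=> pz H; have dz := pos_dom_dom pz; have r1 := weight_ge1 c0 dz.
  have i0 := invsum_ge0 dz; have ei0 : 0 <= eps * invsum z
    by rewrite mulr_ge0// ltW.
  have Er : E <= E * weight c z by rewrite ler_peMr.
  have rle : weight c z <= rho.
    rewrite /rho ler_pdivlMr//.
    rewrite -(ler_pM2r (_ : 0 < weight c z)); last by lra.
    by lra.
  case: (dz) => dz1 dz2; have S0 := sumv_ge0 dz2.
  have cz : z.1 <= c * z.1 by rewrite ler_peMl.
  split=> [|i] /=; rewrite /weight in rle; first by apply/andP; split=> //; lra.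
  have zi := pz.2 i; have := le_sumv i dz2.
  move=> zS; apply/andP; split; last by lra.
  have qb : D * weight c z - del * weight c z ^+ 2 <= E by exact: quad_bound.
  have invb : eps * (z.2 i 0)^-1 <= 2 * E + 1.
    have : eps * (z.2 i 0)^-1 <= eps * invsum z by rewrite ler_pM2l//;
      exact: le_invsum.
    by lra.
  rewrite /h ler_pdivrMr; last by lra.
  by move: invb; rewrite ler_pdivrMr// mulrC.
have inKK z z' : pos_dom z -> pos_dom z' ->
    0 < doubled u v A eta kap del eps c k z z' -> K z /\ K z'.
  move=> pz pz' H; have := bound _ _ pz pz' => B.
  have q1 : D * weight c z - del * weight c z ^+ 2 <= E by exact: quad_bound.
  have q2 : D * weight c z' - del * weight c z' ^+ 2 <= E by exact: quad_bound.
  have i1 : 0 <= eps * invsum z by rewrite mulr_ge0 ?invsum_ge0//;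
    [lra|exact: pos_dom_dom].
  have i2 : 0 <= eps * invsum z' by rewrite mulr_ge0 ?invsum_ge0//;
    [lra|exact: pos_dom_dom].
  by split; apply: inK => //; lra.
have cK : compact K.
  have -> : K = [set t | 0 <= t <= rho] `*` [set x : 'cV[R]_d | forall i,
    h <= x i 0 <= rho].
    by apply/seteqP; split.
  apply: compact_setX; last exact: cV_compact.
  by have := @segment_compact R 0 rho; rewrite set_itvcc.
(* Continuous everywhere, and equal to the functional on K x K. *)
pose inv_h z : R := \sum_i (Num.max h (z.2 i 0))^-1.
pose Phi (y : point * point) :=
  ((u \o ret) y.1 - A - (eta * sumv y.1.2 + kap * y.1.1) - del * weight c y.1 ^+ 2
    - eps * inv_h y.1) -
  ((v \o ret) y.2 + del * weight c y.2 ^+ 2 + eps * inv_h y.2) - k *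
    sqdist y.1 y.2.
have PhiE z z' : K z -> K z' ->
  Phi (z, z') = doubled u v A eta kap del eps c k z z'.
  move=> Kz Kz'; rewrite /Phi /doubled /=.
  have inv_E y : K y -> inv_h y = invsum y.
    move=> [_ Ky]; apply: eq_bigr => i _; congr (_^-1); apply/max_idPr.
    by have /andP[] := Ky i.
  by rewrite !inv_E// !ret_id//; exact/pos_dom_dom/Kpos.
have cPhi : continuous Phi.
  have csum : continuous (fun z : point => sumv z.2).
    by apply: cts_sum => i; exact/cts_coord/cts_snd.
  have crad : continuous (fun z : point => weight c z).
    apply: ctsD; first by apply: ctsD => //; exact: cts_cst.
    by apply: ctsM; [exact: cts_cst|exact: cts_fst].
  have cinv : continuous inv_h.
    apply: cts_sum => i; apply: cts_inv; last first.
      by move=> z; rewrite gt_eqF// lt_max h0.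
    exact/cts_max/cts_coord/cts_snd.
  have c1' (f : point -> R) : continuous f ->
    continuous (fun y : point * point => f y.1).
    by move=> cf; apply: cts_comp => //; exact: cts_fst.
  have c2' (f : point -> R) : continuous f ->
    continuous (fun y : point * point => f y.2).
    by move=> cf; apply: cts_comp => //; exact: cts_snd.
  have cu := c1' _ tu.1; have cv := c2' _ tv.1.
  apply: ctsB; first apply: ctsB.
  - apply: ctsB; first apply: ctsB; first apply: ctsB; first apply: ctsB => //.
    + exact: cts_cst.
    + apply: (c1' (fun z => eta * sumv z.2 + kap * z.1)).
      by apply: ctsD; apply: ctsM => //;
        [exact: cts_cst|exact: cts_cst|exact: cts_fst].
    + apply: (c1' (fun z => del * weight c z ^+ 2)).
      by apply: ctsM; [exact: cts_cst|exact: ctsX].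
    + by apply: ctsM; [exact: cts_cst|exact: c1'].
  - apply: ctsD; first apply: ctsD => //.
    + apply: (c2' (fun z => del * weight c z ^+ 2)).
      by apply: ctsM; [exact: cts_cst|exact: ctsX].
    + by apply: ctsM; [exact: cts_cst|exact: c2'].
  - apply: ctsM; first exact: cts_cst.
    apply: ctsD.
      by apply: ctsX; apply: ctsB; [apply: c1'|apply: c2']; exact: cts_fst.
    apply: cts_sum => i; apply: ctsX; apply: ctsB.
      by apply: (c1' (fun z => z.2 i 0)); exact/cts_coord/cts_snd.
    by apply: (c2' (fun z => z.2 i 0)); exact/cts_coord/cts_snd.
have [Kz0 _] := inKK _ _ z00 z00 pos.
have [[z z'] Kzz max] : exists2 y, y \in K `*` K & forall t, t \in K `*` K ->
  Phi t <= Phi y.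
  apply: compact_EVT_max.
  - by exists (z0, z0).
  - exact: compact_setX.
  - exact: continuous_subspaceT.
move: Kzz; rewrite inE => -[/= Kz Kz'].
have ge0 : doubled u v A eta kap del eps c k z0 z0 <= doubled u v A eta kap del
  eps c k z z'.
  by rewrite -!PhiE//; apply: max; rewrite inE.
exists z, z'; split; [exact: Kpos|exact: Kpos|move=> y y' py py'].
have [le0|gt0] := leP (doubled u v A eta kap del eps c k y y') 0.
  exact: (le_trans le0 (le_trans (ltW pos) ge0)).
have [Ky Ky'] := inKK _ _ py py' gt0.
by rewrite -!PhiE//; apply: max; rewrite inE.
Qed.

End Doubling.

(** * The comparison principle *)

Section Comparison.
Context {R : realType} {d : nat}.
Notation point := (R * 'cV[R]_d)%type.
Implicit Types (u v f : point -> R) (z p : point).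

Definition nondecr (H : 'cV[R]_d -> R) := forall x y, lev x y -> H x <= H y.
(** For a nondecreasing operator, Lipschitz continuity along the diagonal
    controls the increments in all directions. *)
Definition diag_lip (H : 'cV[R]_d -> R) (Lam : R) :=
  forall y s, 0 <= s -> H (y + const_mx s) <= H y + Lam * s.

(** At a maximum (z, z') of the doubled functional, both functions are touched
    by paraboloids with nearly the same slopes. The gradient of the barrier is
    negative for [u] and positive for [v], so that monotonicity of [H] removes
    it from both inequalities. What remains contradicts the fact that the square
    of [weight] is a strict supersolution. *)
Lemma comparison_interior H Lam u v (A eta e : R) :
  nondecr H -> 0 <= Lam -> diag_lip H Lam -> tame u -> tame v -> 0 <= eta ->
    0 <= e ->
  (forall p tau q, open_dom p -> prox_super u p tau q -> tau <= H q + e) ->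
  (forall p tau q, open_dom p -> prox_sub v p tau q -> H q <= tau) ->
  (forall x, orthant x -> u (0, x) - v (0, x) <= A + eta * sumv x) ->
  forall z, pos_dom z ->
    u z - v z <= A + eta * sumv z.2 + (Lam * eta + e) * z.1.
Proof.
move=> mH Lam0 lH tu tv eta0 e0 subu supv init z0 pz0.
set kap := Lam * eta + e; have kap0 : 0 <= kap by rewrite addr_ge0// mulr_ge0.
rewrite leNgt; apply/negP => gap.
have dz0 := pos_dom_dom pz0.
pose th := u z0 - v z0 - A - eta * sumv z0.2 - kap * z0.1.
have th0 : 0 < th by rewrite /th; lra.
pose c := Lam + 1; have c1 : 1 <= c by rewrite /c; lra.
have c0 : 0 <= c by lra.
have r1 := weight_ge1 c0 dz0; have i0 := invsum_ge0 dz0.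
(* Each of the four penalizations takes at most th / 8 from the gap th at z0. *)
pose del := th / (8 * weight c z0 ^+ 2).
have rr : 0 < weight c z0 ^+ 2 by rewrite exprn_gt0//; lra.
have del0 : 0 < del by rewrite divr_gt0// mulr_gt0.
pose eps := th / (8 * (1 + invsum z0)).
have eps0 : 0 < eps by rewrite divr_gt0//; lra.
have [_ [Cu [Cu0 Cut _]]] := tu; have [_ [Cv [Cv0 Cvt Cvx]]] := tv.
pose C := Cu + Cv; have C0 : 0 <= C by rewrite addr_ge0.
(* Large enough for the exclusion of time 0 below. *)
pose k := C ^+ 2 * (d%:R + 1) / th + 1.
have dd0 : 0 <= (d%:R : R) by [].
have Cd0 : 0 <= C ^+ 2 * (d%:R + 1) by rewrite mulr_ge0 ?sqr_ge0//; lra.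
have k0 : 0 < k by rewrite ltr_wpDl// divr_ge0// ltW.
have Phi0 : th / 2 <= doubled u v A eta kap del eps c k z0 z0.
  have -> : doubled u v A eta kap del eps c k z0 z0 =
     th - 2 * (del * weight c z0 ^+ 2) - 2 * (eps * invsum z0).
    by rewrite /doubled sqdist_refl /th; ring.
  have -> : del * weight c z0 ^+ 2 = th / 8 by rewrite /del; field;
    rewrite lt0r_neq0//; lra.
  have : eps * invsum z0 <= th / 8.
    rewrite /eps invfM mulrA -mulrA ler_piMr//; first by lra.
    by rewrite mulrC ler_pdivrMr; lra.
  lra.
have [z [z' [pz pz' max]]] :=
  doubled_max tu tv eta0 kap0 del0 eps0 c1 k0 pz0
    (lt_le_trans (divr_gt0 th0 (ltr0n _ 2)) Phi0).
have big := le_trans Phi0 (max _ _ pz0 pz0).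
have dz := pos_dom_dom pz; have dz' := pos_dom_dom pz'.
have [zt zx] := dz; have [zt' zx'] := dz'.
have r1z := weight_ge1 c0 dz; have r1z' := weight_ge1 c0 dz'.
(* A maximum at time 0 for z or z' would be at most C^2 (d + 1) / (4 k). *)
have tpos : 0 < z.1 /\ 0 < z'.1.
  have [//|notpos] := pselect (0 < z.1 /\ 0 < z'.1); exfalso.
  have Et : `|z.1 - z'.1| = z.1 + z'.1.
    have [z1|z1] := ltrP 0 z.1; have [z1'|z1'] := ltrP 0 z'.1.
    - by exfalso; apply: notpos.
    - have -> : z'.1 = 0 by lra.
      by rewrite subr0 addr0 gtr0_norm.
    - have -> : z.1 = 0 by lra.
      by rewrite sub0r add0r normrN gtr0_norm.
    - have [-> ->] : z.1 = 0 /\ z'.1 = 0 by split; lra.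
      by rewrite subr0 addr0 normr0.
  pose D1 := `|z.1 - z'.1|; pose D2 := \sum_i `|z.2 i 0 - z'.2 i 0|.
  have D10 : 0 <= D1 by exact: normr_ge0.
  have D20 : 0 <= D2 by rewrite /D2 sumr_ge0.
  have uz : u z - u (0, z.2) <= Cu * z.1.
    by apply: le_trans (ler_norm _) _; move: (Cut _ _ zt zx);
      rewrite -surjective_pairing.
  have vz : v (0, z'.2) - v z' <= Cv * z'.1.
    apply: le_trans (ler_norm _) _; move: (Cvt _ _ zt' zx').
    by rewrite -surjective_pairing distrC.
  have vx : v (0, z.2) - v (0, z'.2) <= Cv * D2.
    by apply: le_trans (ler_norm _) _; exact: Cvx.
  have ini := init _ zx.
  have E1 : 0 <= Cu * z'.1 by rewrite mulr_ge0.
  have E2 : 0 <= Cv * z.1 by rewrite mulr_ge0.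
  have E3 : 0 <= Cu * D2 by rewrite mulr_ge0.
  have E4 : 0 <= kap * z.1 by rewrite mulr_ge0.
  have E5 : 0 <= del * weight c z ^+ 2 by rewrite mulr_ge0 ?sqr_ge0// ltW.
  have E6 : 0 <= del * weight c z' ^+ 2 by rewrite mulr_ge0 ?sqr_ge0// ltW.
  have E7 : 0 <= eps * invsum z by rewrite mulr_ge0 ?invsum_ge0// ltW.
  have E8 : 0 <= eps * invsum z' by rewrite mulr_ge0 ?invsum_ge0// ltW.
  have upper : doubled u v A eta kap del eps c k z z' <= C * D1 + C * D2 - k *
    sqdist z z'.
    rewrite /doubled /D1 Et /C.
    lra.
  have amgm (a : R) : C * a - k * a ^+ 2 <= C ^+ 2 / (4 * k).
    exact: quad_bound.
  have sqE : sqdist z z' = D1 ^+ 2 + \sum_i `|z.2 i 0 - z'.2 i 0| ^+ 2.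
    by rewrite /sqdist /D1 real_normK ?num_real//; congr (_ + _);
      apply: eq_bigr => i _; rewrite real_normK ?num_real.
  have up2 : C * D2 - k * (\sum_i `|z.2 i 0 - z'.2 i 0| ^+ 2) <= d%:R *
    (C ^+ 2 / (4 * k)).
    rewrite /D2 !mulr_sumr -sumrB -[d in d%:R]card_ord -sum1_card
      natr_sum mulr_suml.
    by apply: ler_sum => i _; rewrite mul1r.
  have up1 := amgm D1.
  have kth : (d%:R + 1) * (C ^+ 2 / (4 * k)) < th / 2.
    rewrite mulrA ltr_pdivrMr; last by lra.
    have : C ^+ 2 * (d%:R + 1) < k * th.
      rewrite /k mulrDl mul1r divfK ?lt0r_neq0//; lra.
    by have : 0 <= C ^+ 2 * (d%:R + 1);
      [rewrite mulr_ge0 ?sqr_ge0// addr_ge0|lra].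
  rewrite sqE in upper.
  lra.
have oz : open_dom z by split; [exact: tpos.1|exact: pz.2].
have oz' : open_dom z' by split; [exact: tpos.2|exact: pz'.2].
have opd y : open_dom y -> pos_dom y by move=> [/ltW].
pose one := const_mx 1 : 'cV[R]_d.
pose w := \col_i (z.2 i 0) ^- 2 : 'cV[R]_d.
pose w' := \col_i (z'.2 i 0) ^- 2 : 'cV[R]_d.
have P1 := prox_superD (prox_superD (prox_superD (prox_super_linear eta kap z)
   (prox_superZ (ltW del0) (prox_super_square c z)))
   (prox_superZ (ltW eps0) (prox_super_inv oz.2)))
   (prox_superZ (ltW k0) (prox_super_sqdist z' z)).
have {}P1 := subu _ _ _ oz (prox_super_le _ P1).
have P2 := prox_superD (prox_superD (prox_superZ (ltW del0)
  (prox_super_square c z'))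
   (prox_superZ (ltW eps0) (prox_super_inv oz'.2)))
   (prox_superZ (ltW k0) (prox_super_sqdist z z')).
rewrite -[X in prox_super _ _ X]opprK -[X in prox_super _ _ _ X]opprK in P2.
have {}P2 := supv _ _ _ oz' (prox_super_le _ P2).
have {}P1 := P1 _; have {}P2 := P2 _.
pose p : 'cV[R]_d := k *: (2 *: (z.2 - z'.2)).
set q1 := (X in _ <= H X + e) in P1.
set q2 := (X in H X <= _) in P2.
have {}P1 : kap + del * (2 * weight c z * c) + eps * 0 + k * (2 * (z.1 - z'.1)) <=
  H q1 + e.
  apply: P1; apply: filterS (near_open_dom oz) => y /opd py.
  have := max y z' py pz'; rewrite /doubled -/(weight c y) -/(weight c z)
    -/(invsum y) -/(invsum z).
  lra.
have {}P2 : H q2 <= - (del * (2 * weight c z' * c) + eps * 0 + k *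
  (2 * (z'.1 - z.1))).
  apply: P2; apply: filterS (near_open_dom oz') => y /opd py.
  have := max z y pz py; rewrite /doubled -/(weight c y) -/(weight c z')
    -/(invsum y) -/(invsum z').
  by rewrite ![sqdist z _]sqdistC; lra.
have Q1 : H q1 <= H p + Lam * (eta + del * (2 * weight c z)).
  apply: le_trans (lH p _ _); last by rewrite addr_ge0// mulr_ge0//; lra.
  apply: mH => i; rewrite !mxE.
  have : 0 <= eps * z.2 i 0 ^- 2 by rewrite mulr_ge0 ?invr_ge0 ?sqr_ge0// ltW.
  by rewrite -/(weight c z); lra.
have Q2 : H p <= H q2 + Lam * (del * (2 * weight c z')).
  apply: le_trans (lH q2 _ _); last by rewrite mulr_ge0//; lra.
  apply: mH => i; rewrite !mxE.
  have : 0 <= eps * z'.2 i 0 ^- 2 by rewrite mulr_ge0 ?invr_ge0 ?sqr_ge0// ltW.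
  by rewrite -/(weight c z'); lra.
have W : 0 < del * (weight c z + weight c z') by rewrite mulr_gt0//; lra.
rewrite /c /kap in P1 P2 Q1 Q2 W *.
lra.
Qed.

(** The faces of the orthant are reached from the interior by moving along the
    diagonal. *)
Lemma comparison H Lam u v (A eta e : R) :
  nondecr H -> 0 <= Lam -> diag_lip H Lam -> tame u -> tame v -> 0 <= eta ->
    0 <= e ->
  (forall p tau q, open_dom p -> prox_super u p tau q -> tau <= H q + e) ->
  (forall p tau q, open_dom p -> prox_sub v p tau q -> H q <= tau) ->
  (forall x, orthant x -> u (0, x) - v (0, x) <= A + eta * sumv x) ->
  forall t x, 0 <= t -> orthant x ->
    u (t, x) - v (t, x) <= A + eta * sumv x + (Lam * eta + e) * t.
Proof.
move=> mH Lam0 lH tu tv eta0 e0 subu supv init t x t0 x0.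
have inter := comparison_interior mH Lam0 lH tu tv eta0 e0 subu supv init.
rewrite leNgt; apply/negP => gap.
pose line (s : R) : point := (t, x + const_mx s).
pose F s := (u \o ret) (line s) - (v \o ret) (line s) -
  (A + eta * sumv (line s).2 + (Lam * eta + e) * t).
have cl : continuous line.
  apply: cts_pair; first by move=> s; exact: cvg_cst.
  apply: (@cts_col R) => i; under eq_fun do rewrite !mxE.
  by apply: ctsD; [exact: cts_cst|move=> s; exact: cvg_id].
have cF : continuous F.
  apply: ctsB; first by apply: ctsB;
    [exact: cts_comp cl tu.1|exact: cts_comp cl tv.1].
  apply: ctsD; last exact: cts_cst.
  apply: ctsD; first exact: cts_cst.
  apply: ctsM; first exact: cts_cst.
  by apply: cts_sum => i; apply: cts_coord; apply: (cts_comp cl); exact: cts_snd.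
have F0 : 0 < F 0.
  have l0 : line 0 = (t, x) by rewrite /line; congr (_, _); apply/colP => i;
    rewrite !mxE addr0.
  rewrite /F l0 /comp ret_id; last by split.
  by move: gap; rewrite -subr_gt0 => gap; rewrite subr_gt0 -subr_gt0.
have nF : \forall s \near (0 : R)^'+, 0 < F s.
  by apply: cvg_within; exact: near_pos_continuous cF F0.
have [s [Fs s0]] : exists s, 0 < F s /\ 0 < s.
  near (0 : R)^'+ => s; exists s; split; first by near: s.
  by near: s; exact: nbhs_right_gt.
have pl : pos_dom (line s).
  by split=> //= i; rewrite !mxE ltr_wpDl// orthant_ge0.
have := inter _ pl; move: Fs; rewrite /F/= ret_id; last exact: pos_dom_dom.
by rewrite /line/=; lra.
Unshelve. all: by end_near. Qed.

End Comparison.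

(** * Small sections of null sets *)

Section Slices.
Context {R : realType}.
Notation mu := (@lebesgue_measure R).
Let mR : measurableType _ := measurableTypeR R.
Let mRR : measurableType _ := (mR * mR)%type.

Lemma integral_slab (alpha beta k : R) : alpha <= beta ->
  (\int[mu]_y (\1_(`[alpha, beta]%classic : set R) (y + k))%:E =
    (beta - alpha)%:E)%E.
Proof.
move=> ab; transitivity
  (\int[mu]_y (\1_(`[alpha - k, beta - k]%classic : set R) y)%:E)%E.
  apply: eq_integral => y _; congr (_%:E); rewrite !indicE; congr (_%:R);
    congr (nat_of_bool _).
  apply/idP/idP; rewrite !inE /= !in_itv/= => /andP[H1 H2]; apply/andP;
    split; lra.
rewrite integral_indic// setIT.
rewrite [LHS](_ : _ = lebesgue_measure `[alpha - k, beta - k]%classic)//.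
rewrite lebesgue_measure_itv/= lte_fin.
case: ltP => h; first by rewrite -EFinB; congr (_%:E); ring.
by congr (_%:E); lra.
Qed.

(** Markov's inequality for the function of [y] in the conclusion, whose integral
    over the whole line is at most [E] by Tonelli's theorem. The factor 2 leaves
    room for a strict inequality. *)
Lemma good_slice (G : nat -> R -> R) (kap : nat -> R -> R) (alpha beta : nat ->
  R) (E r : R) :
  (forall n s, 0 <= G n s) -> (forall n, measurable_fun setT (G n)) ->
  (forall n, measurable_fun setT (kap n)) ->
  (forall n, alpha n <= beta n) -> 0 < E -> 0 < r ->
  (\sum_(0 <= n <oo) \int[mu]_s (G n s * (beta n - alpha n))%:E <= E%:E)%E ->
  exists2 y, 0 <= y <= r &
    (\sum_(0 <= n <oo) \int[mu]_s (G n s * \1_(`[alpha n, beta n]%classic : set R)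
      (y + kap n s))%:E
       <= (2 * E / r)%:E)%E.
Proof.
move=> G0 mG mkap ab E0 r0 sumE.
pose f n (p : mRR) : \bar R :=
  (G n p.2 * \1_(`[alpha n, beta n]%classic : set R) (p.1 + kap n p.2))%:E.
have f0 n p : (0 <= f n p)%E by rewrite lee_fin mulr_ge0.
have mf n : measurable_fun [set: mRR] (f n).
  apply/measurable_EFinP; apply: measurable_funM.
    exact: (measurableT_comp (mG n) measurable_snd).
  apply: (measurableT_comp (measurable_indic _)) => //.
  apply: measurable_funD; first exact: measurable_fst.
  exact: (measurableT_comp (mkap n) measurable_snd).
pose F n y := (\int[mu]_s f n (y, s))%E.
have mF n : measurable_fun setT (F n).
  by apply: (@measurable_fun_fubini_tonelli_F _ _ _ _ _ mu).
have F0 n y : (0 <= F n y)%E by apply: integral_ge0.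
have total : (\int[mu]_y (\sum_(0 <= n <oo) F n y) <= E%:E)%E.
  rewrite integral_nneseries//.
  apply: le_trans sumE; apply: lee_nneseries => [n *|n *];
    first exact: integral_ge0.
  rewrite /F (@fubini_tonelli _ _ _ _ _ mu mu (f n))//.
  apply: ge0_le_integral => //.
  - by move=> s _; apply: integral_ge0.
  - by apply: (@measurable_fun_fubini_tonelli_G _ _ _ _ _ mu).
  - have mGb : measurable_fun setT (fun s => G n s * (beta n - alpha n)).
      by apply: measurable_funM; [exact: mG|exact: measurable_cst].
    exact/measurable_EFinP.
  - move=> s _; rewrite /f/= EFinM -(integral_slab (kap n s) (ab n)).
    rewrite -ge0_integralZl_EFin//.
    have mI : measurable_fun setT
        (fun y : mR => (\1_(`[alpha n, beta n]%classic : set R) (y + kap n s) :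
          R)).
      apply: (measurableT_comp (measurable_indic _)) => //.
      exact: measurable_funD.
    exact/measurable_EFinP.
have mS : measurable_fun setT (fun y => \sum_(0 <= n <oo) F n y)%E.
  by apply: (@ge0_emeasurable_sum _ _ _ _ F xpredT) => // n y _ _; exact: F0.
have [//|none] :=
  pselect (exists2 y, 0 <= y <= r & (\sum_(0 <= n <oo) F n y <=
    (2 * E / r)%:E)%E).
exfalso.
have big : ((2 * E)%:E <= \int[mu]_(y in `[0%R, r]%classic)
  (\sum_(0 <= n <oo) F n y))%E.
  apply: (@le_trans _ _ (\int[mu]_(y in `[0%R, r]%classic)
    (cst (2 * E / r)%:E y))%E).
    rewrite integral_cst//= lebesgue_measure_itv/= lte_fin r0 -EFinB -EFinM subr0.
    by rewrite divfK// gt_eqF.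
  apply: ge0_le_integral => //.
  - by move=> y _; rewrite lee_fin divr_ge0// ?mulr_ge0// ltW.
  - exact: (measurable_funS measurableT).
  - move=> y /=; rewrite in_itv/= => yr; apply/ltW; rewrite ltNge; apply/negP =>
    le.
    by apply: none; exists y.
have : (\int[mu]_(y in `[0%R, r]%classic) (\sum_(0 <= n <oo) F n y) <= E%:E)%E.
  apply: le_trans total; apply: ge0_subset_integral => //.
  - by move=> y _; apply: nneseries_ge0.
by move=> /(le_trans big); rewrite lee_fin; lra.
Qed.

End Slices.

Section Translate.
Context {R : realType} {d : nat}.
Notation mu := (@lebesgue_measure R).
Implicit Types (x v z : 'cV[R]_d).

Definition slab (a b : R) : R -> R := \1_(`[a, b]%classic : set R).

Lemma slab_ge0 a b s : 0 <= slab a b s.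
Proof. by rewrite /slab indicE. Qed.

Lemma slab_1 a b s : a <= s <= b -> slab a b s = 1.
Proof. by move=> h; rewrite /slab indicE mem_set//= in_itv. Qed.

Lemma measurable_slab a b : measurable_fun setT (slab a b).
Proof. exact: measurable_indic. Qed.

Variables (a b : nat -> 'cV[R]_d) (x v : 'cV[R]_d).
Hypothesis leab : forall n, lev (a n) (b n).

Let factor (j : nat) z n s (i : 'I_d) : R :=
  if (i < j)%N then slab (a n i 0) (b n i 0) (z i 0 + (x i 0 + s * v i 0))
  else b n i 0 - a n i 0.

Let partial j z n s : R := slab 0 1 s * \prod_i factor j z n s i.

Let factor_ge0 j z n s i : 0 <= factor j z n s i.
Proof.
by rewrite /factor; case: ifP => _; rewrite ?slab_ge0// subr_ge0; exact: leab.
Qed.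

Let partial_ge0 j z n s : 0 <= partial j z n s.
Proof.
rewrite mulr_ge0 ?slab_ge0//; apply: prodr_ge0 => i _; exact: factor_ge0.
Qed.

Let measurable_line i : measurable_fun setT (fun s : R => x i 0 + s * v i 0).
Proof.
apply: measurable_funD; first exact: measurable_cst.
by apply: measurable_funM; [exact: measurable_id|exact: measurable_cst].
Qed.

Let measurable_factor j z n i : measurable_fun setT (fun s => factor j z n s i).
Proof.
rewrite /factor; case: (i < j)%N; last exact: measurable_cst.
apply: (measurableT_comp (measurable_slab _ _)).
by apply: measurable_funD; [exact: measurable_cst|exact: measurable_line].
Qed.

Let measurable_prod (P : pred 'I_d) j z n :
  measurable_fun setT (fun s => slab 0 1 s * \prod_(i | P i) factor j z n s i).
Proof.
apply: measurable_funM; first exact: measurable_slab.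
elim: (index_enum _) => [|i l IH].
  rewrite [X in measurable_fun _ X](_ : _ = cst 1); first exact: measurable_cst.
  by apply/funext => s; rewrite big_nil.
rewrite [X in measurable_fun _ X](_ : _ = fun s =>
  (if P i then factor j z n s i else 1) *
    \prod_(k <- l | P k) factor j z n s k).
  apply: measurable_funM => //; case: (P i); last exact: measurable_cst.
  exact: measurable_factor.
by apply/funext => s; rewrite big_cons; case: (P i); rewrite ?mul1r.
Qed.

(** The coordinates of [z] are chosen one after the other. After [j] steps, the
    first [j] side lengths in the volumes of the boxes have been replaced by the
    conditions that the segment lies in the corresponding slabs, at the cost of
    a factor [2 / r] per step ([good_slice]). In the end the sum bounds the time
    that the segment spends in the boxes. *)
Lemma small_section (e r : R) : 0 < e -> 0 < r ->
  (\sum_(0 <= n <oo) (box_vol (a n) (b n))%:E <= e%:E)%E ->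
  exists2 z : 'cV[R]_d, (forall i, 0 <= z i 0 <= r) &
    exists B : set (measurableTypeR R),
      [/\ measurable B, (mu B <= (e * (2 / r) ^+ d)%:E)%E &
      forall (s : R) n, 0 <= s <= 1 -> box (a n) (b n) (x + z + s *: v) -> B s].
Proof.
move=> e0 r0 vol.
have step j : (j <= d)%N -> exists2 z : 'cV[R]_d, (forall i, 0 <= z i 0 <= r) &
    (\sum_(0 <= n <oo) \int[mu]_s (partial j z n s)%:E <=
      (e * (2 / r) ^+ j)%:E)%E.
  elim: j => [|j IH] jd.
    exists 0; first by move=> i; rewrite mxE lexx ltW.
    rewrite expr0 mulr1; apply: le_trans vol; apply: lee_nneseries => [n *|n _].
      by apply: integral_ge0 => s _; rewrite lee_fin.
    rewrite [leLHS](_ : _ = \int[mu]_s ((box_vol (a n) (b n))%:E *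
      (slab 0 1 s)%:E))%E;
      last by apply: eq_integral => s _; rewrite -EFinM mulrC.
    rewrite ge0_integralZl_EFin//; last 3 first.
    - by move=> s _; rewrite lee_fin slab_ge0.
    - by apply/measurable_EFinP; exact: measurable_slab.
    - by apply: prodr_ge0 => i _; rewrite subr_ge0; exact: leab.
    rewrite integral_indic// setIT.
    rewrite [X in (_ * X)%E](_ : _ = lebesgue_measure `[0, 1]%classic)//.
    by rewrite lebesgue_measure_itv/= lte_fin ltr01 oppr0 adde0 mule1.
  have [z z0 le] := IH (ltnW jd).
  pose i0 := Ordinal jd.
  pose G n s := slab 0 1 s * \prod_(i | i != i0) factor j z n s i.
  have [|||||||y yr sumy] := @good_slice R G (fun _ s => x i0 0 + s * v i0 0)
     (fun n => a n i0 0) (fun n => b n i0 0) (e * (2 / r) ^+ j) r.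
  - by move=> n s; rewrite mulr_ge0 ?slab_ge0//; apply: prodr_ge0 =>
    i _; exact: factor_ge0.
  - by move=> n; exact: measurable_prod.
  - by move=> n; exact: measurable_line.
  - by move=> n; exact: leab.
  - by rewrite mulr_gt0// exprn_gt0// divr_gt0.
  - by [].
  - apply: le_trans le; apply: lee_nneseries => [n *|n _].
      apply: integral_ge0 => s _; rewrite lee_fin mulr_ge0 ?subr_ge0 ?leab//.
      by rewrite mulr_ge0 ?slab_ge0//; apply: prodr_ge0 => i _; exact: factor_ge0.
    rewrite le_eqVlt; apply/orP; left; apply/eqP; apply: eq_integral => s _.
    have Ef : factor j z n s i0 = b n i0 0 - a n i0 0 by rewrite /factor ltnn.
    by rewrite /partial (bigD1 i0)//= Ef /G; congr (_%:E); ring.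
  pose z' : 'cV[R]_d := \col_i (if i == i0 then y else z i 0).
  exists z'; first by move=> i; rewrite mxE; case: ifP.
  apply: le_trans (_ : _ <= (2 * (e * (2 / r) ^+ j) / r)%:E)%E _; last first.
    by rewrite lee_fin exprS; lra.
  apply: le_trans sumy; apply: lee_nneseries => [n *|n _].
    by apply: integral_ge0 => s _; rewrite lee_fin.
  rewrite le_eqVlt; apply/orP; left; apply/eqP; apply: eq_integral => s _.
  have Ef : factor j.+1 z' n s i0 = slab (a n i0 0) (b n i0 0)
    (y + (x i0 0 + s * v i0 0)).
    by rewrite /factor ltnSn mxE eqxx.
  rewrite /partial (bigD1 i0)//= Ef /G -/(slab _ _ _).
  rewrite mulrCA mulrC; congr (_ * _ * _)%:E; apply: eq_bigr => i ii0.
  rewrite /factor mxE (negbTE ii0).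
  by have -> : (i < j.+1)%N = (i < j)%N by rewrite ltnS leq_eqVlt
    (negbTE (_ : val i != j)).
have [z z0 le] := step d (leqnn d).
exists z => //.
pose C n := [set s : measurableTypeR R | 1 <= partial d z n s].
have mC n : measurable (C n).
  rewrite -[C n]setTI.
  have -> : C n = (partial d z n) @^-1` `[1, +oo[%classic.
    by apply/seteqP; split=> s /=; rewrite in_itv/= andbT.
  exact: (measurable_prod xpredT).
exists (\bigcup_n C n); split.
- exact: bigcupT_measurable.
- apply: le_trans le.
  apply: le_trans (_ : _ <= \sum_(0 <= n <oo) mu (C n))%E _.
    by apply: measure_sigma_subadditive => //; exact: bigcupT_measurable.
  apply: lee_nneseries => [n *|n _]; first exact: measure_ge0.
  rewrite -[C n]setIT -integral_indic//.
  apply: ge0_le_integral => //.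
  + by apply/measurable_EFinP; exact: measurable_indic.
  + by apply/measurable_EFinP; exact: (measurable_prod xpredT).
  + move=> s _; rewrite lee_fin indicE.
    case: (pselect (C n s)) => h; first by rewrite mem_set.
    by rewrite memNset.
- move=> s n s01 [lo hi]; exists n => //.
  rewrite /C/= /partial slab_1// mul1r big1// => i _.
  rewrite /factor ltn_ord slab_1//; have := lo i; have := hi i; rewrite !mxE =>
    h1 h2.
  by apply/andP; split; lra.
Qed.

End Translate.

(** * Increments from almost everywhere gradients *)

Lemma le_of_linear_error {R : realType} (x c K : R) : 
  (forall eta, 0 < eta -> x <= c + K * eta) -> x <= c.
Proof.
move=> H; apply/ler_addgt0Pr => e e0.
have K0 : 0 < `|K| + 1 by rewrite ltr_wpDl.
apply: le_trans (H (e / (`|K| + 1)) _) _; first by rewrite divr_gt0.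
rewrite lerD2l mulrA ler_pdivrMr// mulrC ler_wpM2l//; first exact: ltW.
by apply: le_trans (ler_norm _) _; rewrite lerDl.
Qed.

Section OneDim.
Context {R : realType}.
Notation mu := (@lebesgue_measure R).
Let mR : measurableType _ := measurableTypeR R.

(** The function is s |-> length of [O] in [0, s]. *)
Lemma open_time (O : set mR) : open (O : set R) -> measurable O ->
  (mu O < +oo)%E ->
  exists m : R -> R, [/\ forall s, 0 <= m s <= fine (mu O),
    forall s s', s <= s' -> m s <= m s' &
    forall s h, 0 <= s -> 0 <= h -> (forall t, s <= t <= s + h -> O t) ->
      m s + h <= m (s + h)].
Proof.
move=> oO mO fO.
pose M s : \bar R := mu (O `&` `[0, s]%classic).
have mI s : measurable (O `&` `[0, s]%classic : set mR) by apply: measurableI.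
have leM s s' : s <= s' -> (M s <= M s')%E.
  move=> ss; apply: le_measure; rewrite ?inE//.
  by apply: setIS => t /=; rewrite !in_itv/= => /andP[-> /le_trans]; apply.
have MO s : (M s <= mu O)%E.
  by apply: le_measure; rewrite ?inE//; exact: subIsetl.
have fM s : M s \is a fin_num.
  by rewrite ge0_fin_numE ?measure_ge0//; exact: le_lt_trans (MO s) fO.
have fO' : mu O \is a fin_num by rewrite ge0_fin_numE ?measure_ge0.
exists (fun s => fine (M s)); split.
- by move=> s; rewrite fine_ge0 ?measure_ge0//= fine_le.
- by move=> s s' ss; apply: fine_le => //; exact: leM.
- move=> s h s0 h0 OI; rewrite -lee_fin EFinD !fineK//.
  have -> : h%:E = mu (`]s, (s + h)%R]%classic : set mR).
    rewrite lebesgue_measure_itv/= lte_fin; case: ltP => hh; last by congr (_%:E);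
      lra.
    by rewrite -EFinB; congr (_%:E); ring.
  rewrite -measureU//.
  + apply: le_measure; rewrite ?inE//.
    * exact: measurableU.
    * move=> t [[Ot]|] /=; rewrite !in_itv/= => /andP[t0 ts].
        by split=> //; apply/andP; split=> //; lra.
      by split; [apply: OI; apply/andP; split; lra|apply/andP; split; lra].
  + rewrite -subset0 => t [[_]] /=; rewrite !in_itv/= => /andP[_ ts] /andP[st _].
    by move: (lt_le_trans st ts); rewrite ltxx.
Qed.

(** The time spent in an open neighbourhood [O] of [B] is charged at the rate
    [L + `|c|]: the function
    u s - u 0 - (c + del) s - (L + |c|) * (length of O in [0, s])
    is nonpositive at 0 and can be continued as a nonpositive function to the
    right of each point, by the Lipschitz bound in [O] and by the derivative
    outside of [B]. *)
Lemma increment_le (u : R -> R) (L c e : R) (B : set mR) :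
  0 <= L -> 0 < e -> measurable B -> (mu B <= e%:E)%E ->
  (forall s s', 0 <= s -> s <= s' -> s' <= 1 -> u s' - u s <= L * (s' - s)) ->
  (forall s, 0 <= s -> s < 1 -> ~ B s -> forall del, 0 < del ->
     \forall h \near 0^'+, u (s + h) <= u s + (c + del) * h) ->
  u 1 - u 0 <= c + (L + `|c|) * (2 * e).
Proof.
move=> L0 e0 mB Be Lu du.
have [|O [oO BO OB]] := lebesgue_regularity_outer mB _ e0.
  by apply: le_lt_trans Be _; rewrite ltry.
have mO : measurable (O : set mR) by exact: open_measurable.
have muO : (mu O <= (2 * e)%:E)%E.
  have -> : O = B `|` (O `\` B) by rewrite setUDr setUidr// setDv setD0.
  apply: le_trans (measureU2 _ _ _) _ => //; first exact: measurableD.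
  have -> : 2 * e = e + e by ring.
  by rewrite EFinD; apply: leeD => //; exact: ltW.
have fO : (mu O < +oo)%E by apply: le_lt_trans muO _; rewrite ltry.
have [m [mb mono mopen]] := open_time oO mO fO.
have m2e s : m s <= 2 * e.
  have /andP[_ H] := mb s; apply: le_trans H _.
  by rewrite -lee_fin fineK// ge0_fin_numE// measure_ge0.
have c0 : - c <= `|c| by rewrite -normrN ler_norm.
have n0 := normr_ge0 c.
pose K := L + `|c|; have K0 : 0 <= K by rewrite addr_ge0.
apply/ler_addgt0Pr => del del0.
pose W s := u s - u 0 - (c + del) * s - K * m s.
suff W1 : W 1 <= 0.
  have : K * m 1 <= K * (2 * e) by rewrite ler_wpM2l.
  by move: W1; rewrite /W mulr1 -/K; lra.
pose A := [set s : R | 0 <= s <= 1 /\ W s <= 0].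
have A0 : A 0.
  split; first by rewrite lexx ler01.
  have /andP[m0 _] := mb 0; have : 0 <= K * m 0 by rewrite mulr_ge0.
  by rewrite /W subrr mulr0; lra.
have supA : has_sup A by split; [exists 0|exists 1 => s [/andP[]]].
set s0 := sup A.
have s00 : 0 <= s0 by apply: sup_upper_bound.
have s01 : s0 <= 1 by apply: sup_le_ub => [|s [/andP[]]]; first by exists 0.
have Ws0 : W s0 <= 0.
  apply/ler_addgt0Pr => eta eta0; rewrite add0r.
  have [a Aa la] := @sup_adherent R A (eta / (K + 1))
    (divr_gt0 eta0 (ltr_wpDl K0 ltr01)) supA.
  have as0 : a <= s0 by apply: sup_upper_bound.
  have [/andP[a0 a1] Wa] := Aa.
  have u1 := Lu _ _ a0 as0 s01.
  have : K * m a <= K * m s0 by rewrite ler_wpM2l//; exact: mono.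
  have : (s0 - a) * (K + 1) <= eta.
    by rewrite -ler_pdivlMr ?ltr_wpDl//; rewrite -/s0 in la; lra.
  have : 0 <= (del + `|c| + c + 1) * (s0 - a) by rewrite mulr_ge0//; lra.
  by move: Wa; rewrite /W /K; lra.
suff -> : 1 = s0 by [].
apply/eqP; rewrite eq_le s01 andbT leNgt; apply/negP => lt1.
suff [h [h0 h1 Wh]] : exists h, [/\ 0 < h, s0 + h <= 1 & W (s0 + h) <= 0].
  have : s0 + h <= s0.
    by apply: sup_upper_bound => //; split=> //; apply/andP; split=> //; lra.
  by lra.
have n1 : \forall h \near (0 : R)^'+, s0 + h <= 1.
  near=> h; have : h < 1 - s0 by near: h; apply: nbhs_right_lt; rewrite subr_gt0.
  by lra.
have [Os|nOs] := pselect (O s0).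
  have /nbhs_ballP[r /= r0 Br] := open_nbhs_nbhs (conj oO Os).
  near (0 : R)^'+ => h; exists h.
  have h0 : 0 < h by near: h; exact: nbhs_right_gt.
  have h1 : s0 + h <= 1 by near: h.
  split=> //.
  have hr : h < r by near: h; exact: nbhs_right_lt.
  have : m s0 + h <= m (s0 + h).
    apply: (mopen s0 h s00 (ltW h0)).
    move=> t /andP[t1 t2]; apply: Br; rewrite /ball/= ltr_norml; apply/andP;
      split; lra.
  move=> mm; have : K * (m s0 + h) <= K * m (s0 + h) by rewrite ler_wpM2l.
  have : u (s0 + h) - u s0 <= L * (s0 + h - s0) by apply: Lu => //; lra.
  have : 0 <= (del + `|c| + c) * h by rewrite mulr_ge0//; lra.
  by move: Ws0; rewrite /W /K; lra.
have nB : ~ B s0 by move=> /BO.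
have := du s0 s00 lt1 nB del del0 => nu.
near (0 : R)^'+ => h; exists h.
have h0 : 0 < h by near: h; exact: nbhs_right_gt.
have h1 : s0 + h <= 1 by near: h.
split=> //.
have : u (s0 + h) <= u s0 + (c + del) * h by near: h.
have : K * m s0 <= K * m (s0 + h) by rewrite ler_wpM2l//; apply: mono; lra.
by move: Ws0; rewrite /W; lra.
Unshelve. all: by end_near. Qed.

End OneDim.

Section Gradient.
Context {R : realType} {d : nat}.
Implicit Types (x y z v : 'cV[R]_d) (h : 'cV[R]_d -> R).

(** The norm is not normalized by the dimension. *)
Definition dist1 x y : R := \sum_i `|x i 0 - y i 0|.

Definition lip1 h (L : R) := forall x y, orthant x -> orthant y ->
  `|h x - h y| <= L * dist1 x y.

Lemma derive_dotv_grad h y v : differentiable h y -> 'D_v h y = dotv (grad h y) v.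
Proof.
move=> dh; rewrite deriveE//.
have {1}-> : v = \sum_i v i 0 *: delta_mx i 0.
  rewrite {1}[v]matrix_sum_delta; apply: eq_bigr => i _.
  by rewrite big_ord_recl big_ord0 addr0.
rewrite linear_sum; apply: eq_bigr => i _.
by rewrite linearZ/= mxE deriveE// mulrC.
Qed.

(** The segment is moved inside the open orthant, parallel to itself, to one
    that meets [N] in a set of small length; along that segment the derivative is
    at most [c] outside of this set. *)
Lemma increment_le_of_gradient h (L c : R) N x v :
  0 <= L -> lip1 h L -> lebesgue_null N ->
  (forall y, open_orthant y -> ~ N y -> differentiable h y /\ dotv (grad h y) v <=
    c) ->
  orthant x -> orthant (x + v) -> h (x + v) - h x <= c.
Proof.
move=> L0 lh nullN gradh x0 xv0.
pose V := \sum_i `|v i 0|; have V0 : 0 <= V by rewrite /V sumr_ge0.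
apply: (@le_of_linear_error _ _ _ ((L * V + `|c|) * 2 + 4 * L * d%:R)) =>
  eta eta0.
(* small_section turns a cover of volume e into sections of length eta. *)
pose e := eta * (eta / 2) ^+ d.
have eh0 : 0 < eta / 2 by lra.
have e0 : 0 < e by rewrite mulr_gt0// exprn_gt0.
have [a [b [ab Ncov vol]]] := nullN e e0.
pose x' : 'cV[R]_d := x + const_mx eta.
have [z z0 [B [mB Be inB]]] := @small_section R d a b x' v ab e eta e0 eta0 vol.
have eE : e * (2 / eta) ^+ d = eta.
  rewrite /e -mulrA -exprMn (_ : eta / 2 * (2 / eta) = 1) ?expr1n ?mulr1//.
  by field; rewrite gt_eqF.
rewrite eE in Be.
pose y s := x' + z + s *: v.
have ypos s : 0 <= s <= 1 -> open_orthant (y s).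
  move=> /andP[s0 s1] i; rewrite !mxE.
  have h1 := orthant_ge0 i x0; have := orthant_ge0 i xv0; rewrite mxE => h2.
  have /andP[zi _] := z0 i.
  have : 0 <= s * (x i 0 + v i 0) by rewrite mulr_ge0.
  have : 0 <= (1 - s) * x i 0 by rewrite mulr_ge0//; lra.
  by lra.
have yo s : 0 <= s <= 1 -> orthant (y s) by move=> /ypos;
  exact: open_orthant_orthant.
have main : h (y 1) - h (y 0) <= c + (L * V + `|c|) * (2 * eta).
  apply: (@increment_le R (h \o y) (L * V) c eta B) => //=.
  - exact: mulr_ge0.
  - move=> s s' s0 ss s1; apply: le_trans (ler_norm _) _.
    have is' : 0 <= s' <= 1 by apply/andP; split; lra.
    have is0 : 0 <= s <= 1 by apply/andP; split; lra.
    apply: le_trans (lh _ _ (yo _ is') (yo _ is0)) _.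
    rewrite -mulrA ler_wpM2l// /dist1 /V mulr_suml; apply: ler_sum => i _.
    rewrite !mxE (_ : _ - _ = v i 0 * (s' - s)); last by ring.
    by rewrite normrM (@ger0_norm _ (s' - s))// subr_ge0.
  - move=> s s0 s1 nB del del0.
    have is0 : 0 <= s <= 1 by apply/andP; split; lra.
    have nN : ~ N (y s) by move=> /Ncov [n _ bn]; apply: nB; apply: (inB s n).
    have [dh gle] := gradh _ (ypos _ is0) nN.
    have : 'D_v h (y s) < c + del by rewrite derive_dotv_grad//; lra.
    have dv : derivable h (y s) v := diff_derivable dh.
    move=> lt.
    have nq : \forall k \near (0 : R)^', k^-1 *: (h (k *: v + y s) - h (y s)) <
      c + del.
      exact: (cvgr_lt _ dv _ lt).
    have nq' : \forall k \near (0 : R)^'+, k^-1 *: (h (k *: v + y s) - h (y s)) <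
      c + del.
      move: nq; rewrite !near_withinE; apply: filterS => k H k0.
      by apply: H; rewrite gt_eqF.
    near=> k.
    have k0 : 0 < k by near: k; exact: nbhs_right_gt.
    have : k^-1 *: (h (k *: v + y s) - h (y s)) < c + del by near: k.
    rewrite (_ : k *: v + y s = y (s + k)); last by rewrite /y scalerDl;
      apply/colP => i; rewrite !mxE; ring.
    by rewrite /GRing.scale/= mulrC ltr_pdivrMr// => /ltW; lra.
have close s w : y s = w + (const_mx eta + z) -> orthant (y s) -> orthant w ->
    `|h (y s) - h w| <= L * (d%:R * (2 * eta)).
  move=> E oy ow; apply: le_trans (lh _ _ oy ow) _.
  rewrite ler_wpM2l// /dist1 -[d in d%:R]card_ord -sum1_card natr_sum mulr_suml.
  apply: ler_sum => i _; rewrite mul1r E !mxE.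
  rewrite (_ : _ - _ = eta + z i 0); last by ring.
  by have /andP[z1 z2] := z0 i; rewrite ger0_norm; lra.
have i1 : 0 <= (1 : R) <= 1 by rewrite ler01 lexx.
have i0 : 0 <= (0 : R) <= 1 by rewrite ler01 lexx.
have c1 : `|h (y 1) - h (x + v)| <= L * (d%:R * (2 * eta)).
  by apply: close => //; [rewrite /y /x'; apply/colP => i; rewrite !mxE;
    ring|exact: yo].
have c0 : `|h (y 0) - h x| <= L * (d%:R * (2 * eta)).
  by apply: close => //; [rewrite /y /x'; apply/colP => i; rewrite !mxE;
    ring|exact: yo].
move: c1 c0 main; rewrite !ler_norml => /andP[c1 _] /andP[_ c0]; lra.
Unshelve. all: by end_near. Qed.

End Gradient.

(** * The nonlinearity at one dyadic level *)

Section Norms.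
Context {R : realType} {d : nat}.
Implicit Types (x y z : 'cV[R]_d).

Lemma norm1s_ge0 y : 0 <= norm1s y.
Proof.
by rewrite /norm1s; elim/big_ind : _ => // a b a0 b0; rewrite le_max a0.
Qed.

Lemma norm1s_leP y c : 0 <= c -> (forall i, d%:R * `|y i 0| <= c) <->
  norm1s y <= c.
Proof.
move=> c0; split=> [H|]; first by apply/bigmax_leP.
by move=> /bigmax_leP[_ H] i; exact: H.
Qed.

Lemma le_norm1s y i : d%:R * `|y i 0| <= norm1s y.
Proof. by move: i; apply/norm1s_leP => //; exact: norm1s_ge0. Qed.

Lemma norm1_ge0 x : 0 <= norm1 x.
Proof. by rewrite mulr_ge0 ?invr_ge0// sumr_ge0. Qed.

Lemma norm1_orthant x : orthant x -> norm1 x = d%:R^-1 * sumv x.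
Proof.
move=> x0; congr (_ * _); apply: eq_bigr => i _.
by rewrite ger0_norm// orthant_ge0.
Qed.

Lemma orthantD x y : orthant x -> orthant y -> orthant (x + y).
Proof. by move=> x0 y0 i; rewrite !mxE addr_ge0 ?orthant_ge0. Qed.

Lemma orthantZ (a : R) x : 0 <= a -> orthant x -> orthant (a *: x).
Proof. by move=> a0 x0 i; rewrite !mxE mulr_ge0 ?orthant_ge0. Qed.

Lemma orthant_const (a : R) : 0 <= a -> orthant (const_mx a : 'cV[R]_d).
Proof. by move=> a0 i; rewrite !mxE. Qed.

Lemma dotvC x y : dotv x y = dotv y x.
Proof. by apply: eq_bigr => i _; rewrite mulrC. Qed.

Lemma dotvDr x y z : dotv x (y + z) = dotv x y + dotv x z.
Proof.
by rewrite /dotv -big_split; apply: eq_bigr => i _; rewrite mxE mulrDr.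
Qed.

Lemma dotvDl x y z : dotv (x + y) z = dotv x z + dotv y z.
Proof. by rewrite dotvC dotvDr !(dotvC z). Qed.

Lemma dotvZl (a : R) x y : dotv (a *: x) y = a * dotv x y.
Proof. by rewrite dotvC dotvZr dotvC. Qed.

Lemma dotv_ge0 x y : orthant x -> orthant y -> 0 <= dotv x y.
Proof.
by move=> x0 y0; apply: sumr_ge0 => i _; rewrite mulr_ge0 ?orthant_ge0.
Qed.

Lemma dotv_le x y z : orthant z -> lev x y -> dotv x z <= dotv y z.
Proof.
by move=> z0 xy; apply: ler_sum => i _; rewrite ler_wpM2r ?orthant_ge0.
Qed.

End Norms.

Lemma cardD_gt0 K : (0 < cardD K)%N.
Proof. by rewrite expn_gt0. Qed.

Section Nonlinearity.
Context {R : realType}.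
Variables (K : nat) (g : R -> R) (m M rho : R).
Hypotheses (m0 : 0 < m) (rho0 : 0 < rho).
Hypothesis gm : forall x, seg x -> m <= g x.
Hypothesis gM : forall x, seg x -> g x <= M.

Notation n := (cardD K).
Notation vec := 'cV[R]_n.
Implicit Types (x y w : vec).

Let n0 : 0 < n%:R :> R.
Proof. by rewrite ltr0n cardD_gt0. Qed.

Definition kern (i j : 'I_n) : R := g (dyad i * dyad j).

Lemma seg_mul (s t : R) : seg s -> seg t -> seg (s * t).
Proof.
rewrite /seg/= !in_itv/= => s1 t1; rewrite -ler_norml normrM.
by rewrite -[leRHS]mulr1 ler_pM// ler_norml.
Qed.

Lemma kern_ge i j : m <= kern i j.
Proof. by apply: gm; apply: seg_mul; exact: dyad_seg. Qed.

Lemma kern_le i j : kern i j <= M.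
Proof. by apply: gM; apply: seg_mul; exact: dyad_seg. Qed.

Lemma mM : m <= M.
Proof.
exact: le_trans (kern_ge (Ordinal (cardD_gt0 K)) (Ordinal (cardD_gt0 K)))
  (kern_le _ _).
Qed.

Let M0 : 0 < M := lt_le_trans m0 mM.

Lemma GK_coord x i : n%:R * (GK K g *m x) i 0 = n%:R^-1 * \sum_j kern i j * x j 0.
Proof.
rewrite mxE !mulr_sumr; apply: eq_bigr => j _; rewrite mxE /kern.
by field; rewrite gt_eqF.
Qed.

Lemma GK_ge0 x : orthant x -> orthant (GK K g *m x).
Proof.
move=> x0 i; rewrite !mxE; apply: sumr_ge0 => j _; rewrite mxE.
rewrite mulr_ge0 ?orthant_ge0// mulr_ge0 ?invr_ge0 ?sqr_ge0//.
exact: le_trans (ltW m0) (kern_ge i j).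
Qed.

Lemma GK_coord_ge x i : orthant x -> m * norm1 x <= n%:R * (GK K g *m x) i 0.
Proof.
move=> x0; rewrite GK_coord norm1_orthant// mulrCA ler_wpM2l ?invr_ge0//.
rewrite /sumv mulr_sumr; apply: ler_sum => j _.
by rewrite ler_wpM2r ?orthant_ge0// kern_ge.
Qed.

Lemma GK_coord_le x i : orthant x -> n%:R * (GK K g *m x) i 0 <= M * norm1 x.
Proof.
move=> x0; rewrite GK_coord norm1_orthant// [leRHS]mulrCA ler_wpM2l ?invr_ge0//.
rewrite /sumv mulr_sumr; apply: ler_sum => j _.
by rewrite ler_wpM2r ?orthant_ge0// kern_le.
Qed.

Lemma norm1s_GK_le x c : orthant x -> 0 <= c ->
  (forall i, n%:R * (GK K g *m x) i 0 <= c) -> norm1s (GK K g *m x) <= c.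
Proof.
move=> x0 c0 H; apply/norm1s_leP => // i.
by rewrite ger0_norm// orthant_ge0//; exact: GK_ge0.
Qed.

Lemma le_norm1s_GK x i : n%:R * (GK K g *m x) i 0 <= norm1s (GK K g *m x).
Proof. by apply: le_trans (le_norm1s _ i); rewrite ler_wpM2l// ler_norm. Qed.

Lemma norm1_le_norm1s x : orthant x -> m * norm1 x <= norm1s (GK K g *m x).
Proof.
by move=> x0; apply: le_trans (le_norm1s_GK _ (Ordinal (cardD_gt0 K)));
  exact: GK_coord_ge.
Qed.

Lemma dotv_norm1 w x : orthant x -> orthant w -> dotv w x <= norm1s w * norm1 x.
Proof.
move=> x0 w0; rewrite norm1_orthant// /sumv mulrA mulr_sumr; apply: ler_sum =>
  i _.
rewrite ler_wpM2r ?orthant_ge0// ler_pdivlMr// mulrC.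
by apply: le_trans (le_norm1s _ i); rewrite ler_wpM2l// ler_norm.
Qed.

(** The value of [sfC] at [GK K g *m x]; working with [x] avoids inverting the
    matrix. *)
Definition quadC x : R := 2^-1 * dotv (GK K g *m x) x.
Definition cap : R := 2 * rho ^+ 2 / m.
Definition linC (nu : R) : R := 8 * rho / m * (nu - rho).

Lemma quadC_ge0 x : orthant x -> 0 <= quadC x.
Proof. by move=> x0; rewrite mulr_ge0 ?invr_ge0// dotv_ge0//; exact: GK_ge0. Qed.

Lemma quadC_le x : orthant x -> quadC x <= norm1s (GK K g *m x) ^+ 2 / (2 * m).
Proof.
move=> x0; have h1 := norm1_le_norm1s x0; have h2 := dotv_norm1 x0 (GK_ge0 x0).
set nu := norm1s _ in h1 h2 *; have nu0 : 0 <= nu by exact: norm1s_ge0.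
rewrite /quadC ler_pdivlMr ?mulr_gt0//.
have : nu * (m * norm1 x) <= nu * nu by rewrite ler_wpM2l.
have : m * dotv (GK K g *m x) x <= m * (nu * norm1 x) by rewrite ler_wpM2l// ltW.
by rewrite expr2; lra.
Qed.

Lemma cap_gt0 : 0 < cap.
Proof. by rewrite divr_gt0// mulr_gt0// exprn_gt0. Qed.

Lemma linC_mono s t : s <= t -> linC s <= linC t.
Proof. by move=> st; rewrite ler_wpM2l ?lerD2r// divr_ge0 ?mulr_ge0// ltW. Qed.

Lemma linC_cap nu : 2 * rho <= nu -> cap <= linC nu.
Proof.
move=> /linC_mono; apply: le_trans; rewrite /linC /cap.
have -> : 8 * rho / m * (2 * rho - rho) = 8 * rho ^+ 2 / m by ring.
by rewrite ler_pM2r ?invr_gt0// ler_pM2r ?exprn_gt0// ler_nat.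
Qed.

(** The case distinction in [sfCR] disappears on the cone: the quadratic form is
    at most [cap] when the dual norm is at most [2 * rho], and the linear part
    exceeds [cap] beyond. *)
Lemma sfCR_GK x : orthant x ->
  sfCR g m rho (GK K g *m x) = Num.max (Num.min (quadC x) cap)
    (linC (norm1s (GK K g *m x))).
Proof.
move=> x0; rewrite /sfCR sfC_GK// -/(quadC x) -/(linC _).
have [le|gt] := leP (norm1s (GK K g *m x)) (2 * rho).
  congr Num.max; apply/esym/min_idPl; apply: le_trans (quadC_le x0) _.
  have nu0 := norm1s_ge0 (GK K g *m x).
  rewrite /cap invfM mulrA ler_wpM2r ?invr_ge0 ?(ltW m0)// ler_pdivrMr//.
  by rewrite expr2 expr2; have := ler_pM nu0 nu0 le le; lra.
by apply/esym/max_idPr; rewrite ge_min linC_cap ?orbT// ltW.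
Qed.

Lemma sfCR_ge0 x : orthant x -> 0 <= sfCR g m rho (GK K g *m x).
Proof.
by move=> x0; rewrite sfCR_GK// le_max le_min quadC_ge0// ltW// cap_gt0.
Qed.

Let Hset y := [set sfCR g m rho w | w in [set w | calC g w /\ lev y w]].

Let Hset_lb y : lbound (Hset y) 0.
Proof. by move=> _ [w [[x x0 <-] _] <-]; exact: sfCR_ge0. Qed.

Lemma sfH_le x y : orthant x -> lev y (GK K g *m x) ->
  sfH g m rho y <= sfCR g m rho (GK K g *m x).
Proof.
move=> x0 yx; apply: ge_inf; first by exists 0; exact: Hset_lb.
by exists (GK K g *m x) => //; split=> //; exists x.
Qed.

Lemma norm1_const (c : R) : 0 <= c -> norm1 (const_mx c : vec) = c.
Proof.
move=> c0; rewrite norm1_orthant; last exact: orthant_const.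
rewrite /sumv (eq_bigr (fun=> c)) => [|j _]; last by rewrite mxE.
rewrite sumr_const card_ord -[c *+ _]mulr_natl mulrA mulVf ?mul1r// gt_eqF//.
Qed.

Lemma lev_GK_const y c : norm1s y <= c -> lev y (GK K g *m const_mx (c / m)).
Proof.
move=> yc i; have c0 : 0 <= c := le_trans (norm1s_ge0 y) yc.
have cm0 : 0 <= c / m by rewrite divr_ge0// ltW.
rewrite -(ler_pM2l n0);
  apply: le_trans (GK_coord_ge i (orthant_const (d := n) cm0)).
rewrite norm1_const// [leRHS]mulrC divfK ?gt_eqF//; apply: le_trans yc;
  apply: le_trans (le_norm1s _ i).
by rewrite ler_wpM2l// ler_norm.
Qed.

Lemma le_sfH y (c : R) : (forall x, orthant x -> lev y (GK K g *m x) ->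
   c <= sfCR g m rho (GK K g *m x)) -> c <= sfH g m rho y.
Proof.
move=> H; apply: lb_le_inf.
  set x : vec := const_mx (norm1s y / m).
  exists (sfCR g m rho (GK K g *m x)), (GK K g *m x) => //; split;
    last exact: lev_GK_const.
  by exists x => //; apply: orthant_const; rewrite divr_ge0 ?norm1s_ge0// ltW.
by move=> _ [w [[x x0 <-] yx] <-]; exact: H.
Qed.

Lemma sfH_nondecr : nondecr (sfH g m rho : vec -> R).
Proof.
move=> y y' yy'; apply: le_sfH => x x0 y'x; apply: sfH_le => // i.
exact: le_trans (yy' i) (y'x i).
Qed.

Lemma sfH_bound y : norm1s y <= rho -> sfH g m rho y <= cap + 8 * rho / m *
  (M * (rho / m)).
Proof.
move=> yr; have c0 : 0 <= rho / m by rewrite divr_ge0// ltW.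
have ox := orthant_const (d := n) c0.
apply: le_trans (sfH_le ox (lev_GK_const yr)) _.
have k0 : 0 <= 8 * rho / m by rewrite divr_ge0 ?mulr_ge0// ltW.
have e0 : 0 <= 8 * rho / m * (M * (rho / m)) by rewrite mulr_ge0// mulr_ge0// ltW.
rewrite sfCR_GK// ge_max; apply/andP; split.
  by rewrite ge_min [X in _ || X]lerDl e0 orbT.
apply: (@le_trans _ _ (8 * rho / m * (M * (rho / m))));
  last by rewrite lerDr ltW// cap_gt0.
rewrite ler_wpM2l// lerBlDr ler_wpDr ?(ltW rho0)//.
apply: norm1s_GK_le => //; first by rewrite mulr_ge0// ltW.
by move=> i; apply: le_trans (GK_coord_le i ox) _; rewrite norm1_const.
Qed.

(** A Lipschitz constant of the nonlinearity for the normalized dual norm; it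
    does not depend on the level. *)
Definition LH : R := 2 * rho / m + M / (2 * m ^+ 2) + cap + 8 * rho * M / m ^+ 2.

Lemma LH_ge0 : 0 <= LH.
Proof.
rewrite /LH !addr_ge0 ?divr_ge0 ?mulr_ge0 ?exprn_ge0 ?sqr_ge0//; exact: ltW.
Qed.

Lemma quadCD x z : quadC (x + z) = quadC x + dotv (GK K g *m x) z + quadC z.
Proof.
rewrite /quadC mulmxDr dotvDl !dotvDr (dotv_GK g z x) [dotv (GK K g *m x) z]dotvC.
by lra.
Qed.

Lemma quadC_le_norm1 x : orthant x -> quadC x <= M / 2 * norm1 x ^+ 2.
Proof.
move=> x0; have h2 := dotv_norm1 x0 (GK_ge0 x0).
have h3 : norm1s (GK K g *m x) <= M * norm1 x.
  apply: norm1s_GK_le => //; first by rewrite mulr_ge0 ?norm1_ge0// ltW.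
  by move=> i; exact: GK_coord_le.
have := ler_wpM2r (norm1_ge0 x) h3.
by rewrite /quadC expr2; lra.
Qed.

(** The quadratic form matters only when the dual norm is at most [2 * rho], where
    it grows at a bounded rate; [cap] takes care of large [s]. *)
Lemma sfCR_shift x (s : R) : orthant x -> 0 <= s ->
  sfCR g m rho (GK K g *m (x + const_mx (s / m))) <= sfCR g m rho (GK K g *m x) +
    LH * s.
Proof.
move=> x0 s0; have sm0 : 0 <= s / m by rewrite divr_ge0// ltW.
set z : vec := const_mx (s / m).
have z0 : orthant z by exact: orthant_const.
have nz : norm1 z = s / m by rewrite norm1_const.
have xz0 := orthantD x0 z0.
set nu := norm1s (GK K g *m x); have nu0 : 0 <= nu by exact: norm1s_ge0.
have nu' : norm1s (GK K g *m (x + z)) <= nu + M * (s / m).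
  apply: norm1s_GK_le => //; first by rewrite addr_ge0// mulr_ge0// ltW.
  move=> i; rewrite mulmxDr mxE mulrDr lerD//; first exact: le_norm1s_GK.
  by apply: le_trans (GK_coord_le i z0) _; rewrite nz.
have t1 : 0 <= 2 * rho / m * s by rewrite mulr_ge0// divr_ge0 ?mulr_ge0// ltW.
have t2 : 0 <= M / (2 * m ^+ 2) * s by rewrite mulr_ge0// divr_ge0 ?mulr_ge0
  ?sqr_ge0// ltW.
have t3 : 0 <= cap * s by rewrite mulr_ge0// ltW// cap_gt0.
have t4 : 0 <= 8 * rho * M / m ^+ 2 * s by rewrite mulr_ge0// divr_ge0 ?mulr_ge0
  ?sqr_ge0// ltW.
have LHs : LH * s = 2 * rho / m * s + M / (2 * m ^+ 2) * s + cap * s + 8 * rho *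
  M / m ^+ 2 * s.
  by rewrite /LH; ring.
rewrite !sfCR_GK// ge_max; apply/andP; split; last first.
  apply: le_trans (linC_mono nu') _.
  have : linC nu <= Num.max (Num.min (quadC x) cap) (linC nu)
    by rewrite le_max lexx orbT.
  have -> : linC (nu + M * (s / m)) = linC nu + 8 * rho * M / m ^+ 2 * s.
    by rewrite /linC; field; rewrite gt_eqF.
  by lra.
have [nule|nugt] := leP nu (2 * rho); last first.
  apply: (@le_trans _ _ cap); first by rewrite ge_min lexx orbT.
  have := linC_cap (ltW nugt).
  have : linC nu <= Num.max (Num.min (quadC x) cap) (linC nu)
    by rewrite le_max lexx orbT.
  by lra.
apply: (@le_trans _ _ (Num.min (quadC x) cap + LH * s)); last first.
  by rewrite lerD2r le_max lexx.
have LHs0 : 0 <= LH * s by rewrite mulr_ge0// LH_ge0.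
have [ge1|lt1] := leP 1 s.
  have q0 : 0 <= Num.min (quadC x) cap by rewrite le_min quadC_ge0//=
    ltW// cap_gt0.
  apply: (@le_trans _ _ cap); first by rewrite ge_min lexx orbT.
  have : cap <= cap * s by rewrite ler_peMr// ltW// cap_gt0.
  by lra.
rewrite addr_minl; rewrite le_min; apply/andP; split; last first.
  by rewrite ge_min; apply/orP; right; lra.
rewrite ge_min; apply/orP; left; rewrite quadCD -addrA lerD2l.
have d1 := dotv_norm1 z0 (GK_ge0 x0); rewrite -/nu nz in d1.
have d2 := quadC_le_norm1 z0; rewrite nz in d2.
have d3 : nu * (s / m) <= 2 * rho * (s / m) by rewrite ler_wpM2r.
have d4 : M / 2 * (s / m) ^+ 2 <= M / (2 * m ^+ 2) * s.
  have -> : M / 2 * (s / m) ^+ 2 = M / (2 * m ^+ 2) * (s * s).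
    by field; rewrite gt_eqF.
  apply: ler_wpM2l; first by rewrite divr_ge0 ?mulr_ge0 ?sqr_ge0// ltW.
  by rewrite ler_piMr// ltW.
have E4 : 2 * rho / m * s = 2 * rho * (s / m) by ring.
rewrite E4 in LHs t1.
by lra.
Qed.

(** If [GK K g *m x] is a competitor for [y], adding a multiple of the constant
    vector to [x] gives a competitor for the translated vector, because the
    entries of the kernel are at least [m]. *)
Lemma sfH_diag_lip : diag_lip (sfH g m rho : vec -> R) (n%:R * LH).
Proof.
move=> y s s0; rewrite -lerBlDr; apply: le_sfH => x x0 yx; rewrite lerBlDr.
have ns0 : 0 <= n%:R * s by rewrite mulr_ge0.
have nsm0 : 0 <= n%:R * s / m by rewrite divr_ge0// ltW.
rewrite mulrAC mulrC; apply: le_trans (sfCR_shift x0 ns0); apply: sfH_le.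
  by apply: orthantD => //; exact: orthant_const.
move=> i; rewrite mulmxDr !mxE lerD//; first by have := yx i; rewrite mxE.
have := GK_coord_ge i (orthant_const (d := n) nsm0).
by rewrite norm1_const// [leLHS]mulrC divfK ?gt_eqF// ler_pM2l// mxE.
Qed.

(** By symmetry of the matrix, G x . x <= G x' . x = G x . x' <= G x' . x'. *)
Lemma quadC_mono x x' : orthant x -> orthant x' ->
  lev (GK K g *m x) (GK K g *m x') -> quadC x <= quadC x'.
Proof.
move=> x0 x'0 le; rewrite ler_wpM2l ?invr_ge0//.
apply: le_trans (dotv_le x0 le) _; rewrite dotv_GK; exact: dotv_le.
Qed.

(** On the cone the nonlinearity is nondecreasing, so that the vector itself is
    the best competitor; the linear part is nonpositive there. *)
Lemma sfH_GK x : orthant x -> norm1s (GK K g *m x) <= rho ->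
  sfH g m rho (GK K g *m x) = quadC x.
Proof.
move=> x0 nur; have nu0 := norm1s_ge0 (GK K g *m x).
have qcap : quadC x <= cap.
  apply: le_trans (quadC_le x0) _; rewrite /cap invfM mulrA ler_wpM2r ?invr_ge0
    ?(ltW m0)//.
  by rewrite ler_pdivrMr//; have := ler_pM nu0 nu0 nur nur; rewrite -!expr2; nra.
have lin0 : linC (norm1s (GK K g *m x)) <= 0.
  rewrite mulr_ge0_le0// ?subr_le0// divr_ge0 ?mulr_ge0//; exact: ltW.
apply/eqP; rewrite eq_le; apply/andP; split.
  apply: le_trans (sfH_le x0 _) _; first by move=> i.
  rewrite sfCR_GK// ge_max; apply/andP; split; first by rewrite ge_min lexx.
  exact: le_trans lin0 (quadC_ge0 x0).
apply: le_sfH => x' x'0 le; rewrite sfCR_GK// le_max le_min qcap andbT.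
by rewrite quadC_mono.
Qed.

End Nonlinearity.

(** * Refinement of dyadic levels *)

Section Cells.
Context {R : realType}.
Variables (K K' : nat).
Hypothesis hK : (K <= K')%N.

Definition subdiv : nat := 2 ^ (K' - K).

Lemma subdiv_gt0 : (0 < subdiv)%N.
Proof. by rewrite expn_gt0. Qed.

Lemma cardD_subdiv : cardD K' = (cardD K * subdiv)%N.
Proof. by rewrite /cardD /subdiv -expnD addSn subnKC. Qed.

Lemma cell_proof (i : 'I_(cardD K')) : (i %/ subdiv < cardD K)%N.
Proof. by rewrite ltn_divLR ?subdiv_gt0// -cardD_subdiv. Qed.

Definition cell (i : 'I_(cardD K')) : 'I_(cardD K) := Ordinal (cell_proof i).

Lemma sub_proof (i : 'I_(cardD K)) (j : 'I_subdiv) : (i * subdiv + j <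
  cardD K')%N.
Proof.
apply: (@leq_trans (i * subdiv + subdiv)%N); first by rewrite ltn_add2l.
by rewrite -mulSnr cardD_subdiv leq_mul2r ltn_ord orbT.
Qed.

Definition sub_index i j : 'I_(cardD K') := Ordinal (sub_proof i j).

Definition left_end (i : 'I_(cardD K)) := sub_index i (Ordinal subdiv_gt0).

Lemma cell_sub_index i j : cell (sub_index i j) = i.
Proof.
by apply: val_inj; rewrite /= divnMDl ?subdiv_gt0// divn_small// addn0.
Qed.

Lemma cell_left_end i : cell (left_end i) = i.
Proof. exact: cell_sub_index. Qed.

Lemma sum_fiber (F : 'I_(cardD K') -> R) i :
  \sum_(k | cell k == i) F k = \sum_j F (sub_index i j).
Proof.
rewrite (reindex_onto (sub_index i) (fun k => Ordinal (ltn_pmod k subdiv_gt0)))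
  /=.
  apply: eq_bigl => j; rewrite cell_sub_index eqxx/=; apply/eqP/val_inj => /=.
  by rewrite modnMDl modn_small.
by move=> k /eqP <-; apply: val_inj; rewrite /= -divn_eq.
Qed.

Lemma sum_cells (F : 'I_(cardD K') -> R) :
  \sum_k F k = \sum_i \sum_(k | cell k == i) F k.
Proof. exact: partition_big. Qed.

Notation n := (cardD K).
Notation n' := (cardD K').
Notation vec := 'cV[R]_n.
Notation vec' := 'cV[R]_n'.

Let r0 : 0 < subdiv%:R :> R. Proof. by rewrite ltr0n subdiv_gt0. Qed.
Let n0 : 0 < n%:R :> R. Proof. by rewrite ltr0n cardD_gt0. Qed.
Let nr : n'%:R = n%:R * subdiv%:R :> R. Proof. by rewrite cardD_subdiv natrM. Qed.
Let n'0 : 0 < n'%:R :> R. Proof. by rewrite ltr0n cardD_gt0. Qed.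

(** [avg] averages over the cells of the coarse level, [replicate] is its right
    inverse that is constant on cells, and [pull] is its transpose. *)
Definition avg (X : vec') : vec :=
  \col_i (subdiv%:R^-1 * \sum_(k | cell k == i) X k 0).
Definition replicate (x : vec) : vec' := \col_k x (cell k) 0.
Definition pull (q : vec) : vec' := \col_k (subdiv%:R^-1 * q (cell k) 0).

Lemma avg_replicate x : avg (replicate x) = x.
Proof.
apply/colP => i; rewrite mxE sum_fiber (eq_bigr (fun=> x i 0)) => [|j _];
  last first.
  by rewrite mxE cell_sub_index.
by rewrite sumr_const card_ord -[x i 0 *+ _]mulr_natl mulrA mulVf ?mul1r// gt_eqF.
Qed.

Lemma sum_avg (F : 'I_n -> R) X :
  \sum_i F i * avg X i 0 = subdiv%:R^-1 * \sum_k F (cell k) * X k 0.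
Proof.
rewrite sum_cells mulr_sumr; apply: eq_bigr => i _.
by rewrite mxE mulrCA; congr (_ * _); rewrite mulr_sumr; apply: eq_bigr =>
  k /eqP ->.
Qed.

Lemma dotv_pull q X : dotv (pull q) X = dotv q (avg X).
Proof.
rewrite /dotv sum_avg mulr_sumr; apply: eq_bigr => k _.
by rewrite mxE mulrA.
Qed.

Lemma avgD X Y : avg (X + Y) = avg X + avg Y.
Proof.
apply/colP => i; rewrite !mxE -mulrDr -big_split; congr (_ * _).
by apply: eq_bigr => k _; rewrite mxE.
Qed.

Lemma avgZ (a : R) X : avg (a *: X) = a *: avg X.
Proof.
apply/colP => i; rewrite !mxE mulrCA; congr (_ * _); rewrite mulr_sumr.
by apply: eq_bigr => k _; rewrite mxE.
Qed.

Lemma avgB X Y : avg (X - Y) = avg X - avg Y.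
Proof. by rewrite -scaleN1r avgD avgZ scaleN1r. Qed.

Lemma avg_orthant X : orthant X -> orthant (avg X).
Proof.
move=> X0 i; rewrite !mxE mulr_ge0 ?invr_ge0// sumr_ge0// => k _.
exact: orthant_ge0.
Qed.

Lemma avg_open X : open_orthant X -> open_orthant (avg X).
Proof.
move=> X0 i; rewrite !mxE mulr_gt0 ?invr_gt0// sum_fiber.
rewrite (bigD1 (Ordinal subdiv_gt0))//=; apply: ltr_wpDr; last exact: X0.
by apply: sumr_ge0 => k _; exact/ltW/X0.
Qed.

Lemma replicate_orthant x : orthant x -> orthant (replicate x).
Proof. by move=> x0 k; rewrite !mxE orthant_ge0. Qed.

Lemma norm1s_pull q : norm1s (pull q) = norm1s q.
Proof.
have E k : n'%:R * `|pull q k 0| = n%:R * `|q (cell k) 0|.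
  rewrite mxE normrM normfV (@ger0_norm _ subdiv%:R)// nr.
  by field; rewrite gt_eqF.
apply/eqP; rewrite eq_le; apply/andP; split; apply/norm1s_leP;
  rewrite ?norm1s_ge0// => i.
  by rewrite E; exact: le_norm1s.
by rewrite -[i]cell_left_end -E; exact: le_norm1s.
Qed.

Lemma lev_pull (q y : vec) (Y : vec') : (forall k, n%:R * y (cell k) 0 <=
  n'%:R * Y k 0) ->
  lev q y -> lev (pull q) Y.
Proof.
move=> H qy k; rewrite mxE -(ler_pM2l n'0); apply: le_trans (H k).
rewrite nr mulrA mulfK ?gt_eqF// ler_pM2l//; exact: qy.
Qed.

Lemma unpull_lev (q y : vec) (Y : vec') : (forall k, n'%:R * Y k 0 <= n%:R *
  y (cell k) 0) ->
  lev (pull q) Y -> lev q y.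
Proof.
move=> H qY i; rewrite -(ler_pM2l n0) -[i]cell_left_end.
apply: le_trans (H (left_end i)); have := qY (left_end i).
by rewrite -(ler_pM2l n'0) mxE nr mulrA mulfK ?gt_eqF.
Qed.

Lemma dyad_cell (k : 'I_n') : 0 <= (dyad k : R) - dyad (cell k) <= 2 ^- K.
Proof.
have p0 j : 0 < 2 ^+ j :> R by rewrite exprn_gt0.
have pr : 2 ^+ K' = 2 ^+ K * subdiv%:R :> R.
  by rewrite /subdiv natrX -exprD subnKC.
have -> : dyad k - dyad (cell k) = (k %% subdiv)%:R / (2 ^+ K * subdiv%:R) :> R.
  rewrite /dyad /= pr {1}(divn_eq k subdiv) natrD natrM.
  by field; rewrite !gt_eqF ?p0.
apply/andP; split; first by rewrite divr_ge0// mulr_ge0// exprn_ge0.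
rewrite ler_pdivrMr ?mulr_gt0// mulrA mulVf ?mul1r ?gt_eqF//.
by rewrite ler_nat ltnW// ltn_pmod// subdiv_gt0.
Qed.

Lemma dyad_left_end (i : 'I_n) : dyad (left_end i) = dyad i :> R.
Proof.
have pr : 2 ^+ K' = 2 ^+ K * subdiv%:R :> R by rewrite /subdiv natrX
  -exprD subnKC.
rewrite /dyad/= addn0 natrM pr; congr (_ - 1); field.
by rewrite !gt_eqF ?exprn_gt0.
Qed.

End Cells.

(** Modulus of continuity of (s, t) |-> g (s * t) at the scale of the cells. *)
Definition osc {R : realType} (g : R -> R) (K : nat) (w : R) :=
  forall s t s' t' : R, seg s -> seg t -> seg s' -> seg t' ->
    `|s - s'| <= 2 ^- K -> `|t - t'| <= 2 ^- K -> `|g (s * t) - g (s' * t')| <= w.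

Lemma sfCR_scale {R : realType} (K K' : nat) (g : R -> R) (m rho lam : R)
    (x : 'cV[R]_(cardD K)) (x' : 'cV[R]_(cardD K')) :
  0 < m -> 0 < rho -> (forall x, seg x -> m <= g x) -> 1 <= lam -> orthant x ->
    orthant x' ->
  quadC g x' <= lam * quadC g x ->
  norm1s (GK K' g *m x') <= lam * norm1s (GK K g *m x) ->
  sfCR g m rho (GK K' g *m x') <=
    lam * sfCR g m rho (GK K g *m x) + 8 * rho ^+ 2 / m * (lam - 1).
Proof.
move=> m0 rho0 gm lam1 x0 x'0 qle nle.
have cap0 := cap_gt0 m0 rho0.
have e0 : 0 <= 8 * rho ^+ 2 / m * (lam - 1).
  by rewrite mulr_ge0 ?subr_ge0// divr_ge0 ?mulr_ge0 ?sqr_ge0// ltW.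
have l0 : 0 <= lam by lra.
have S := sfCR_GK m0 rho0 gm x0; have S0 := sfCR_ge0 m0 rho0 gm x0.
set s := sfCR g m rho (GK K g *m x) in S S0 *.
rewrite sfCR_GK// ge_max; apply/andP; split.
  apply: le_trans (_ : _ <= lam * s) _; last by lra.
  apply: (@le_trans _ _ (lam * Num.min (quadC g x) (cap m rho))); last first.
    by rewrite ler_wpM2l// S le_max lexx.
  rewrite minr_pMr// le_min !ge_min qle/=.
  by apply/orP; right; rewrite ler_peMl// ltW.
apply: le_trans (linC_mono m0 rho0 nle) _.
have : lam * linC m rho (norm1s (GK K g *m x)) <= lam * s.
  by rewrite ler_wpM2l// S le_max lexx orbT.
have -> : linC m rho (lam * norm1s (GK K g *m x)) =
  lam * linC m rho (norm1s (GK K g *m x)) + 8 * rho ^+ 2 / m * (lam - 1).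
  by rewrite /linC; ring.
by lra.
Qed.

Section Levels.
Context {R : realType}.
Variables (K K' : nat) (g : R -> R) (m M rho w : R).
Hypotheses (hK : (K <= K')%N) (m0 : 0 < m) (rho0 : 0 < rho).
Hypothesis gm : forall x, seg x -> m <= g x.
Hypothesis gM : forall x, seg x -> g x <= M.
Hypothesis gw : osc g K w.

Notation n := (cardD K).
Notation n' := (cardD K').
Let lam := 1 + w / m.

Let w0 : 0 <= w.
Proof.
have s0 : seg (0 : R) by rewrite /seg/= in_itv/= lerN10 ler01.
by apply: le_trans (gw s0 s0 s0 s0 _ _);
  rewrite ?subrr ?normr0 ?invr_ge0 ?exprn_ge0.
Qed.

Let lam1 : 1 <= lam.
Proof. by rewrite /lam lerDl divr_ge0// ltW. Qed.

Let lam0 : 0 < lam := lt_le_trans ltr01 lam1.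

Let kern_close k l : `|kern g (cell hK k) (cell hK l) - kern g k l| <= w.
Proof.
have H j : `|dyad (cell hK j) - dyad j| <= 2 ^- K :> R.
  by rewrite distrC; have /andP[h1 h2] := @dyad_cell R _ _ hK j;
    rewrite ger0_norm.
by apply: gw; rewrite ?H//; exact: dyad_seg.
Qed.

Let le_lam a b : m <= b -> `|a - b| <= w -> a <= lam * b.
Proof.
rewrite ler_norml => mb /andP[_ h]; rewrite /lam mulrDl mul1r.
have : w <= w / m * b by rewrite mulrAC ler_pdivlMr// ler_wpM2l.
by lra.
Qed.

Let r0 : 0 < (subdiv K K')%:R :> R. Proof. by rewrite ltr0n subdiv_gt0. Qed.
Let n0 : 0 < n%:R :> R. Proof. by rewrite ltr0n cardD_gt0. Qed.
Let nr : n'%:R = n%:R * (subdiv K K')%:R :> R.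
Proof.
by rewrite (cardD_subdiv hK) natrM.
Qed.
Let n'0 : 0 < n'%:R :> R. Proof. by rewrite ltr0n cardD_gt0. Qed.

Lemma GK_avg (X : 'cV[R]_n') i : n%:R * (GK K g *m avg hK X) i 0 =
  n'%:R^-1 * \sum_l kern g i (cell hK l) * X l 0.
Proof. by rewrite GK_coord sum_avg mulrA nr invfM. Qed.

Lemma GK_avg_le (X : 'cV[R]_n') k : orthant X ->
  n%:R * (GK K g *m avg hK X) (cell hK k) 0 <= lam * (n'%:R * (GK K' g *m X) k 0).
Proof.
move=> X0; rewrite GK_avg GK_coord mulrCA ler_wpM2l ?invr_ge0 ?(ltW n'0)//.
rewrite mulr_sumr; apply: ler_sum => l _; rewrite mulrA ler_wpM2r ?orthant_ge0//.
by apply: le_lam; [exact: kern_ge|exact: kern_close].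
Qed.

Lemma GK_le_avg (X : 'cV[R]_n') k : orthant X ->
  n'%:R * (GK K' g *m X) k 0 <= lam * (n%:R * (GK K g *m avg hK X) (cell hK k) 0).
Proof.
move=> X0; rewrite GK_avg GK_coord mulrCA ler_wpM2l ?invr_ge0 ?(ltW n'0)//.
rewrite mulr_sumr; apply: ler_sum => l _; rewrite mulrA ler_wpM2r ?orthant_ge0//.
by apply: le_lam; [exact: kern_ge|rewrite distrC; exact: kern_close].
Qed.

Lemma quadC_avgE (X : 'cV[R]_n') : quadC g (avg hK X) =
  2^-1 * (n'%:R^-1 * \sum_k (n%:R * (GK K g *m avg hK X) (cell hK k) 0) * X k 0).
Proof.
rewrite /quadC -dotv_pull; congr (_ * _); rewrite mulr_sumr; apply: eq_bigr =>
  k _.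
by rewrite mxE nr; field; rewrite !gt_eqF.
Qed.

Lemma quadCE (X : 'cV[R]_n') : quadC g X =
  2^-1 * (n'%:R^-1 * \sum_k (n'%:R * (GK K' g *m X) k 0) * X k 0).
Proof.
rewrite /quadC; congr (_ * _); rewrite mulr_sumr; apply: eq_bigr => k _.
by field; rewrite !gt_eqF.
Qed.

Lemma quadC_avg_le (X : 'cV[R]_n') : orthant X ->
  quadC g (avg hK X) <= lam * quadC g X.
Proof.
move=> X0; rewrite quadC_avgE quadCE [leRHS]mulrCA ler_wpM2l ?invr_ge0//.
rewrite [leRHS]mulrCA ler_wpM2l ?invr_ge0 ?(ltW n'0)// mulr_sumr;
  apply: ler_sum => k _.
by rewrite mulrA ler_wpM2r ?orthant_ge0//; exact: GK_avg_le.
Qed.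

Lemma quadC_le_avg (X : 'cV[R]_n') : orthant X ->
  quadC g X <= lam * quadC g (avg hK X).
Proof.
move=> X0; rewrite quadC_avgE quadCE [leRHS]mulrCA ler_wpM2l ?invr_ge0//.
rewrite [leRHS]mulrCA ler_wpM2l ?invr_ge0 ?(ltW n'0)// mulr_sumr;
  apply: ler_sum => k _.
by rewrite mulrA ler_wpM2r ?orthant_ge0//; exact: GK_le_avg.
Qed.

Lemma norm1s_avg_le (X : 'cV[R]_n') : orthant X ->
  norm1s (GK K g *m avg hK X) <= lam * norm1s (GK K' g *m X).
Proof.
move=> X0; apply: (norm1s_GK_le m0 gm); first exact: avg_orthant.
  by rewrite mulr_ge0 ?norm1s_ge0// ltW.
move=> i; rewrite -[i](cell_left_end hK); apply: le_trans (GK_avg_le _ X0) _.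
by rewrite ler_wpM2l ?(ltW lam0)//; exact: le_norm1s_GK.
Qed.

Lemma norm1s_le_avg (X : 'cV[R]_n') : orthant X ->
  norm1s (GK K' g *m X) <= lam * norm1s (GK K g *m avg hK X).
Proof.
move=> X0; apply: (norm1s_GK_le m0 gm) => //.
  by rewrite mulr_ge0 ?norm1s_ge0// ltW.
move=> k; apply: le_trans (GK_le_avg _ X0) _.
by rewrite ler_wpM2l ?(ltW lam0)//; exact: le_norm1s_GK.
Qed.

Definition level_err : R :=
  (lam ^+ 3 - 1) *
    (8 * rho ^+ 2 / m + (cap m rho + 8 * rho / m * (M * (rho / m)))).

Let lam3 : 1 <= lam ^+ 3.
Proof. exact: exprn_ege1. Qed.

Lemma quadCZ (k : nat) (a : R) (x : 'cV[R]_(cardD k)) : quadC g (a *: x) =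
  a ^+ 2 * quadC g x.
Proof. by rewrite /quadC -scalemxAr dotvZl dotvZr; ring. Qed.

Lemma norm1sZ (k : nat) (a : R) (x : 'cV[R]_k) : 0 <= a ->
  norm1s (a *: x) <= a * norm1s x.
Proof.
move=> a0; apply/norm1s_leP; first by rewrite mulr_ge0 ?norm1s_ge0.
by move=> i; rewrite mxE normrM (ger0_norm a0) mulrCA ler_wpM2l// le_norm1s.
Qed.

(** Competitors are transported from one level to the other by averaging or
    replicating. As [m <= g], an additive error [w] on the kernel is a factor
    [lam = 1 + w / m], and a dilation of the transported vector by [lam] restores
    the constraint; the values change by a power of [lam]. *)
Lemma level_close (q : 'cV[R]_n) : norm1s q <= rho ->
  sfH g m rho (pull hK q) <= sfH g m rho q + level_err /\
  sfH g m rho q <= sfH g m rho (pull hK q) + level_err.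
Proof.
move=> qrho.
have lam3' := lt_le_trans ltr01 lam3.
pose E := 8 * rho ^+ 2 / m * (lam ^+ 3 - 1).
have fin (s t : R) : s <= cap m rho + 8 * rho / m * (M * (rho / m)) ->
    t <= lam ^+ 3 * s + E -> t <= s + level_err.
  move=> sb; have l1 : 0 <= lam ^+ 3 - 1 by rewrite subr_ge0.
  by have := ler_wpM2l l1 sb; rewrite /level_err /E; lra.
have lam0' := ltW lam0.
split; apply: fin; rewrite ?(sfH_bound m0 rho0 gm gM) ?norm1s_pull//.
- rewrite -lerBlDr -ler_pdivrMl//; apply: (le_sfH m0 gm) => x x0 qx.
  rewrite ler_pdivrMl// lerBlDr.
  have L0 := replicate_orthant hK x0.
  have X0 : orthant (lam *: replicate hK x) by exact: orthantZ.
  apply: le_trans (sfH_le m0 rho0 gm X0 _) _.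
    apply: lev_pull qx => k.
    have -> : (GK K' g *m (lam *: replicate hK x)) k 0 =
        lam * (GK K' g *m replicate hK x) k 0 by rewrite -scalemxAr mxE.
    by rewrite [leRHS]mulrCA -{1}(avg_replicate hK x); exact: GK_avg_le.
  apply: sfCR_scale => //.
    rewrite quadCZ (_ : lam ^+ 3 * _ = lam ^+ 2 * (lam * quadC g x));
      last by ring.
    rewrite ler_wpM2l ?sqr_ge0//.
    by have := quadC_le_avg L0; rewrite avg_replicate.
  rewrite -scalemxAr; apply: le_trans (norm1sZ _ lam0') _.
  apply: (@le_trans _ _ (lam * (lam * norm1s (GK K g *m x)))).
    by rewrite ler_wpM2l//; have := norm1s_le_avg L0; rewrite avg_replicate.
  rewrite mulrA -expr2 ler_wpM2r ?norm1s_ge0//.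
  by rewrite ler_weXn2l.
- rewrite -lerBlDr -ler_pdivrMl//; apply: (le_sfH m0 gm) => X X0 qX.
  rewrite ler_pdivrMl// lerBlDr.
  have A0 := avg_orthant hK X0.
  have x0 : orthant (lam *: avg hK X) by exact: orthantZ.
  apply: le_trans (sfH_le m0 rho0 gm x0 _) _.
    apply: (unpull_lev (hK := hK)) qX => k.
    have -> : (GK K g *m (lam *: avg hK X)) (cell hK k) 0 =
        lam * (GK K g *m avg hK X) (cell hK k) 0 by rewrite -scalemxAr mxE.
    by rewrite [leRHS]mulrCA; exact: GK_le_avg.
  apply: sfCR_scale => //.
    rewrite quadCZ (_ : lam ^+ 3 * _ = lam ^+ 2 * (lam * quadC g X));
      last by ring.
    by rewrite ler_wpM2l ?sqr_ge0//; exact: quadC_avg_le.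
  rewrite -scalemxAr; apply: le_trans (norm1sZ _ lam0') _.
  apply: (@le_trans _ _ (lam * (lam * norm1s (GK K' g *m X)))).
    by rewrite ler_wpM2l//; exact: norm1s_avg_le.
  rewrite mulrA -expr2 ler_wpM2r ?norm1s_ge0//.
  by rewrite ler_weXn2l.
Qed.

End Levels.

(** * Oscillation of the kernel *)

Section Oscillation.
Context {R : realType}.
Implicit Types (g : R -> R).

Lemma C1_seg_continuous g : C1_seg g -> {within seg, continuous g}.
Proof.
move=> [g' _ dg]; apply/subspace_continuousP => x sx.
have /cvgrPdist_lt lim := dg x sx.
have near1 := lim 1 ltr01.
apply/cvgrPdist_lt => e e0.
pose C := `|g' x| + 1; have C0 : 0 < C by rewrite ltr_wpDl.
have small : \forall y \near within seg (nbhs x), `|y - x| < e / C.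
  apply: cvg_within; apply/nbhs_ballP; exists (e / C) => /=;
    first exact: divr_gt0.
  by move=> y; rewrite /ball/= distrC.
move: near1 small; rewrite !near_withinE => n1 n2.
have n1' : \forall y \near x, y != x -> seg y ->
  `|g' x - (g y - g x) / (y - x)| < 1.
  exact: n1.
near=> y => sy.
have [->|yx] := eqVneq y x; first by rewrite subrr normr0.
have H1 : `|g' x - (g y - g x) / (y - x)| < 1.
  by move: yx sy; near: y.
have H2 : `|y - x| < e / C by move: sy; near: y.
have yx0 : 0 < `|y - x| by rewrite normr_gt0 subr_eq0.
have H3 : `|(g y - g x) / (y - x)| < C.
  have -> : (g y - g x) / (y - x) = g' x - (g' x - (g y - g x) / (y - x)) by ring.
  by apply: le_lt_trans (ler_normB _ _) _; rewrite ltrD2l.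
rewrite distrC -[g y - g x](divfK (_ : y - x != 0)) ?subr_eq0// normrM.
apply: lt_trans (_ : C * `|y - x| < e); first by rewrite ltr_pM2r.
by rewrite mulrC -ltr_pdivlMr.
Unshelve. all: by end_near. Qed.

Definition clamp (x : R) : R := Num.max (-1) (Num.min 1 x).

Lemma clamp_seg x : seg (clamp x).
Proof.
rewrite /seg/= in_itv/= /clamp le_max lexx/= ge_max ge_min lexx/= andbT; lra.
Qed.

Lemma clamp_id x : seg x -> clamp x = x.
Proof.
rewrite /seg/= in_itv/= => /andP[h1 h2]; rewrite /clamp (min_idPr h2).
exact/max_idPr.
Qed.

Lemma clamp_continuous : continuous clamp.
Proof.
apply: cts_max => x; apply: (@continuous_min _ _ (cst 1) id).
  exact: cst_continuous.
by move=> ?.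
Qed.

Lemma continuous_clamp g : {within seg, continuous g} -> continuous (g \o clamp).
Proof.
move=> /subspace_continuousP cg x; apply: (cvg_comp _ _ _ (cg _ (clamp_seg x))).
move=> B; rewrite /within/= => nB.
have H := @clamp_continuous x _ nB; apply: (@filterS _ (nbhs x) _ _ _ _ H) => y;
  apply; exact: clamp_seg.
Qed.

(** Uniform continuity on a compact interval, by the near-covering form of
    compactness. *)
Lemma uniform_seg g (e : R) : {within seg, continuous g} -> 0 < e ->
  exists2 del, 0 < del & forall s t, seg s -> seg t -> `|s - t| < del ->
    `|g s - g t| < e.
Proof.
move=> cg e0; have cc := continuous_clamp cg.
have /compact_near_coveringP cpt : compact (seg : set R)
  by exact: segment_compact.
pose P (del s : R) := forall t, `|s - t| < del ->
  `|(g \o clamp) s - (g \o clamp) t| < e.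
have loc : forall s : R, seg s -> \forall s' \near s & del \near (0 : R)^'+,
  P del s'.
  move=> s _.
  have /cvgrPdist_lt/(_ (e / 2)) := cc s; rewrite divr_gt0// => /(_ isT).
  move=> /nbhs_ballP[r /= r0 Hr].
  exists (ball s (r / 2), [set del | del < r / 2]) => /=.
    split; first by apply: nbhsx_ballx; rewrite divr_gt0.
    by apply: nbhs_right_lt; rewrite divr_gt0.
  move=> [s' del] [/= ss' dr] t st.
  have h1 : `|(g \o clamp) s - (g \o clamp) s'| < e / 2.
    by apply: Hr; apply: lt_trans ss' _; rewrite ltr_pdivrMr//; lra.
  have h2 : `|(g \o clamp) s - (g \o clamp) t| < e / 2.
    apply: Hr; rewrite /ball/=.
    have -> : s - t = (s - s') + (s' - t) by ring.
    apply: le_lt_trans (ler_normD _ _) _; rewrite /ball/= in ss'; lra.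
  have -> : (g \o clamp) s' - (g \o clamp) t =
    ((g \o clamp) s - (g \o clamp) t) - ((g \o clamp) s - (g \o clamp) s')
      by ring.
  by apply: le_lt_trans (ler_normB _ _) _; lra.
have H := cpt R (0^'+) P _ loc.
near (0 : R)^'+ => del; exists del; first by near: del; exact: nbhs_right_gt.
move=> s t ss st lt.
have : forall x, seg x -> forall t, `|x - t| < del ->
  `|(g \o clamp) x - (g \o clamp) t| < e.
  near: del; exact: H.
by move=> /(_ s ss t lt) /=; rewrite !clamp_id.
Unshelve. all: by end_near. Qed.

Lemma bounded_seg g : {within seg, continuous g} -> exists M, forall x, seg x ->
  g x <= M.
Proof.
move=> cg; have [|c _ H] := @EVT_max R g (-1) 1 _ cg; first by lra.
by exists (g c) => x sx; exact: H.
Qed.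

Lemma osc_eventually g (w : R) : {within seg, continuous g} -> 0 < w ->
  \forall K \near \oo, osc g K w.
Proof.
move=> cg w0; have [del del0 H] := uniform_seg cg w0.
have : (2^-1 : R) ^+ K @[K --> \oo] --> 0.
  by apply: cvg_expr; rewrite ger0_norm ?invr_ge0// invf_lt1// ltr1n.
move=> /cvgrPdist_lt/(_ (del / 2)); rewrite divr_gt0// => /(_ isT).
apply: filterS => K; rewrite sub0r normrN exprVn ger0_norm ?invr_ge0
  ?exprn_ge0// => small.
move=> s t s' t' ss st ss' st' h1 h2; apply/ltW/H.
- exact: seg_mul.
- exact: seg_mul.
have -> : s * t - s' * t' = (s - s') * t + s' * (t - t') by ring.
apply: le_lt_trans (ler_normD _ _) _; rewrite !normrM.
have n1 : `|t| <= 1 by move: st; rewrite /seg/= in_itv/= ler_norml.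
have n2 : `|s'| <= 1 by move: ss'; rewrite /seg/= in_itv/= ler_norml.
have : `|s - s'| * `|t| <= `|s - s'| by rewrite ler_piMr.
have : `|s'| * `|t - t'| <= `|t - t'| by rewrite ler_piMl.
by lra.
Qed.

End Oscillation.

(** * The initial condition at two levels *)

Section TotalVariation.
Context {R : realType}.
Implicit Types (mu nu : Mplus R).

Lemma TV_le mu nu c : 
  (forall A : set (measurableTypeR R), measurable A ->
    `|fine (mu A) - fine (nu A)| <= c) ->
  TV mu nu <= c.
Proof.
move=> H; apply: sup_le_ub.
  by exists `|fine (mu set0) - fine (nu set0)|, set0; split.
by move=> _ [A [mA _ ->]]; exact: H.
Qed.

Lemma le_TV mu nu c (A : set (measurableTypeR R)) : 
  (forall A : set (measurableTypeR R), measurable A ->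
    `|fine (mu A) - fine (nu A)| <= c) ->
  measurable A -> A `<=` seg -> `|fine (mu A) - fine (nu A)| <= TV mu nu.
Proof.
move=> H mA As; apply: ub_le_sup; last by exists A.
by exists c => _ [B [mB _ ->]]; exact: H.
Qed.

Lemma mu_ofE K (x : 'cV[R]_(cardD K)) A : orthant x ->
  fine (mu_of x A) = \sum_i x i 0 / (cardD K)%:R *
    \1_A (dyad i : measurableTypeR R).
Proof.
move=> x0; have -> : mu_of x A = (\sum_i x i 0 / (cardD K)%:R *
  \1_A (dyad i : measurableTypeR R))%:E.
  rewrite -sumEFin; apply: eq_bigr => i _.
  by rewrite diracE (max_idPr (orthant_ge0 i x0)) EFinM indicE.
by [].
Qed.

Lemma mu_of_TV K (x y : 'cV[R]_(cardD K)) A : orthant x -> orthant y ->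
  `|fine (mu_of x A) - fine (mu_of y A)| <= (cardD K)%:R^-1 * dist1 x y.
Proof.
move=> x0 y0; rewrite !mu_ofE// -sumrB mulr_sumr.
apply: le_trans (ler_norm_sum _ _ _) _; apply: ler_sum => i _.
set I := \1_A _; rewrite (_ : _ - _ = (cardD K)%:R^-1 * (x i 0 - y i 0) * I);
  last by ring.
rewrite !normrM normfV normr_nat ler_piMr ?mulr_ge0 ?invr_ge0//.
by rewrite /I indicE; case: (_ \in _); rewrite ?normr1 ?normr0.
Qed.

Variables (psi : Mplus R -> R) (lipTV : R).
Hypothesis H2 : forall mu nu : Mplus R, `|psi mu - psi nu| <= lipTV * TV mu nu.

(** Two measures at a positive distance force the constant to be nonnegative. *)
Lemma lipTV_ge0 : 0 <= lipTV.
Proof.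
pose x : 'cV[R]_(cardD 0) := const_mx 1; pose y : 'cV[R]_(cardD 0) := 0.
have x0 : orthant x by apply: orthant_const.
have y0 : orthant y by move=> i; rewrite !mxE.
have T0 : 0 < TV (mu_of x) (mu_of y).
  apply: lt_le_trans (le_TV (A := seg) (fun A _ => mu_of_TV A x0 y0) _ _).
  - rewrite !mu_ofE// [X in _ - X]big1 => [|i _]; last by rewrite mxE !mul0r.
    rewrite subr0 ger0_norm; last by apply: sumr_ge0 => i _;
      rewrite mulr_ge0// mxE divr_ge0.
    rewrite (bigD1 (Ordinal (cardD_gt0 0)))//= ltr_wpDr//.
      by apply: sumr_ge0 => i _; rewrite mulr_ge0// mxE divr_ge0.
    rewrite mxE indicE mem_set; last exact: dyad_seg.
    by rewrite mulr1 divr_gt0// ltr0n cardD_gt0.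
  - exact: measurable_itv.
  - by [].
have := le_trans (normr_ge0 _) (H2 (mu_of x) (mu_of y)).
by rewrite pmulr_lge0.
Qed.

Lemma psiK_lip1 K : lip1 (psiK psi : 'cV[R]_(cardD K) ->
  R) (lipTV / (cardD K)%:R).
Proof.
move=> x y x0 y0; apply: le_trans (H2 _ _) _;
  rewrite -mulrA ler_wpM2l ?lipTV_ge0//.
by apply: TV_le => A _; exact: mu_of_TV.
Qed.

(** Elements of [Mplus] that agree on measurable sets are at total variation
    distance 0, so that [psi] does not separate them. *)
Lemma psi_eq mu nu :
  (forall A : set (measurableTypeR R), measurable A -> fine (mu A) = fine (nu A))
    -> psi mu = psi nu.
Proof.
move=> E; apply/eqP; rewrite -subr_eq0 -normr_le0.
apply: le_trans (H2 _ _) _; rewrite mulr_ge0_le0 ?lipTV_ge0//.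
by apply: TV_le => A mA; rewrite E// subrr normr0.
Qed.

Section Spread.
Variables (K K' : nat).
Hypothesis hK : (K <= K')%N.
Notation n := (cardD K).
Notation n' := (cardD K').

(** The mass of each coarse cell is moved to the left end of the cell. This
    represents at the fine level the measure that [avg] gives at the coarse
    one. *)
Definition spread (X : 'cV[R]_n') : 'cV[R]_n' :=
  \col_k (if left_end hK (cell hK k) == k then (subdiv K K')%:R *
    avg hK X (cell hK k) 0 else 0).

Lemma sum_spread (F : 'I_n' -> R) X :
  \sum_k F k * spread X k 0 = \sum_k F (left_end hK (cell hK k)) * X k 0.
Proof.
have r0 : (subdiv K K')%:R != 0 :> R by rewrite pnatr_eq0 -lt0n subdiv_gt0.
transitivity (\sum_i (F (left_end hK i) * (subdiv K K')%:R) * avg hK X i 0);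
  last first.
  rewrite sum_avg mulr_sumr; apply: eq_bigr => k _.
  by rewrite [F _ * _]mulrC mulrA mulrA mulVf// mul1r.
rewrite (sum_cells hK); apply: eq_bigr => i _.
rewrite (bigD1 (left_end hK i)) ?cell_left_end//= big1 ?addr0 =>
  [|k /andP[/eqP ck nk]].
  by rewrite mxE cell_left_end eqxx mulrA.
by rewrite mxE ck eq_sym (negbTE nk) mulr0.
Qed.

Lemma spread_orthant X : orthant X -> orthant (spread X).
Proof.
move=> X0 k; rewrite mxE [leRHS]mxE; case: ifP => // _.
by rewrite mulr_ge0// orthant_ge0//; exact: avg_orthant.
Qed.

Lemma psiK_spread X : orthant X -> psiK psi (spread X) = psiK psi (avg hK X).
Proof.
move=> X0; apply: psi_eq => A _.
rewrite !mu_ofE//; [|exact: avg_orthant|exact: spread_orthant].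
transitivity (n'%:R^-1 * \sum_k (\1_A (dyad k : measurableTypeR R) : R) *
  spread X k 0).
  by rewrite mulr_sumr; apply: eq_bigr => k _; ring.
transitivity (n%:R^-1 * \sum_i (\1_A (dyad i : measurableTypeR R) : R) *
  avg hK X i 0); last first.
  by rewrite mulr_sumr; apply: eq_bigr => k _; ring.
have -> : n'%:R^-1 = n%:R^-1 * (subdiv K K')%:R^-1 :> R.
  by rewrite -invfM -natrM -cardD_subdiv.
rewrite sum_spread sum_avg mulrA; congr (_ * _).
by apply: eq_bigr => k _; rewrite dyad_left_end.
Qed.

Variables (g : R -> R) (a w : R).
Hypothesis gw : osc g K w.
Hypothesis a0 : 0 <= a.

(** For the part in the cone, the kernel varies by at most [w] within a cell; the
    rest is small in the dual norm. *)
Lemma calK'_cell (p : 'cV[R]_n') k : calK' g a p ->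
  n'%:R * `|p (left_end hK (cell hK k)) 0 - p k 0| <= w * a + 2 *
    (Num.sqrt n'%:R)^-1.
Proof.
have n'0 : 0 < n'%:R :> R by rewrite ltr0n cardD_gt0.
move=> [y [v [[z [z0 za] <-] vs ->]]]; set l := left_end _ _.
have -> : (GK K' g *m z + v) l 0 - (GK K' g *m z + v) k 0 =
    ((GK K' g *m z) l 0 - (GK K' g *m z) k 0) + (v l 0 - v k 0) by rewrite !mxE;
      ring.
apply: (@le_trans _ _ (n'%:R * `|(GK K' g *m z) l 0 - (GK K' g *m z) k 0| +
    (n'%:R * `|v l 0| + n'%:R * `|v k 0|))).
  rewrite -!mulrDr ler_wpM2l//; apply: le_trans (ler_normD _ _) _; rewrite lerD2l.
  exact: ler_normB.
have vb i := le_trans (le_norm1s v i) vs.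
apply: lerD; last by have := lerD (vb l) (vb k); lra.
apply: le_trans (_ : w * norm1 z <= _); last first.
  apply: ler_wpM2l => //.
  have s0 : seg (0 : R) by rewrite /seg/= in_itv/= lerN10 ler01.
  by apply: le_trans (gw s0 s0 s0 s0 _ _);
    rewrite ?subrr ?normr0 ?invr_ge0 ?exprn_ge0.
rewrite -[X in X * `|_|]ger0_norm// -normrM mulrBr !GK_coord -mulrBr -sumrB.
rewrite normrM normfV normr_nat norm1_orthant// mulrCA ler_wpM2l ?invr_ge0//.
rewrite /sumv mulr_sumr; apply: le_trans (ler_norm_sum _ _ _) _; apply: ler_sum =>
  j _.
rewrite -mulrBl normrM (ger0_norm (orthant_ge0 j z0)) ler_wpM2r ?orthant_ge0//.
apply: gw; rewrite ?subrr ?normr0 ?invr_ge0 ?exprn_ge0//; try exact: dyad_seg.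
rewrite dyad_left_end distrC; have /andP[h1 h2] := @dyad_cell R _ _ hK k.
by rewrite ger0_norm.
Qed.

Lemma dotv_spread (p X : 'cV[R]_n') : calK' g a p -> orthant X ->
  `|dotv p (spread X - X)| <= (w * a + 2 * (Num.sqrt n'%:R)^-1) * norm1 X.
Proof.
move=> pK X0.
have n'0 : 0 < n'%:R :> R by rewrite ltr0n cardD_gt0.
have -> : dotv p (spread X - X) = \sum_k (p (left_end hK (cell hK k)) 0 - p k 0) *
  X k 0.
  transitivity (\sum_k p k 0 * spread X k 0 - \sum_k p k 0 * X k 0).
    rewrite -sumrB; apply: eq_bigr => k _.
    have -> : (spread X - X) k 0 = spread X k 0 - X k 0 by rewrite [LHS]mxE
      [X in _ + X]mxE.
    by ring.
  by rewrite sum_spread -sumrB; apply: eq_bigr => k _; ring.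
apply: le_trans (ler_norm_sum _ _ _) _.
rewrite norm1_orthant// /sumv mulrA mulr_sumr; apply: ler_sum => k _.
rewrite normrM (ger0_norm (orthant_ge0 k X0)) ler_wpM2r ?orthant_ge0//.
by rewrite ler_pdivlMr// mulrC; exact: calK'_cell.
Qed.

Hypothesis H3 : exists2 N : set 'cV[R]_n', lebesgue_null N &
       forall x, open_orthant x -> ~ N x ->
         differentiable (psiK psi) x /\ calK' g a (grad (psiK psi) x).

Lemma psiK_increment (x y : 'cV[R]_n') c : orthant x -> orthant y ->
  (forall p, calK' g a p -> dotv p (x - y) <= c) -> psiK psi x - psiK psi y <= c.
Proof.
move=> x0 y0 H; have [N nullN gradN] := H3.
rewrite -{1}[x](subrKC y).
apply: (increment_le_of_gradient (N := N) _ (psiK_lip1 (K := K'))) => //.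
- by rewrite divr_ge0// lipTV_ge0.
- by move=> z z0 /(gradN z z0)[dz Kz]; split=> //; exact: H.
- by rewrite subrKC.
Qed.

(** The displacement from [X] to [spread X] has mass 0 in each cell, and is tested
    against gradients that are almost constant on cells. *)
Lemma psiK_avg (X : 'cV[R]_n') : orthant X ->
  `|psiK psi (avg hK X) - psiK psi X| <= (w * a + 2 * (Num.sqrt n'%:R)^-1) *
    norm1 X.
Proof.
move=> X0; rewrite -psiK_spread//; have S0 := spread_orthant X0.
rewrite ler_norml; apply/andP; split; last first.
  apply: psiK_increment => // p pK.
  by apply: le_trans (ler_norm _) _; exact: dotv_spread.
rewrite -opprB lerN2; apply: psiK_increment => // p pK.
rewrite -opprB -scaleN1r dotvZr mulN1r; apply: le_trans (ler_norm _) _.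
by rewrite normrN; exact: dotv_spread.
Qed.

End Spread.
End TotalVariation.

(** * Propagation of slope bounds *)

Section Transfer.
Context {R : realType}.

Lemma tame_comp d d' (u : R * 'cV[R]_d -> R) (P : 'cV[R]_d' -> 'cV[R]_d) (c : R) :
  tame u -> continuous P -> (forall x, orthant x -> orthant (P x)) -> 0 <= c ->
  (forall x y, dist1 (P x) (P y) <= c * dist1 x y) ->
  tame (fun z => u (z.1, P z.2)).
Proof.
move=> [cu [C [C0 Ct Cx]]] cP oP c0 lP; split.
  have -> : (fun z : R * 'cV[R]_d' => u (z.1, P z.2)) \o ret =
    (fun z => (u \o ret) (Num.max 0 z.1, P (pos_part z.2))).
    apply/funext => z /=; rewrite ret_id//; split=> /=;
      first by rewrite le_max lexx.
    by apply: oP; exact: pos_part_ge0.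
  apply: cts_comp cu; apply: cts_pair; first exact/cts_max/cts_fst.
  apply: (cts_comp _ cP); apply: (@cts_col R) => i; under eq_fun do rewrite mxE.
  exact/cts_max/cts_coord/cts_snd.
exists (C * (1 + c)); split.
- by rewrite mulr_ge0// addr_ge0.
- move=> t x t0 x0; apply: le_trans (Ct _ _ t0 (oP _ x0)) _.
  by rewrite ler_wpM2r// ler_peMr// lerDl.
- move=> x y x0 y0; apply: le_trans (Cx _ _ (oP _ x0) (oP _ y0)) _.
  rewrite -mulrA ler_wpM2l//; apply: le_trans (lP x y) _.
  by rewrite ler_wpM2r ?lerDr// sumr_ge0.
Qed.

(** Restriction of a touching paraboloid to an affine subspace, parametrized by
    [B], along which [F] reduces to [f]. *)
Lemma prox_super_along d d' (F : R * 'cV[R]_d' -> R) (f : R * 'cV[R]_d -> R)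
    (B : R * 'cV[R]_d -> R * 'cV[R]_d') p q tau q' (C : R) :
  continuous B -> (forall z, F (B z) = f z) ->
  (forall z, (B z).1 - (B p).1 = z.1 - p.1) ->
  (forall z, dotv q ((B z).2 - (B p).2) = dotv q' (z.2 - p.2)) ->
  (forall z, sqdist (B z) (B p) <= C * sqdist z p) ->
  prox_super F (B p) tau q -> prox_super f p tau q'.
Proof.
move=> cB FB B1 B2 Bs /prox_super_near[M M0 nF]; exists (M * C).
have := cB p _ nF; rewrite nbhs_filterE/=; apply: filterS => z /=.
by rewrite !FB B1 B2 => /le_trans; apply; rewrite lerD2l -mulrA ler_wpM2l.
Qed.

Lemma prox_super_dir d (f : R * 'cV[R]_d -> R) p tau q v : prox_super f p tau q ->
  exists2 C, 0 <= C & \forall s \near (0 : R),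
    f (p.1, p.2 + s *: v) <= f p + s * dotv q v + C * s ^+ 2.
Proof.
move=> /prox_super_near[M M0 nf].
pose line (s : R) : R * 'cV[R]_d := (p.1, p.2 + s *: v).
have cl : continuous line.
  apply: cts_pair; first by move=> s; exact: cvg_cst.
  apply: (@cts_col R) => i; under eq_fun do rewrite !mxE.
  apply: ctsD; first exact: cts_cst.
  by apply: ctsM; [move=> s; exact: cvg_id|exact: cts_cst].
have l0 : line 0 = p by rewrite /line scale0r addr0 -surjective_pairing.
exists (M * \sum_i v i 0 ^+ 2); first by rewrite mulr_ge0// sumr_ge0// => i _;
  rewrite sqr_ge0.
have nf0 : nbhs (line 0) [set z | f z <= f p + tau * (z.1 - p.1) +
  dotv q (z.2 - p.2) + M * sqdist z p].
  by rewrite l0.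
have := cl 0 _ nf0; rewrite nbhs_filterE/=; apply: filterS => s /=.
have E : p.2 + s *: v - p.2 = s *: v by rewrite addrC addKr.
rewrite /sqdist/= subrr mulr0 addr0 expr0n/= add0r E dotvZr => /le_trans; apply.
rewrite lerD2l -mulrA ler_wpM2l// mulr_suml le_eqVlt; apply/orP; left; apply/eqP.
by apply: eq_bigr => i _; rewrite !mxE; ring.
Qed.

Lemma near_quad_ge0 (a C : R) : (\forall s \near (0 : R), 0 <= s ->
  0 <= s * a + C * s ^+ 2) -> 0 <= a.
Proof.
move=> H; apply/ler_addgt0Pr => e e0; rewrite addrC -lerBlDr sub0r.
near (0 : R)^'+ => s.
have s0 : 0 < s by near: s; exact: nbhs_right_gt.
have Hs : 0 <= s -> 0 <= s * a + C * s ^+ 2 by near: s; exact: cvg_within H.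
have se : s < e / (`|C| + 1) by near: s; apply: nbhs_right_lt;
  rewrite divr_gt0// ltr_wpDl.
have := Hs (ltW s0); rewrite expr2 mulrCA -mulrDr pmulr_rge0// => h.
rewrite ltr_pdivlMr ?ltr_wpDl// in se.
have : C * s <= `|C| * s by rewrite ler_wpM2r ?ler_norm// ltW.
by lra.
Unshelve. all: by end_near. Qed.

(** Only points behind [p] matter for a paraboloid touching from above; for one
    touching from below they are the points ahead. *)
Lemma prox_super_slope d (f : R * 'cV[R]_d -> R) p tau q v (c : R) : prox_super f
  p tau q ->
  (\forall s \near (0 : R), 0 <= s -> f p - f (p.1, p.2 - s *: v) <= s * c) ->
    dotv q v <= c.
Proof.
move=> /(prox_super_dir (- v)) [C C0 nf] ns.
rewrite -subr_ge0; apply: (@near_quad_ge0 _ C).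
apply: filterS2 nf ns => s h1 h2 /h2.
have E : dotv q (- v) = - dotv q v by rewrite -scaleN1r dotvZr mulN1r.
by rewrite scalerN E in h1; lra.
Qed.

Lemma prox_sub_slope d (f : R * 'cV[R]_d -> R) p tau q v (c : R) : prox_sub f p
  tau q ->
  (\forall s \near (0 : R), 0 <= s -> f (p.1, p.2 + s *: v) - f p <= s * c) ->
    dotv q v <= c.
Proof.
move=> ps ns.
have -> : dotv q v = dotv (- q) (- v).
  by rewrite /dotv; apply: eq_bigr => i _; rewrite !mxE mulrNN.
apply: (prox_super_slope ps); apply: filterS ns => s h /h; rewrite scalerN !opprK;
  lra.
Qed.

Lemma near_orthant_line d (x v : 'cV[R]_d) : open_orthant x ->
  \forall s \near (0 : R), orthant (x + s *: v).
Proof.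
move=> x0.
have : nbhs (0 : R) [set s | forall i, 0 < (x + s *: v) i 0].
  apply: (@filter_forall _ _ (fun i => [set s | 0 < (x + s *: v) i 0])
    (nbhs (0 : R)) _) => i.
  have cl : continuous (fun s : R => (x + s *: v) i 0).
    under eq_fun do rewrite !mxE.
    apply: ctsD; first exact: cts_cst.
    by apply: ctsM; [move=> s; exact: cvg_id|exact: cts_cst].
  have l0 : 0 < (x + 0 *: v) i 0 by rewrite !mxE mul0r addr0; exact: x0.
  exact: (near_pos_continuous cl l0).
by apply: filterS => s H; exact: open_orthant_orthant.
Qed.

End Transfer.

Section Propagation.
Context {R : realType} {d : nat}.
Implicit Types (f : R * 'cV[R]_d -> R) (H : 'cV[R]_d -> R) (x y v : 'cV[R]_d).

Definition translate f x : R * 'cV[R]_d -> R := fun z => f (z.1, z.2 + x).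

Lemma tame_translate f x : tame f -> orthant x -> tame (translate f x).
Proof.
move=> tf x0; apply: (tame_comp (P := fun y => y + x) (c := 1)) => //.
- apply: (@cts_col R) => i; under eq_fun do rewrite !mxE.
  by apply: ctsD; [exact: coord_continuous|exact: cts_cst].
- by move=> y y0; exact: orthantD.
- move=> y z; rewrite mul1r; apply: ler_sum => i _; rewrite !mxE.
  by rewrite (_ : _ - _ = y i 0 - z i 0)//; ring.
Qed.

Lemma sqdist_translate x (z p : R * 'cV[R]_d) :
  sqdist (z.1, z.2 - x) (p.1, p.2 - x) = sqdist z p.
Proof.
rewrite /sqdist/=; congr (_ + _); apply: eq_bigr => i _; rewrite !mxE;
  congr (_ ^+ 2); ring.
Qed.

Lemma prox_super_translate f x p tau q :
  prox_super (translate f x) p tau q -> prox_super f (p.1, p.2 + x) tau q.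
Proof.
move=> H; apply: (@prox_super_along _ _ _ (translate f x) f
  (fun z => (z.1, z.2 - x)) (p.1, p.2 + x) q tau q 1).
- apply: cts_pair; first exact: cts_fst.
  apply: (@cts_col R) => i; under eq_fun do rewrite !mxE.
  by apply: ctsD; [exact/cts_coord/cts_snd|exact: cts_cst].
- by move=> [t y]; rewrite /translate/= subrK.
- by [].
- by move=> z /=; rewrite addrK opprD addrA [in LHS]addrAC.
- by move=> z; have /= -> := sqdist_translate x z (p.1, p.2 + x); rewrite mul1r.
- by rewrite /= addrK -surjective_pairing.
Qed.

Lemma open_orthantD x y : open_orthant x -> orthant y -> open_orthant (x + y).
Proof. by move=> x0 y0 i; rewrite mxE ltr_wpDr// orthant_ge0. Qed.

(** Both translates solve the equation in the whole orthant, without boundary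
    condition, and can be compared. *)
Lemma propagate H Lam f x y (c : R) : nondecr H -> 0 <= Lam -> diag_lip H Lam ->
  tame f -> viscosity_solution H f -> orthant x -> orthant y ->
  (forall z, orthant z -> f (0, z + x) - f (0, z + y) <= c) ->
  forall t, 0 <= t -> f (t, x) - f (t, y) <= c.
Proof.
move=> mH L0 lH tf vf x0 y0 init t t0.
have o0 : orthant (0 : 'cV[R]_d) by move=> i.
have open_tr (p : R * 'cV[R]_d) (w : 'cV[R]_d) : orthant w -> open_dom p ->
  open_dom (p.1, p.2 + w).
  move=> w0 [p1 p2]; split=> //=. exact: (open_orthantD p2 w0).
have := @comparison R d H Lam (translate f x) (translate f y) c 0 0 mH L0 lH
  (tame_translate tf x0) (tame_translate tf y0) (lexx 0) (lexx 0) _ _ _ t 0 t0 o0.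
rewrite (_ : c + 0 * _ + (Lam * 0 + 0) * t = c); last by ring.
rewrite /translate/= !add0r; apply.
- move=> p tau q op /prox_super_translate ps; rewrite addr0.
  exact: (visc_prox_super vf (open_tr _ _ x0 op) ps).
- move=> p tau q op ps; apply: (visc_prox_sub vf (open_tr _ _ y0 op)).
  exact: (@prox_super_translate (fun z => - f z)).
- by move=> z z0; rewrite mul0r addr0; exact: init.
Qed.

(** A bound on the initial increments in the direction [v] is inherited by all
    slopes of touching paraboloids. *)
Lemma slope_bound H Lam f v (c : R) : nondecr H -> 0 <= Lam -> diag_lip H Lam ->
  tame f -> viscosity_solution H f -> 
  (forall s x y, 0 <= s -> orthant x -> orthant y -> x - y = s *: v ->
     f (0, x) - f (0, y) <= s * c) ->
  forall p tau q, open_dom p -> prox_super f p tau q \/ prox_sub f p tau q ->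
    dotv q v <= c.
Proof.
move=> mH L0 lH tf vf init p tau q [p1 p2] touch.
have incr s x y : 0 <= s -> orthant x -> orthant y -> x - y = s *: v ->
    f (p.1, x) - f (p.1, y) <= s * c.
  move=> s0 x0 y0 xy; apply: (propagate mH L0 lH tf vf x0 y0); last exact: ltW.
  move=> z z0; apply: init => //; try exact: orthantD.
  by rewrite opprD addrACA subrr add0r.
have op := open_orthant_orthant p2.
case: touch => [ps|ps].
- apply: (prox_super_slope ps).
  have := near_orthant_line (- v) p2; apply: filterS => s; rewrite scalerN =>
    h s0.
  rewrite {1}(surjective_pairing p); apply: incr => //.
  by rewrite opprB addrC subrK.
- apply: (prox_sub_slope ps).
  have := near_orthant_line v p2; apply: filterS => s h s0.
  rewrite [in X in _ - X](surjective_pairing p); apply: incr => //.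
  by rewrite addrC addKr.
Qed.

End Propagation.

Section Separation.
Context {R : realType} {d : nat}.
Implicit Types (C : set 'cV[R]_d) (q p : 'cV[R]_d).

Lemma dotv_step (r v : 'cV[R]_d) (s : R) :
  dotv (r + (- s) *: v) (r + (- s) *: v) = dotv r r - 2 * s * dotv r v +
    s ^+ 2 * dotv v v.
Proof. by rewrite dotvDl !dotvDr !dotvZl !dotvZr (dotvC v r); ring. Qed.

(** If [p0] is the point of [C] nearest to [q], the linear form of [q - p0]
    attains its maximum over [C] at [p0]; the inequality for [q] forces
    [q = p0]. *)
Lemma mem_of_support C q : compact C -> C !=set0 ->
  (forall p p' (s : R), 0 <= s <= 1 -> C p -> C p' -> C (p + s *: (p' - p))) ->
  (forall v (c : R), (forall p, C p -> dotv p v <= c) -> dotv q v <= c) -> C q.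
Proof.
move=> cC C0 conv supp.
pose D p : R := dotv (q - p) (q - p).
have cD : continuous D.
  apply: cts_sum => i; have H : continuous (fun p : 'cV[R]_d => (q - p) i 0).
    under eq_fun do rewrite !mxE.
    by apply: ctsB; [exact: cts_cst|exact: coord_continuous].
  exact: ctsM.
have [p0 + pmin] : exists2 p, p \in C & forall t, t \in C -> D p <= D t.
  by apply: compact_EVT_min => //; exact: continuous_subspaceT.
rewrite inE => Cp0.
set r := q - p0.
have key p : C p -> dotv p r <= dotv p0 r.
  move=> Cp; set v := p - p0.
  suff : 0 <= - (2 * dotv r v).
    have -> : dotv r v = dotv p r - dotv p0 r.
      by rewrite dotvC /v dotvDl -scaleN1r dotvZl mulN1r.
    by lra.
  apply: (@near_quad_ge0 _ _ (dotv v v)).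
  have n1 : \forall s \near (0 : R), s < 1 by apply: (@lt_nbhsl R 0 1);
    rewrite ltr01.
  apply: filterS n1 => s s1 s0.
  have : D p0 <= D (p0 + s *: v).
    by apply: pmin; rewrite inE; apply: conv => //; rewrite s0 ltW.
  have -> : D (p0 + s *: v) = dotv r r - 2 * s * dotv r v + s ^+ 2 * dotv v v.
    rewrite /D (_ : q - (p0 + s *: v) = r + (- s) *: v); last first.
      by rewrite /r opprD addrA scaleNr.
    exact: dotv_step.
  rewrite /D -/r; lra.
have := supp r _ key.
have E : p0 + r = q by rewrite /r addrC subrK.
have -> : dotv q r = dotv p0 r + dotv r r by rewrite -dotvDl E.
move=> le; have : dotv r r <= 0 by lra.
move=> rr; have r0 : r = 0.
  apply/colP => i; rewrite [RHS]mxE; apply/eqP;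
    rewrite -sqrf_eq0 eq_le sqr_ge0 andbT.
  apply: le_trans rr; rewrite /dotv (bigD1 i)//= expr2 lerDl sumr_ge0// => j _.
  by rewrite -expr2 sqr_ge0.
by move: r0 => /eqP; rewrite subr_eq0 => /eqP ->.
Qed.

End Separation.

(** * The set of gradients and the projections of a measure *)

Section GradientSet.
Context {R : realType}.
Variables (K : nat) (g : R -> R) (a : R).
Hypothesis a0 : 0 <= a.
Notation n := (cardD K).
Notation vec := 'cV[R]_n.

Let n0 : 0 < n%:R :> R.
Proof. by rewrite ltr0n cardD_gt0. Qed.

Let b : R := (Num.sqrt n%:R)^-1.
Let b0 : 0 <= b.
Proof. by rewrite invr_ge0 sqrtr_ge0. Qed.

Lemma calK'_nonempty : (calK' g a : set vec) !=set0.
Proof.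
exists (GK K g *m 0 + 0 : vec), (GK K g *m 0), 0; split=> //.
  exists 0 => //; split; first by move=> i.
  by rewrite /norm1 big1 ?mulr0// => i _; rewrite mxE normr0.
by apply/norm1s_leP => // i; rewrite mxE normr0 mulr0.
Qed.

Lemma norm1D (x y : vec) : norm1 (x + y) <= norm1 x + norm1 y.
Proof.
rewrite /norm1 -mulrDr ler_wpM2l ?invr_ge0// -big_split; apply: ler_sum => i _.
by rewrite mxE ler_normD.
Qed.

Lemma norm1Z (s : R) (x : vec) : norm1 (s *: x) = `|s| * norm1 x.
Proof.
rewrite /norm1 [RHS]mulrCA; congr (_ * _); rewrite mulr_sumr; apply: eq_bigr =>
  i _.
by rewrite mxE normrM.
Qed.

Lemma calK'_convex (p p' : vec) (s : R) : 0 <= s <= 1 ->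
  calK' g a p -> calK' g a p' -> calK' g a (p + s *: (p' - p)).
Proof.
move=> /andP[s0 s1] [_ [w [[x [x0 xa] <-] wb ->]]]
  [_ [w' [[x' [x'0 x'a] <-] w'b ->]]].
have s1' : 0 <= 1 - s by lra.
exists (GK K g *m ((1 - s) *: x + s *: x')), ((1 - s) *: w + s *: w'); split.
- exists ((1 - s) *: x + s *: x') => //; split; first by apply: orthantD;
  exact: orthantZ.
  apply: le_trans (norm1D _ _) _; rewrite !norm1Z !ger0_norm//.
  by have := ler_wpM2l s1' xa; have := ler_wpM2l s0 x'a; lra.
- apply/norm1s_leP => // i; rewrite !mxE.
  have /norm1s_leP/(_ i) h1 := wb; have /norm1s_leP/(_ i) h2 := w'b.
  have {}h1 := h1 b0; have {}h2 := h2 b0.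
  apply: (@le_trans _ _ ((1 - s) * (n%:R * `|w i 0|) + s * (n%:R * `|w' i 0|))).
    have -> : (1 - s) * (n%:R * `|w i 0|) + s * (n%:R * `|w' i 0|) =
      n%:R * ((1 - s) * `|w i 0| + s * `|w' i 0|) by ring.
    rewrite ler_wpM2l//.
    by apply: le_trans (ler_normD _ _) _;
      rewrite !normrM (ger0_norm s1') (ger0_norm s0).
  by have := ler_wpM2l s1' h1; have := ler_wpM2l s0 h2; lra.
- rewrite mulmxDr -!scalemxAr; move: (GK K g *m x) (GK K g *m x') => A A'.
  by apply/colP => i; rewrite !mxE; ring.
Qed.

Lemma calK'_compact : compact (calK' g a : set vec).
Proof.
pose X : set vec := [set x | orthant x /\ norm1 x <= a].
pose W : set vec := [set w | norm1s w <= b].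
have cX : compact X.
  apply: (subclosed_compact _ (@cV_compact R n 0 (n%:R * a))).
    have -> : X = (\bigcap_i [set x : vec | 0 <= x i 0]) `&`
      [set x | norm1 x <= a].
      apply/seteqP; split=> [x [x0 xa]|x [x0 xa]]; split=> //.
        by move=> i _; exact: orthant_ge0.
      by move=> i; rewrite mxE; exact: x0.
    apply: closedI.
      apply: closed_bigI => i _.
      exact: (closed_comp (f := fun x : vec => x i 0) (fun x _ =>
        @coord_continuous R n 1 i 0 x) (@closed_ge R 0)).
    have cn : continuous (fun x : vec => norm1 x).
      apply: ctsM; first exact: cts_cst.
      apply: cts_sum => i; apply: cts_norm; exact: coord_continuous.
    exact: (closed_comp (fun x _ => cn x) (@closed_le R a)).
  move=> x [x0 xa] i; rewrite orthant_ge0//=.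
  by rewrite norm1_orthant// mulrC ler_pdivrMr// mulrC in xa; apply: le_trans xa;
    exact: le_sumv.
have cW : compact W.
  have -> : W = [set w : vec | forall i, - (b / n%:R) <= w i 0 <= b / n%:R].
    apply/seteqP; split=> w /=.
      move=> /norm1s_leP H i; have := H b0 i.
      by rewrite mulrC -ler_pdivlMr// ler_norml.
    move=> H; apply/norm1s_leP => // i.
    by rewrite mulrC -ler_pdivlMr// ler_norml.
  exact: cV_compact.
have -> : calK' g a = (fun z : vec * vec => GK K g *m z.1 + z.2) @` (X `*` W).
  apply/seteqP; split=> [_ [_ [w [[x Xx <-] Ww ->]]]|_ [[x w] [Xx Ww] <-]].
    by exists (x, w).
  by exists (GK K g *m x), w; split=> //; exists x.
apply: continuous_compact; last exact: compact_setX.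
apply: continuous_subspaceT; apply: (@cts_col R) => i.
under eq_fun do rewrite !mxE.
apply: ctsD; last exact/cts_coord/cts_snd.
apply: cts_sum => j; apply: ctsM; first exact: cts_cst.
exact/cts_coord/cts_fst.
Qed.

Lemma mem_calK' (q : vec) :
  (forall v (c : R), (forall p, calK' g a p -> dotv p v <= c) -> dotv q v <= c) ->
    calK' g a q.
Proof.
exact: (mem_of_support calK'_compact calK'_nonempty (fun p p' s s01 =>
  @calK'_convex p p' s s01)).
Qed.

End GradientSet.

Section Project.
Context {R : realType}.
Variable mu : Mplus R.

Let fin A : measurable A -> mu A \is a fin_num.
Proof. exact: fin_num_measure. Qed.

(** The distribution function at the points of the grid. The last cell is closed
    on the right, so that the last value is the total mass. *)
Definition cdf (K i : nat) : R :=
  if (i < cardD K)%N then fine (mu (`]-oo,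
    (i%:R / 2 ^+ K - 1)[%classic : set (measurableTypeR R)))
  else fine (mu setT).

Lemma cell_cdf K (i : 'I_(cardD K)) : fine (mu (dyadic_cell i)) =
  cdf K i.+1 - cdf K i.
Proof.
rewrite /cdf ltn_ord /dyadic_cell ltn_neqAle ltn_ord andbT.
have add (A B C : set (measurableTypeR R)) : measurable A -> measurable B ->
    C = A `|` B -> A `&` B = set0 -> fine (mu B) = fine (mu C) - fine (mu A).
  move=> mA mB -> AB; rewrite measureU// fineD ?fin//; ring.
have [last|notlast] /= := eqVneq i.+1 (cardD K).
  have -> : fine (mu `[dyad i, 1]%classic) =
    fine (mu (`[dyad i, +oo[%classic : set (measurableTypeR R))).
    have -> : fine (mu (`[dyad i, +oo[%classic : set (measurableTypeR R))) =
       fine (mu `[dyad i, 1]%classic) + fine (mu `]1, +oo[%classic).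
      have -> := add `[dyad i, 1]%classic `]1,
        +oo[%classic `[dyad i, +oo[%classic.
      - ring.
      - exact: measurable_itv.
      - exact: measurable_itv.
      - apply/seteqP; split=> x /=; rewrite !in_itv/= ?andbT.
          by move=> h; case: (leP x 1) => h1; [left; rewrite h|right].
        by move=> [/andP[]//|h]; apply: le_trans (ltW h); have := @dyad_seg R K i;
          rewrite /seg/= in_itv => /andP[].
      - by rewrite -subset0 => x [] /=;
        rewrite !in_itv/= ?andbT => /andP[_ h] /(le_lt_trans h); rewrite ltxx.
    suff -> : mu `]1, +oo[%classic = 0%E by rewrite addr0.
    apply/eqP; rewrite eq_le measure_ge0 andbT -(Mplus_seg mu).
    apply: le_measure; rewrite ?inE.
    - exact: measurable_itv.
    - by apply: measurableC; exact: measurable_itv.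
    - by move=> x /=; rewrite /seg/= !in_itv/= andbT =>
      h /andP[_ /(lt_le_trans h)]; rewrite ltxx.
  apply: add.
  - exact: measurable_itv.
  - exact: measurable_itv.
  - apply/seteqP; split=> x //= _; rewrite !in_itv/= andbT;
    case: (ltP x (dyad i)) => h; [by left|by right].
  - by rewrite -subset0 => x [] /=; rewrite !in_itv/= andbT => /lt_le_trans h /h;
    rewrite ltxx.
have E : i.+1%:R / 2 ^+ K - 1 = dyad i + 2 ^- K :> R by rewrite /dyad -natr1;
  ring.
have p0 : 0 < 2 ^- K :> R by rewrite invr_gt0 exprn_gt0.
rewrite E; apply: add.
- exact: measurable_itv.
- exact: measurable_itv.
- apply/seteqP; split=> x /=; rewrite !in_itv/=.
    by move=> h; case: (ltP x (dyad i)) => h1; [left|right; rewrite h].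
  move=> [h|/andP[//]]; apply: lt_trans h _; rewrite -/(dyad i); lra.
- by rewrite -subset0 => x [] /=; rewrite !in_itv/= => /lt_le_trans h /andP[/h];
  rewrite ltxx.
Qed.

Lemma project_orthant K : orthant (project K mu).
Proof. by move=> i; rewrite !mxE mulr_ge0// fine_ge0// measure_ge0. Qed.

(** Sums over the fine cells contained in a coarse one telescope. *)
Lemma avg_project K K' (hK : (K <= K')%N) : avg hK (project K' mu) = project K mu.
Proof.
have r0 := subdiv_gt0 K K'.
apply/colP => i; rewrite !mxE sum_fiber.
rewrite (eq_bigr (fun j : 'I_(subdiv K K') => (cardD K')%:R *
    (cdf K' (i * subdiv K K' + j).+1 - cdf K' (i * subdiv K K' + j)))) => [|j _];
      last first.
  by rewrite mxE cell_cdf.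
rewrite -mulr_sumr (cardD_subdiv hK) natrM mulrA [_^-1 * _]mulrC mulfK
  ?pnatr_eq0 -?lt0n//.
congr (_ * _); rewrite cell_cdf.
have -> : \sum_(j < subdiv K K') (cdf K' (i * subdiv K K' + j).+1 - cdf K'
  (i * subdiv K K' + j)) =
    cdf K' (i.+1 * subdiv K K') - cdf K' (i * subdiv K K').
  rewrite -(big_mkord xpredT (fun j => cdf K' (i * subdiv K K' + j).+1 - cdf K'
    (i * subdiv K K' + j))).
  rewrite (@telescope_sumr_eq _ 0%N (subdiv K K') (fun j =>
    cdf K' (i * subdiv K K' + j))) ?addn0 ?mulSnr// => k _.
  by rewrite addnS.
have scale j : cdf K' (j * subdiv K K') = cdf K j.
  rewrite /cdf (cardD_subdiv hK) ltn_pmul2r//; case: ifP => // _.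
  have -> : (j * subdiv K K')%:R / 2 ^+ K' - 1 = j%:R / 2 ^+ K - 1 :> R;
    last by [].
  have -> : 2 ^+ K' = 2 ^+ K * (subdiv K K')%:R :> R
    by rewrite natrX -exprD subnKC.
  by rewrite natrM; field; rewrite !gt_eqF ?exprn_gt0// ltr0n.
by rewrite !scale.
Qed.

Lemma norm1_project K : norm1 (project K mu) <= fine (mu setT).
Proof.
rewrite norm1_orthant; last exact: project_orthant.
rewrite /sumv (eq_bigr (fun i : 'I_(cardD K) =>
  (cardD K)%:R * (cdf K i.+1 - cdf K i))) => [|i _]; last first.
  by rewrite mxE cell_cdf.
rewrite -mulr_sumr mulKf ?pnatr_eq0 -?lt0n ?cardD_gt0//.
rewrite -(big_mkord xpredT (fun j => cdf K j.+1 - cdf K j)) telescope_sumr//.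
rewrite {1}/cdf ltnn lerBlDr lerDl /cdf; case: ifP => _;
  exact/fine_ge0/measure_ge0.
Qed.

End Project.

(** * Convergence of the approximations *)

Section SolutionFacts.
Context {R : realType}.

Lemma tame_solution d (H : 'cV[R]_d -> R) u h (L : R) : viscosity_solution H u ->
  frakL_unif u ->
  0 <= L -> lip1 h L -> (forall x, orthant x -> u (0, x) = h x) -> tame u.
Proof.
move=> [cu _] [[_ tl] _] L0 lh init; split; first exact: continuous_ret.
set T := time_lip u in tl.
have [C C0 HC] : exists2 C : R, 0 <= C & forall t x, 0 < t -> orthant x ->
  `|u (t, x) - u (0, x)| / t <= C.
  exists `|fine T| => // t x t0 x0.
  have le : ((`|u (t, x) - u (0, x)| / t)%:E <= T)%E.
    by apply: ereal_sup_ubound; exists t, x.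
  case ET : T le tl => [r| |] //; rewrite lee_fin => le _.
  exact: le_trans le (ler_norm _).
exists (C + L); split; first exact: addr_ge0.
- move=> t x; rewrite le_eqVlt => /orP[/eqP<- _|t0 x0];
  first by rewrite subrr normr0 mulr0.
  have := HC _ _ t0 x0; rewrite ler_pdivrMr// => /le_trans; apply.
  by rewrite ler_wpM2r ?lerDl// ltW.
- move=> x y x0 y0; rewrite !init//; apply: le_trans (lh _ _ x0 y0) _.
  by rewrite ler_wpM2r ?lerDr// sumr_ge0.
Qed.

End SolutionFacts.

Section Averaging.
Context {R : realType}.
Variables (K K' : nat).
Hypothesis hK : (K <= K')%N.
Notation n := (cardD K).
Notation n' := (cardD K').
Notation r := ((subdiv K K')%:R : R).

Let r0 : 0 < r. Proof. by rewrite ltr0n subdiv_gt0. Qed.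

Definition averaged (f : R * 'cV[R]_n -> R) : R * 'cV[R]_n' -> R := fun z =>
  f (z.1, avg hK z.2).

Lemma dist1_avg (x y : 'cV[R]_n') : dist1 (avg hK x) (avg hK y) <= 1 * dist1 x y.
Proof.
pose w : 'cV[R]_n' := \col_k `|x k 0 - y k 0|.
apply: (@le_trans _ _ (\sum_i 1 * avg hK w i 0)).
  apply: ler_sum => i _; rewrite mul1r !mxE -mulrBr -sumrB normrM normfV
    (@ger0_norm _ r)//.
  rewrite ler_wpM2l ?invr_ge0//; apply: le_trans (ler_norm_sum _ _ _) _.
  by apply: ler_sum => k _; rewrite mxE.
rewrite sum_avg; apply: ler_pM.
- by rewrite invr_ge0.
- by apply: sumr_ge0 => k _; rewrite mul1r mxE.
- by rewrite invf_le1// -[1]/(1%:R) ler_nat subdiv_gt0.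
- by apply: ler_sum => k _; rewrite mul1r mxE.
Qed.

Lemma tame_averaged f : tame f -> tame (averaged f).
Proof.
move=> tf; apply: (tame_comp (P := avg hK) (c := 1)) => //.
- apply: (@cts_col R) => i; under eq_fun do rewrite !mxE.
  apply: ctsM; first exact: cts_cst.
  under eq_fun do rewrite sum_fiber.
  by apply: cts_sum => j; exact: coord_continuous.
- exact: avg_orthant.
- exact: dist1_avg.
Qed.

Lemma dotvB (q x y : 'cV[R]_n') : dotv q (x - y) = dotv q x - dotv q y.
Proof. by rewrite dotvDr -scaleN1r dotvZr mulN1r. Qed.

Lemma avg_delta k : avg hK (delta_mx k 0 : 'cV[R]_n') = r^-1 *: delta_mx
  (cell hK k) 0.
Proof.
apply/colP => i; rewrite !mxE eqxx andbT; congr (_ * _).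
have [->|ne] := eqVneq i (cell hK k).
  rewrite (bigD1 k)//= mxE !eqxx big1 ?addr0// => l /andP[_ lk].
  by rewrite mxE (negbTE lk).
rewrite big1// => l /eqP cl; rewrite mxE.
by case: eqP => //= lk; move: ne; rewrite -cl lk eqxx.
Qed.

(** The function is constant along the kernel of [avg], so that slopes vanish
    there; they are thus in the range of the transpose [pull]. *)
Lemma prox_super_averaged f p tau q : prox_super (averaged f) p tau q ->
  exists2 q', q = pull hK q' & prox_super f (p.1, avg hK p.2) tau q'.
Proof.
move=> ps.
have ker v : avg hK v = 0 -> 0 <= dotv q v.
  move=> v0; have [C C0 nf] := prox_super_dir v ps.
  apply: (@near_quad_ge0 _ _ C); apply: filterS nf => s + _.
  by rewrite /averaged/= avgD avgZ v0 scaler0 addr0; lra.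
have const k l : cell hK k = cell hK l -> q k 0 = q l 0.
  move=> kl; have E : avg hK (delta_mx k 0 - delta_mx l 0 : 'cV[R]_n') = 0.
    by rewrite avgB !avg_delta kl subrr.
  have h1 := ker _ E.
  have h2 : 0 <= dotv q (delta_mx l 0 - delta_mx k 0).
    by apply: ker; rewrite avgB !avg_delta kl subrr.
  by move: h1 h2; rewrite !dotvB !dotv_delta; lra.
pose q' : 'cV[R]_n := r *: avg hK q.
have qE : q = pull hK q'.
  apply/colP => k; rewrite !mxE mulrA mulVf ?gt_eqF// mul1r sum_fiber.
  rewrite (eq_bigr (fun=> q k 0)) => [|j _]; last by apply: const;
    rewrite cell_sub_index.
  by rewrite sumr_const card_ord -[q k 0 *+ _]mulr_natl mulrA mulVf
    ?mul1r// gt_eqF.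
exists q' => //.
pose B (z : R * 'cV[R]_n) : R * 'cV[R]_n' :=
  (z.1, p.2 + replicate hK (z.2 - avg hK p.2)).
have rep0 : replicate hK (0 : 'cV[R]_n) = 0 by apply/colP => k; rewrite !mxE.
have Bp : B (p.1, avg hK p.2) = p by rewrite /B/= subrr rep0 addr0
  -surjective_pairing.
apply: (@prox_super_along _ _ _ (averaged f) f B (p.1, avg hK p.2) q tau q' r);
  rewrite ?Bp//.
- apply: cts_pair; first exact: cts_fst.
  apply: (@cts_col R) => i; under eq_fun do rewrite !mxE.
  apply: ctsD; first exact: cts_cst.
  by apply: ctsD; [exact/cts_coord/cts_snd|exact: cts_cst].
- move=> [t y]; rewrite /averaged /B /= avgD avg_replicate.
  by rewrite addrC subrK.
- move=> z; rewrite /B /= (addrC p.2) addrK.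
  by rewrite qE dotv_pull avg_replicate.
- move=> z; rewrite /sqdist /B /= mulrDr lerD//.
    by rewrite ler_peMl ?sqr_ge0// -[1]/(1%:R) ler_nat subdiv_gt0.
  rewrite (sum_cells hK) mulr_sumr; apply: ler_sum => i _.
  rewrite sum_fiber (eq_bigr (fun=> (z.2 i 0 - avg hK p.2 i 0) ^+ 2)) => [|j _].
    by rewrite sumr_const card_ord -[_ *+ _]mulr_natl.
  have E (w : 'cV[R]_n) k : (p.2 + replicate hK w) k 0 - p.2 k 0 =
    w (cell hK k) 0.
    by rewrite !mxE; ring.
  rewrite E cell_sub_index; congr (_ ^+ 2).
  by rewrite [LHS]mxE [X in _ + X]mxE.
Qed.

Lemma pullN (q : 'cV[R]_n) : pull hK (- q) = - pull hK q.
Proof. by apply/colP => k; rewrite !mxE mulrN. Qed.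

Lemma prox_sub_averaged f p tau q : prox_sub (averaged f) p tau q ->
  exists2 q', q = pull hK q' & prox_sub f (p.1, avg hK p.2) tau q'.
Proof.
move=> ps; have [q' E ps'] := @prox_super_averaged (fun z => - f z) _ _ _ ps.
by exists (- q'); rewrite ?pullN -?E ?opprK// /prox_sub opprK.
Qed.

End Averaging.

Section Main.
Context {R : realType}.
Variables (g : R -> R) (psi : Mplus R -> R) (m M lipTV a : R)
  (f : forall K : nat, R -> R * 'cV[R]_(cardD K) -> R).
Arguments f : clear implicits.
Hypotheses (m0 : 0 < m) (a0 : 0 <= a).
Hypothesis gm : forall x, seg x -> m <= g x.
Hypothesis gM : forall x, seg x -> g x <= M.
Hypothesis H2 : forall mu nu : Mplus R, `|psi mu - psi nu| <= lipTV * TV mu nu.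
Hypothesis H3 : forall K : nat, (1 <= K)%N ->
     exists2 N : set 'cV[R]_(cardD K), lebesgue_null N &
       forall x, open_orthant x -> ~ N x ->
         differentiable (psiK psi) x /\ calK' g a (grad (psiK psi) x).
Hypothesis f_sol : forall (K : nat) (rho : R), (1 <= K)%N -> lipTV < rho ->
     [/\ frakL_unif (f K rho),
         viscosity_solution (sfH g m rho) (f K rho) &
         forall x, orthant x -> f K rho (0, x) = psiK psi x].

Let lip0 : 0 <= lipTV := lipTV_ge0 H2.

Let rho_gt0 rho : lipTV < rho -> 0 < rho := le_lt_trans lip0.

Let n0 K : 0 < (cardD K)%:R :> R.
Proof. by rewrite ltr0n cardD_gt0. Qed.

Let M0 : 0 < M := lt_le_trans m0 (mM 0 gm gM).

Let Lam K rho := (cardD K)%:R * LH m M rho : R.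

Let Lam0 K rho : lipTV < rho -> 0 <= Lam K rho.
Proof. by move=> /rho_gt0 r0; rewrite mulr_ge0// (LH_ge0 0 m0 r0 gm gM). Qed.

Let tame_f K rho : (1 <= K)%N -> lipTV < rho -> tame (f K rho).
Proof.
move=> K1 lr; have [fu fv f0] := f_sol K1 lr.
apply: (tame_solution fv fu _ (psiK_lip1 H2 (K := K))) => //.
by rewrite divr_ge0.
Qed.

Let slopes K rho v c : (1 <= K)%N -> lipTV < rho -> 
  (forall s x y, 0 <= s -> orthant x -> orthant y -> x - y = s *: v ->
     psiK psi x - psiK psi y <= s * c) ->
  forall p tau q, open_dom p -> prox_super (f K rho) p tau q \/ prox_sub (f K rho)
    p tau q -> dotv q v <= c.
Proof.
move=> K1 lr init; have [fu fv f0] := f_sol K1 lr; have r0 := rho_gt0 lr.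
apply: (slope_bound (sfH_nondecr m0 r0 gm) (Lam0 K lr) (sfH_diag_lip m0 r0 gm gM)
  (tame_f K1 lr) fv) => s x y s0 x0 y0 xy.
by rewrite !f0//; exact: init.
Qed.

(** [slope_bound] in the coordinate directions, where the total variation distance
    bounds the initial increments. *)
Lemma touching_norm K rho : (1 <= K)%N -> lipTV < rho ->
  forall p tau q, open_dom p ->
  prox_super (f K rho) p tau q \/ prox_sub (f K rho) p tau q -> norm1s q <= lipTV.
Proof.
move=> K1 lr p tau q op touch; apply/norm1s_leP => // i.
have incr (e : R) : `|e| = 1 -> dotv q (e *: delta_mx i 0) <=
  lipTV / (cardD K)%:R.
  move=> e1; apply: (slopes K1 lr _ op touch) => s x y s0 x0 y0 xy.
  apply: le_trans (ler_norm _) _; apply: le_trans (psiK_lip1 H2 x0 y0) _.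
  rewrite mulrC ler_wpM2r ?divr_ge0// /dist1.
  rewrite (eq_bigr (fun k => s * (k == i)%:R)) => [|k _]; last first.
    have -> : x k 0 - y k 0 = (x - y) k 0 by rewrite !mxE.
    by rewrite xy !mxE andbT !normrM e1 mul1r ger0_norm// normr_nat.
  rewrite -mulr_sumr (bigD1 i)//= eqxx big1 ?addr0 ?mulr1// => k ki.
  by rewrite (negbTE ki).
have h1 := incr 1 (normr1 _); have h2 := incr (-1) (normrN1 _).
rewrite dotvZr dotv_delta mul1r in h1; rewrite dotvZr dotv_delta mulN1r in h2.
rewrite mulrC -ler_pdivlMr// ler_norml; apply/andP; split; lra.
Qed.

(** [slope_bound] in all directions says that [q] satisfies the linear
    inequalities that define the closed convex set [calK' g a]. *)
Lemma touching_calK' K rho : (1 <= K)%N -> lipTV < rho ->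
  forall p tau q, open_dom p ->
  prox_super (f K rho) p tau q \/ prox_sub (f K rho) p tau q -> calK' g a q.
Proof.
move=> K1 lr p tau q op touch; apply: mem_calK' => // v c vc.
apply: (slopes K1 lr _ op touch) => s x y s0 x0 y0 xy.
have H3K := H3 K1.
apply: (psiK_increment H2 H3K x0 y0) => p' Kp'.
by rewrite xy dotvZr ler_wpM2l//; exact: vc.
Qed.

(** A slope is at dual distance at most |D_K|^(-1/2) from an element of the
    cone at which both nonlinearities are equal to the quadratic form. *)
Lemma cutoff_close K rho rho' : (1 <= K)%N -> lipTV < rho -> lipTV < rho' ->
  lipTV + (Num.sqrt (cardD K)%:R)^-1 <= rho ->
    lipTV + (Num.sqrt (cardD K)%:R)^-1 <= rho' ->
  forall t x, 0 <= t -> orthant x ->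
  f K rho (t, x) - f K rho' (t, x) <= (LH m M rho + LH m M rho') *
    (Num.sqrt (cardD K)%:R)^-1 * t.
Proof.
move=> K1 lr lr' ler ler' t x t0 x0.
have r0 := rho_gt0 lr; have r0' := rho_gt0 lr'.
set b := (Num.sqrt (cardD K)%:R)^-1 in ler ler' *.
have b0 : 0 <= b by rewrite invr_ge0 sqrtr_ge0.
have [_ fv f0] := f_sol K1 lr; have [_ fv' f0'] := f_sol K1 lr'.
have L0 := LH_ge0 0 m0 r0 gm gM; have L0' := LH_ge0 0 m0 r0' gm gM.
set e := (LH m M rho + LH m M rho') * b.
have e0 : 0 <= e by rewrite mulr_ge0// addr_ge0.
have := @comparison R _ (sfH g m rho') (Lam K rho') (f K rho) (f K rho') 0 0 e
  (sfH_nondecr m0 r0' gm) (Lam0 K lr') (sfH_diag_lip m0 r0' gm gM)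
  (tame_f K1 lr) (tame_f K1 lr') (lexx 0) e0 _ _ _ t x t0 x0.
rewrite mul0r mulr0 !add0r; apply.
- move=> p tau q op ps.
  apply: le_trans (visc_prox_super fv op ps) _.
  have nq := touching_norm K1 lr op (or_introl ps).
  have [y [w [[z [z0 za] yz] wb qE]]] := touching_calK' K1 lr op (or_introl ps).
  have wi i : `|w i 0| <= b / (cardD K)%:R.
    have /norm1s_leP/(_ i) := wb; rewrite mulrC -ler_pdivlMr//; exact.
  have bn0 : 0 <= b / (cardD K)%:R by rewrite divr_ge0.
  have ynorm : norm1s y <= lipTV + b.
    apply/norm1s_leP => [|i]; first exact: addr_ge0.
    have -> : y = q - w by rewrite qE addrK.
    rewrite !mxE; apply: (@le_trans _ _ ((cardD K)%:R * `|q i 0| + (cardD K)%:R *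
      `|w i 0|)).
      by rewrite -mulrDr ler_wpM2l// ler_normB.
    by apply: lerD;
      [exact: le_trans (le_norm1s q i) nq|exact: le_trans (le_norm1s w i) wb].
  have Hy : sfH g m rho y = sfH g m rho' y.
    by rewrite -yz !sfH_GK// yz; exact: le_trans ynorm _.
  have h1 : sfH g m rho q <= sfH g m rho y + LH m M rho * b.
    have := sfH_diag_lip m0 r0 gm gM y bn0.
    rewrite [_ * LH _ _ _ * _](_ : _ = LH m M rho * b); last by field;
      rewrite gt_eqF.
    apply: le_trans; apply: sfH_nondecr => // i; rewrite qE !mxE lerD2l.
    by apply: le_trans (ler_norm _) (wi i).
  have h2 : sfH g m rho' y <= sfH g m rho' q + LH m M rho' * b.
    have := sfH_diag_lip m0 r0' gm gM q bn0.
    rewrite [_ * LH _ _ _ * _](_ : _ = LH m M rho' * b); last by field;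
      rewrite gt_eqF.
    apply: le_trans; apply: sfH_nondecr => // i; rewrite qE !mxE.
    by have := wi i; rewrite ler_norml => /andP[h _]; lra.
  by rewrite /e; lra.
- by move=> p tau q op ps; exact: visc_prox_sub fv' op ps.
- by move=> y y0; rewrite f0// f0'// subrr mul0r.
Qed.

(** The bound of [psiK_avg], per unit of mass. *)
Definition init_err (w : R) K : R := w * a + 2 * (Num.sqrt (cardD K)%:R)^-1.

(** Comparison at the fine level, in both directions. The error on the initial
    conditions grows linearly in [X], hence the slope [eta] in [comparison]; the
    error on the nonlinearities is [level_err]. *)
Lemma levels_close K K' rho w (hK : (K <= K')%N) : (1 <= K)%N -> lipTV < rho ->
  osc g K w ->
  forall t X, 0 <= t -> orthant X ->
  `|f K rho (t, avg hK X) - f K' rho (t, X)| <=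
    init_err w K' * norm1 X + (LH m M rho * init_err w K' + level_err m M rho w) *
      t.
Proof.
move=> K1 lr gw t X t0 X0.
have K1' : (1 <= K')%N := leq_trans K1 hK.
have r0 := rho_gt0 lr.
have [_ fv f0] := f_sol K1 lr; have [_ fv' f0'] := f_sol K1' lr.
have w0 : 0 <= w.
  have s0 : seg (0 : R) by rewrite /seg/= in_itv/= lerN10 ler01.
  by apply: le_trans (gw 0 0 0 0 s0 s0 s0 s0 _ _);
    rewrite ?subrr ?normr0 ?invr_ge0 ?exprn_ge0.
set eps := init_err w K'.
have eps0 : 0 <= eps by rewrite addr_ge0 ?mulr_ge0 ?invr_ge0 ?sqrtr_ge0.
set err := level_err m M rho w.
have err0 : 0 <= err.
  have z0 : norm1s (0 : 'cV[R]_(cardD K)) <= rho.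
    by apply/norm1s_leP => [|i]; [exact: ltW|rewrite mxE normr0 mulr0 ltW].
  have [h1 h2] := level_close hK m0 r0 gm gM gw z0.
  by rewrite -/err in h1 h2; lra.
have N0 := n0 K'.
set eta := eps / (cardD K')%:R; have eta0 : 0 <= eta by rewrite divr_ge0.
have psiclose Y : orthant Y -> `|psiK psi (avg hK Y) - psiK psi Y| <=
  eta * sumv Y.
  move=> Y0; have := psiK_avg H2 hK gw (H3 K1') Y0; rewrite -/eps.
  by rewrite norm1_orthant// mulrA.
have bound : eta * sumv X + (Lam K' rho * eta + err) * t =
    eps * norm1 X + (LH m M rho * eps + err) * t.
  by rewrite norm1_orthant// /eta /Lam; field; rewrite gt_eqF.
rewrite -bound.
have av_dom (p : R * 'cV[R]_(cardD K')) : open_dom p ->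
  open_dom (p.1, avg hK p.2).
  by move=> [p1 p2]; split=> //=; exact: avg_open.
have tF := tame_averaged hK (tame_f K1 lr).
have tf' := tame_f K1' lr.
have nq q : norm1s q <= lipTV -> norm1s q <= rho by move=> /le_trans;
  apply; exact: ltW.
rewrite ler_norml; apply/andP; split; last first.
- have := @comparison R _ (sfH g m rho) (Lam K' rho) (averaged hK (f K rho))
  (f K' rho) 0 eta err
    (sfH_nondecr m0 r0 gm) (Lam0 K' lr) (sfH_diag_lip m0 r0 gm gM) tF tf' eta0
      err0 _ _ _ t X t0 X0.
  rewrite add0r; apply.
  + move=> p tau q op /prox_super_averaged[q' -> ps].
    have op' := av_dom _ op.
    have n1 := nq _ _ (touching_norm K1 lr op' (or_introl ps)).
    apply: le_trans (visc_prox_super fv op' ps) _.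
    exact: (level_close hK m0 r0 gm gM gw n1).2.
  + by move=> p tau q op ps; exact: visc_prox_sub fv' op ps.
  + move=> Y Y0; rewrite /averaged/= f0 ?f0'//; last exact: avg_orthant.
    by rewrite add0r; exact: (le_trans (ler_norm _) (psiclose _ Y0)).
- rewrite -lerN2 opprK opprB.
  have mH : nondecr (fun q : 'cV[R]_(cardD K') => sfH g m rho q - err : R).
    by move=> x y xy; rewrite lerD2r; exact: sfH_nondecr.
  have lH : diag_lip (fun q : 'cV[R]_(cardD K') => sfH g m rho q - err : R)
    (Lam K' rho).
    by move=> y s s0; have := sfH_diag_lip m0 r0 gm gM y s0; rewrite /Lam; lra.
  have := @comparison R _ _ (Lam K' rho) (f K' rho) (averaged hK (f K rho)) 0 eta
    err
    mH (Lam0 K' lr) lH tf' tF eta0 err0 _ _ _ t X t0 X0.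
  rewrite add0r; apply.
  + by move=> p tau q op ps; rewrite subrK; exact: visc_prox_super fv' op ps.
  + move=> p tau q op /prox_sub_averaged[q' -> ps].
    have op' := av_dom _ op.
    have n1 := nq _ _ (touching_norm K1 lr op' (or_intror ps)).
    apply: le_trans (visc_prox_sub fv op' ps).
    by rewrite lerBlDr; exact: (level_close hK m0 r0 gm gM gw n1).1.
  + move=> Y Y0; rewrite /averaged/= f0 ?f0'//; last exact: avg_orthant.
    by rewrite add0r; apply: le_trans (ler_norm _) _;
      rewrite distrC; exact: psiclose.
Qed.

Let err_const rho : R := 8 * rho ^+ 2 / m + (cap m rho + 8 * rho / m *
  (M * (rho / m))).

Let err_const_ge0 rho : 0 < rho -> 0 <= err_const rho.
Proof.
move=> r0; have M0' := ltW M0; have m0' := ltW m0; have r0' := ltW r0.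
apply: addr_ge0; first by rewrite divr_ge0// mulr_ge0// sqr_ge0.
apply: addr_ge0; first exact: (ltW (cap_gt0 m0 r0)).
by apply: mulr_ge0; [rewrite divr_ge0// mulr_ge0|rewrite mulr_ge0// divr_ge0].
Qed.

Lemma level_err_small rho w : lipTV < rho -> 0 <= w -> w <= m ->
  level_err m M rho w <= w * (7 / m * err_const rho).
Proof.
move=> lr w0 wm; have r0 := rho_gt0 lr.
rewrite /level_err -/(err_const rho) [leRHS]mulrA ler_wpM2r//.
  exact: err_const_ge0.
have x0 : 0 <= w / m by rewrite divr_ge0// ltW.
have x1 : w / m <= 1 by rewrite ler_pdivrMr// mul1r.
have -> : w * (7 / m) = 7 * (w / m) by ring.
set x := w / m in x0 x1 *.
have x2 : x ^+ 2 <= x by rewrite expr2 ler_piMr.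
have x3 : x ^+ 3 <= x by rewrite exprS; apply: le_trans (ler_wpM2l x0 x2) _;
  rewrite ler_piMr.
have -> : (1 + x) ^+ 3 - 1 = 3 * x + 3 * x ^+ 2 + x ^+ 3 by ring.
by lra.
Qed.

Lemma inv_sqrt_card_small (del : R) : 0 < del ->
  \forall K \near \oo, (Num.sqrt (cardD K)%:R)^-1 <= del :> R.
Proof.
move=> d0; near=> K.
have big : del ^- 2 <= K%:R by near: K; exact: nbhs_infty_ger.
have Kn : (K%:R : R) <= (cardD K)%:R.
  rewrite ler_nat /cardD expnS; apply: (leq_trans (ltnW (ltn_expl K (ltnSn 1)))).
  exact: leq_pmull.
rewrite -[del]invrK lef_pV2 ?posrE ?sqrtr_gt0 ?invr_gt0//.
rewrite -[del^-1]ger0_norm ?invr_ge0 ?(ltW d0)// -sqrtr_sqr ler_wsqrtr// exprVn.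
exact: le_trans big Kn.
Unshelve. all: by end_near. Qed.

Hypothesis gc : {within seg, continuous g}.

(** The mass of the projections is bounded by the mass of [mu], so that the bound
    of [levels_close] tends to 0 as the oscillation of the kernel does. *)
Lemma projections_cauchy t mu rho : 0 <= t -> lipTV < rho ->
  cvg (f K rho (t, project K mu) @[K --> \oo]).
Proof.
move=> t0 lr; have r0 := rho_gt0 lr.
have L0 := LH_ge0 0 m0 r0 gm gM.
set T := fine (mu setT); have T0 : 0 <= T by exact/fine_ge0/measure_ge0.
pose S := T + LH m M rho * t; have S0 : 0 <= S by rewrite addr_ge0// mulr_ge0.
pose D := 7 / m * err_const rho * t.
have D0 : 0 <= D.
  apply: mulr_ge0 => //; apply: mulr_ge0; first by rewrite divr_ge0// ltW.
  exact: err_const_ge0.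
apply/cauchy_cvgP/cauchy_exP => e e0.
pose C1 := a * S + D; have C10 : 0 <= C1 by rewrite addr_ge0// mulr_ge0.
(* The bound of levels_close is at most w C1 + (2 S) |D_K'|^(-1/2). *)
pose w := Num.min m (e / 3 / (C1 + 1)).
have w0 : 0 < w by rewrite lt_min m0/= !divr_gt0// ltr_wpDl.
have wm : w <= m by rewrite ge_min lexx.
have wC : w * C1 <= e / 3.
  apply: (@le_trans _ _ (w * (C1 + 1))); first by rewrite ler_wpM2l ?lerDl// ltW.
  by rewrite -ler_pdivlMr ?ltr_wpDl// ge_min lexx orbT.
pose del := e / 3 / (2 * S + 1).
have del0 : 0 < del by rewrite !divr_gt0// ltr_wpDl// mulr_ge0.
have delS : del * (2 * S) <= e / 3.
  apply: (@le_trans _ _ (del * (2 * S + 1)));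
    first by rewrite ler_wpM2l ?lerDl// ltW.
  by rewrite /del divfK// gt_eqF// ltr_wpDl// mulr_ge0.
near \oo => K.
have K1 : (1 <= K)%N by near: K; exact: nbhs_infty_ge.
have gw : osc g K w by near: K; exact: osc_eventually.
exists (f K rho (t, project K mu)).
suff : \forall K' \near \oo,
  `|f K rho (t, project K mu) - f K' rho (t, project K' mu)| < e by [].
near=> K'.
have hK : (K <= K')%N by near: K'; exact: nbhs_infty_ge.
have small : (Num.sqrt (cardD K')%:R)^-1 <= del :> R.
  by near: K'; exact: inv_sqrt_card_small.
have := levels_close hK K1 lr gw t0 (@project_orthant R mu K').
rewrite avg_project => /le_lt_trans; apply.
set b := (Num.sqrt _)^-1 in small; have b0 : 0 <= b by rewrite invr_ge0 sqrtr_ge0.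
have ie : init_err w K' <= w * a + 2 * del by rewrite lerD2l ler_wpM2l.
have ie0 : 0 <= init_err w K' by rewrite addr_ge0 ?mulr_ge0// ltW.
have h1 : init_err w K' * norm1 (project K' mu) <= init_err w K' * T.
  by rewrite ler_wpM2l//; exact: norm1_project.
have h2 := ler_wpM2r S0 ie.
have h3 := ler_wpM2r t0 (level_err_small lr (ltW w0) wm).
have DE : w * (7 / m * err_const rho) * t = w * D by rewrite /D; ring.
rewrite DE in h3.
rewrite /C1 in wC.
have e3 : 0 < e / 3 by rewrite divr_gt0.
rewrite /S in h2 delS wC.
by lra.
Unshelve. all: by end_near. Qed.

Lemma cutoff_irrelevant t mu rho rho' : 0 <= t -> lipTV < rho -> lipTV < rho' ->
  forall e, 0 < e -> \forall K \near \oo,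
    f K rho (t, project K mu) - f K rho' (t, project K mu) <= e.
Proof.
move=> t0 lr lr' e e0.
have r0 := rho_gt0 lr; have r0' := rho_gt0 lr'.
have L0 := LH_ge0 0 m0 r0 gm gM; have L0' := LH_ge0 0 m0 r0' gm gM.
pose C := (LH m M rho + LH m M rho') * t;
  have C0 : 0 <= C by rewrite mulr_ge0// addr_ge0.
near=> K.
have K1 : (1 <= K)%N by near: K; exact: nbhs_infty_ge.
have s1 : (Num.sqrt (cardD K)%:R)^-1 <= rho - lipTV.
  by near: K; apply: inv_sqrt_card_small; rewrite subr_gt0.
have s2 : (Num.sqrt (cardD K)%:R)^-1 <= rho' - lipTV.
  by near: K; apply: inv_sqrt_card_small; rewrite subr_gt0.
have s3 : (Num.sqrt (cardD K)%:R)^-1 <= e / (C + 1).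
  by near: K; apply: inv_sqrt_card_small; rewrite divr_gt0// ltr_wpDl.
apply: le_trans (cutoff_close K1 lr lr' _ _ t0 (@project_orthant R mu K)) _.
- by lra.
- by lra.
rewrite mulrAC -/C.
apply: le_trans (ler_wpM2l C0 s3) _.
rewrite mulrCA ler_piMr ?(ltW e0)// ler_pdivrMr ?ltr_wpDl// mul1r lerDl//.
Unshelve. all: by end_near. Qed.

End Main.

Theorem theorem1p2 (R : realType) (g : R -> R) (psi : Mplus R -> R)
  (m : R) (lipTV : R) (f : forall K : nat, R -> R * 'cV[R]_(cardD K) -> R)
  (H1_C1 : C1_seg g)
  (H1_m : 0 < m)
  (H1_lb : forall x, seg x -> m <= g x)
  (H2 : forall mu nu : Mplus R, `|psi mu - psi nu| <= lipTV * TV mu nu)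
  (H3 : exists2 a : R, 0 < a & forall K : nat, (1 <= K)%N ->
     exists2 N : set 'cV[R]_(cardD K), lebesgue_null N &
       forall x, open_orthant x -> ~ N x ->
         differentiable (psiK psi) x /\ calK' g a (grad (psiK psi) x))
  (H4 : exists lipW : R, forall P Q : Mplus R, is_prob P -> is_prob Q ->
     `|psi P - psi Q| <= lipW * W P Q)
  (f_sol : forall (K : nat) (rho : R), (1 <= K)%N -> lipTV < rho ->
     [/\ frakL_unif (f K rho),
         viscosity_solution (sfH g m rho) (f K rho) &
         forall x, orthant x -> f K rho (0, x) = psiK psi x]) :
  exists finf : R -> Mplus R -> R,
    forall (t : R) (mu : Mplus R), 0 <= t -> forall rho : R, lipTV < rho ->
      f K rho (t, project K mu) @[K --> \oo] --> finf t mu.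
Proof.
have gc := C1_seg_continuous H1_C1.
have [M gM] := bounded_seg gc.
have [a a0 H3a] := H3.
pose rho1 := lipTV + 1; have lr1 : lipTV < rho1 by rewrite ltrDl.
exists (fun t mu => lim (f K rho1 (t, project K mu) @[K --> \oo])) => t mu t0 rho lr.
have c1 := projections_cauchy H1_m (ltW a0) H1_lb gM H2 H3a f_sol gc (mu := mu) t0 lr1.
have irr := cutoff_irrelevant H1_m (ltW a0) H1_lb gM H2 H3a f_sol mu t0.
apply/cvgrPdist_le => e e0.
have e2 : 0 < e / 2 by rewrite divr_gt0.
have /cvgrPdist_le/(_ _ e2) n1 := c1.
near=> K.
have h1 : `|lim (f K rho1 (t, project K mu) @[K --> \oo]) - f K rho1 (t, project K mu)| <= e / 2.
  by near: K.
have h2 : f K rho1 (t, project K mu) - f K rho (t, project K mu) <= e / 2.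
  by near: K; exact: irr.
have h3 : f K rho (t, project K mu) - f K rho1 (t, project K mu) <= e / 2.
  by near: K; exact: irr.
by move: h1; rewrite !ler_norml => /andP[h4 h5]; apply/andP; split; lra.
Unshelve. all: by end_near. Qed.
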